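(* Suppose Assumption 1 holds and $\Psi$ is directionally pathwise differentiable at $P$ relative to $\mathcal T$ with derivative $\gamma$. Let $V$ be a linear subspace of $\mathcal T$ on which $\gamma$ is linear, with representer $\tilde\psi_V$. An estimator sequence $T_n$ is $V$-efficient if and only if $$\sqrt n\{T_n-\Psi(P)\}=n^{-1/2}\sum_{i=1}^n\tilde\psi_V(X_i)+o_{P^n}(1).$$ Any two $V$-efficient sequences $T_n,T_n'$ satisfy $\sqrt n(T_n-T_n')\to0$ in $P^n$-probability.
   Context: Model. $\mathcal P$ is a set of probability measures on a measurable space, $P\in\mathcal P$ is fixed, $X_1,\dots,X_n$ are i.i.d. observations. $L_2^0(P)$ is the mean-zero subspace of $L_2(P)$, with inner product $\langle\cdot,\cdot\rangle$ and norm $\|\cdot\|$. A DQM path with score $h\in L_2^0(P)$ is a map $t\mapsto P_t\in\mathcal P$, $t\in[0,\varepsilon)$, $P_0=P$, with $\int[(dP_t^{1/2}-dP^{1/2})/t-\tfrac12h\,dP^{1/2}]^2\to0$ as $t\downarrow0$; $P_{t,h}$ denotes such a path, $P_{n,h}:=P_{n^{-1/2},h}$, $P^n_{n,h}$ its $n$-fold product. The tangent space $\mathcal T\subseteq L_2^0(P)$ is a linear subspace. Assumption 1: $\mathcal T$ is closed in $L_2(P)$ and every $h\in\mathcal T$ is the score of some DQM path in $\mathcal P$. Directional pathwise differentiability: there is a positively homogeneous $\gamma:\mathcal T\to\mathbb R$ such that for every $h\in\mathcal T$ and every DQM path with score $h$, $t^{-1}\{\Psi(P_{t,h})-\Psi(P)\}\to\gamma(h)$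 as $t\downarrow0$. (Under Assumption 1, $\gamma$ is then continuous.) $T_n$ is regular along $V$ with limit $L$ if for every $h\in V$ and every DQM path with score $h$, $\sqrt n\{T_n-\Psi(P_{n,h})\}\rightsquigarrow L$ under $P^n_{n,h}$. $\tilde\psi_V\in\overline V$ is the Riesz representer of the continuous extension of $\gamma|_V$ to $\overline V$, and $V_V:=\|\tilde\psi_V\|^2$. $T_n$ is $V$-efficient if it is regular along $V$ with limit $N(0,V_V)$. *)

(* Defs.v *)
From HB Require Import structures.
From mathcomp Require Import all_boot all_order all_algebra.
From mathcomp Require Import all_classical all_reals all_analysis.

Set Implicit Arguments.
Unset Strict Implicit.
Unset Printing Implicit Defensive.

Import Order.TTheory GRing.Theory Num.Theory.
Import numFieldNormedType.Exports.
Local Open Scope classical_set_scope.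
Local Open Scope charge_scope.
Local Open Scope ring_scope.

Section iid_sample.
Context (d : measure_display) (T : measurableType d) (R : realType).

Definition sample_cons n (x : T * n.-tuple T) : n.+1.-tuple T :=
  [tuple of x.1 :: x.2].

Lemma measurable_sample_cons n :
  measurable_fun [set: T * n.-tuple T] (@sample_cons n).
Proof. exact: measurable_cons. Qed.

HB.instance Definition _ n :=
  isMeasurableFun.Build _ _ _ _ (@sample_cons n) (@measurable_sample_cons n).

(* [iid P n] is the n-fold product P^n: P^(n+1) is the image of P \x P^n under
   consing, and P^0 is the unit mass at the empty sample. *)
Fixpoint iid (P : probability T R) (n : nat) : probability (n.-tuple T) R :=
  if n is n'.+1 then
    distribution (P \x iid P n')%E (@sample_cons n')
  else \d_([tuple] : 0.-tuple T).

(* Certifies [iid]: measurable rectangles generate the sigma-algebra of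
   n.-tuple T, so this identity determines the measure. *)
Lemma iid_rectangle (P : probability T R) n (A : 'I_n -> set T) :
  (forall i, measurable (A i)) ->
  iid P n [set x | forall i, A i (tnth x i)] = (\prod_(i < n) P (A i))%E.
Proof.
elim: n A => [|n IH] A mA.
  by rewrite big_ord0 /= diracE mem_set// => -[].
have mB (A' : 'I_n -> set T) : (forall i, measurable (A' i)) ->
    measurable [set x : n.-tuple T | forall i, A' i (tnth x i)].
  move=> mA'.
  rewrite (_ : [set _ | _] = \bigcap_i ((@tnth _ T ^~ i) @^-1` A' i)).
    apply: fin_bigcap_measurable => [|i _]; first exact: finite_finset.
    by rewrite -[X in measurable X]setTI; exact: measurable_tnth.
  by apply/seteqP; split => x /= Ax i; [move=> _|]; exact: Ax.
rewrite big_ord_recl -(IH (fun i => A (lift ord0 i))) //= /distribution.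
rewrite /pushforward /= -product_measure1E//; last first.
  by apply: (mB (fun i => A (lift ord0 i))) => i; exact: mA.
congr product_measure1; apply/seteqP; split => -[x y] /=.
  move=> Axy; split; first by have := Axy ord0.
  by move=> i; have := Axy (lift ord0 i); rewrite tnthS.
move=> [Ax Ay] i; have [j ->|->//] := unliftP ord0 i.
by rewrite tnthS; exact: Ay.
Qed.

End iid_sample.

Section L2.
Context (d : measure_display) (T : measurableType d) (R : realType).
Variable P : probability T R.

(* Square-integrable functions, as representatives: they are not quotiented by
   almost-everywhere equality, so [L2norm] is only a seminorm on [L2]. *)
Definition L2 : Type := LfunType P (lee1n 2).
HB.instance Definition _ := GRing.Lmodule.on L2.

Definition L2norm (h : L2) : R := fine ('N[P]_2%:E[EFin \o h])%E.

Definition L2inner (h k : L2) : R := \int[P]_x (h x * k x).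

Definition L20 : set L2 := [set h : L2 | \int[P]_x h x = 0].

Definition linear_subspace (V : set L2) : Prop :=
  V 0 /\ forall (a : R) (h k : L2), V h -> V k -> V (a *: h + k).

Definition L2closure (V : set L2) : set L2 :=
  [set h : L2 | forall e : R, 0 < e -> exists2 k : L2, V k & L2norm (h - k) < e].

Definition L2closed (V : set L2) : Prop := L2closure V `<=` V.

Definition L2continuous_on (V : set L2) (g : L2 -> R) : Prop :=
  forall h, V h -> forall e : R, 0 < e ->
    exists2 delta : R, 0 < delta &
      forall k, V k -> L2norm (k - h) < delta -> `|g k - g h| < e.

Definition linear_on (V : set L2) (g : L2 -> R) : Prop :=
  forall (a : R) (h k : L2), V h -> V k -> g (a *: h + k) = a * g h + g k.

Definition positively_homogeneous_on (V : set L2) (g : L2 -> R) : Prop :=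
  forall (a : R) (h : L2), 0 <= a -> V h -> g (a *: h) = a * g h.

(* psi is the Riesz representer of the continuous extension (called g) of
   gamma|_V to the closure of V. *)
Definition riesz_representer (V : set L2) (gamma : L2 -> R) (psi : L2) : Prop :=
  L2closure V psi /\
  exists g : L2 -> R,
    [/\ forall h, V h -> g h = gamma h,
        L2continuous_on (L2closure V) g &
        forall h, L2closure V h -> g h = L2inner psi h].

End L2.

Section dominating.
Context (d : measure_display) (T : measurableType d) (R : realType).
Variables Q P : probability T R.

Definition dominating : set T -> \bar R := measure_add Q P.

HB.instance Definition _ := Measure.on dominating.

Let dominating_fin : fin_num_fun dominating.
Proof.
by move=> A mA; rewrite /dominating measure_addE fin_numD !fin_num_measure.
Qed.

HB.instance Definition _ := @Measure_isFinite.Build _ _ _ dominating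
  dominating_fin.

End dominating.

(* A version of the square root density (dS/d(Q+P))^(1/2), for S = Q or P. *)
Definition root_density (d : measure_display) (T : measurableType d)
    (R : realType) (Q P S : probability T R) (x : T) : R :=
  Num.sqrt (fine (('d (charge_of_finite_measure S) '/d (dominating Q P)) x)).

Section model.
Context (d : measure_display) (T : measurableType d) (R : realType).
Variables (calP : set (probability T R)) (P : probability T R).

(* The integral of [(dP_t^(1/2) - dP^(1/2))/t - h dP^(1/2)/2]^2; it does not
   depend on the dominating measure, and P_t + P always dominates both. *)
Definition DQM_remainder (h : L2 P) (Pt : R -> probability T R) (t : R)
    : \bar R :=
  (\int[dominating (Pt t) P]_x
     (((root_density (Pt t) P (Pt t) x - root_density (Pt t) P P x) / t
       - 2^-1 * h x * root_density (Pt t) P P x) ^+ 2)%:E)%E.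

(* The values of Pt outside [0, eps) are irrelevant. *)
Definition DQM_path (h : L2 P) (Pt : R -> probability T R) : Prop :=
  [/\ L20 h,
      exists2 eps : R, 0 < eps & forall t, 0 <= t < eps -> calP (Pt t),
      Pt 0 = P &
      DQM_remainder h Pt t @[t --> 0^'+] --> 0%E].

Definition assumption1 (TS : set (L2 P)) : Prop :=
  L2closed TS /\ forall h, TS h -> exists Pt, DQM_path h Pt.

(* Psi and gamma are only ever used on calP and TS respectively. *)
Definition directionally_differentiable (TS : set (L2 P))
    (Psi : probability T R -> R) (gamma : L2 P -> R) : Prop :=
  positively_homogeneous_on TS gamma /\
  forall h, TS h -> forall Pt, DQM_path h Pt ->
    t^-1 * (Psi (Pt t) - Psi P) @[t --> 0^'+] --> gamma h.

End model.

Section estimators.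
Context (d : measure_display) (T : measurableType d) (R : realType).

Definition estimator : Type := forall n : nat, {mfun n.-tuple T >-> R}.

Definition weak_cvg (Q : forall n, probability (n.-tuple T) R)
    (Z : forall n, n.-tuple T -> R) (L : probability (measurableTypeR R) R)
    : Prop :=
  forall f : R -> R, continuous f -> (exists M : R, forall y, `|f y| <= M) ->
    \int[Q n]_x f (Z n x) @[n --> \oo] --> \int[L]_y f y.

Definition cvg_in_prob0 (Q : forall n, probability (n.-tuple T) R)
    (Z : forall n, n.-tuple T -> R) : Prop :=
  forall e : R, 0 < e -> Q n [set x | e < `|Z n x|] @[n --> \oo] --> 0%E.

(* N(0, v); the library's [normal_prob] is not a point mass when its standard
   deviation is 0, so the degenerate case is treated apart. *)
Definition centered_normal (v : R) : probability (measurableTypeR R) R :=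
  if v == 0 then (\d_(0 : measurableTypeR R) : probability (measurableTypeR R) R)
  else normal_prob 0 (Num.sqrt v).

Variables (calP : set (probability T R)) (P : probability T R).
Variable Psi : probability T R -> R.

Definition regular_along (V : set (L2 P)) (Tn : estimator)
    (L : probability (measurableTypeR R) R) : Prop :=
  forall h, V h -> forall Pt, DQM_path calP h Pt ->
    let Pn n := Pt (Num.sqrt n%:R)^-1 in
    weak_cvg (fun n => iid (Pn n) n)
      (fun n x => Num.sqrt n%:R * (Tn n x - Psi (Pn n))) L.

(* The representer psi of gamma|_V enters through the efficient variance. *)
Definition efficient (V : set (L2 P)) (psi : L2 P) (Tn : estimator) : Prop :=
  regular_along V Tn (centered_normal (L2norm psi ^+ 2)).

Definition asymptotically_linear (psi : L2 P) (Tn : estimator) : Prop :=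
  cvg_in_prob0 (iid P) (fun n x =>
    Num.sqrt n%:R * (Tn n x - Psi P)
    - (Num.sqrt n%:R)^-1 * \sum_(i < n) psi (tnth x i)).

End estimators.

(* Main.v *)
(** An asymptotically linear sequence is regular by a local central limit
    theorem: under the local laws the score sum of psi is asymptotically normal
    with mean <psi, h>, and remainders that vanish under P^n vanish under the
    local laws by contiguity.  It comes from replacing the summands
    one at a time by normal variables and Taylor expanding a smooth test
    function; DQM controls each replacement through root densities.

    Conversely, let S_n = sqrt n (T_n - Psi(P)) and let F_n be its truncation
    at a level M.  Under P and under the local law of the direction a h,
    regularity gives the limit of the mean of F_n.  Expanding the local law to
    first order, the difference of the two means is a E[F_n Delta_n(h)] up to
    O(M a^2), where Delta_n(h) is the normalised score sum, so E[F_n Delta_n(h)]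
    is close to <psi, h>, first for h in V and then for h = psi by density.
    Since E[F_n^2], E[F_n Delta_n(psi)] and E[Delta_n(psi)^2] are all close to
    |psi|^2, E[(F_n - Delta_n(psi))^2] is small. *)

Require Import Defs.
From HB Require Import structures.
From mathcomp Require Import all_boot all_order all_algebra.
From mathcomp Require Import all_classical all_reals all_analysis.
From mathcomp Require Import measurable_realfun ring lra.

Set Implicit Arguments.
Unset Strict Implicit.
Unset Printing Implicit Defensive.

Import Order.TTheory GRing.Theory Num.Theory.
Import numFieldNormedType.Exports.
Local Open Scope classical_set_scope.
Local Open Scope ring_scope.

(** * Real-valued integrals *)

(** Local laws may be singular to P and densities may vanish, so no logarithm of a likelihood ratio
    is expanded. Products of root densities are root densities of the products, and every n-fold
    integral reduces to one-coordinate inner products in L2 and powers of the Hellinger affinity.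

    The converse gets by with a first-order expansion because the direction may be rescaled: for
    fixed a the error is of order M a^2 as n grows, hence small after division by a. The order of
    choices is therefore: the level M, then a, then n. The truncation is there because S_n comes
    with a weak limit but no moments. The level has the form M = N + 1, so that a shift by at most 1
    acts on [-N, N] as an exact translation; what happens outside costs a fraction tau = |psi|^2 /
    N^2, by Chebyshev's inequality for the normal limit.

    Regularity is known along V alone, while psi lies in the closure of V. The passage to psi is
    uniform in n because F_n is bounded and h -> Delta_n(h) is an isometry on centred functions. *)

Notation Rintegrable mu f := (mu.-integrable [set: _] (EFin \o f)).

Section real_integrals.
Context (d : measure_display) (T : measurableType d) (R : realType).
Variable mu : {finite_measure set T -> \bar R}.
Implicit Types f g : T -> R.

Lemma Rintegrable_measurable f : Rintegrable mu f -> measurable_fun setT f.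
Proof. by case/integrableP => /measurable_EFinP. Qed.

Lemma Rintegrable_le f g : measurable_fun setT f -> (forall x, `|f x| <= g x) ->
  Rintegrable mu g -> Rintegrable mu f.
Proof.
move=> mf fg ig; apply: le_integrable ig => //; first exact/measurable_EFinP.
by move=> x _ /=; rewrite lee_fin (le_trans (fg x)) ?ler_norm.
Qed.

Lemma Rintegrable_bounded f (M : R) : measurable_fun setT f ->
  (forall x, `|f x| <= M) -> Rintegrable mu f.
Proof.
move=> mf fM; apply: (@Rintegrable_le _ (cst M)) => //.
exact: finite_measure_integrable_cst.
Qed.

Lemma RintegrableD f g : Rintegrable mu f -> Rintegrable mu g ->
  Rintegrable mu (fun x => f x + g x).
Proof. by move=> fi gi; exact: (integrableD _ fi gi). Qed.

Lemma RintegrableB f g : Rintegrable mu f -> Rintegrable mu g ->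
  Rintegrable mu (fun x => f x - g x).
Proof. by move=> fi gi; exact: (integrableB _ fi gi). Qed.

Lemma RintegrableZ (a : R) f : Rintegrable mu f ->
  Rintegrable mu (fun x => a * f x).
Proof. by move=> fi; exact: (integrableZl _ _ fi). Qed.

Lemma Rintegrable_norm f : Rintegrable mu f -> Rintegrable mu (fun x => `|f x|).
Proof. exact: integrable_norm. Qed.

Lemma EFin_Rintegral f : Rintegrable mu f ->
  (\int[mu]_x f x)%:E = (\int[mu]_x (f x)%:E)%E.
Proof. by move=> fi; rewrite fineK//; exact: integrable_fin_num fi. Qed.

Lemma Rintegral_le f g : Rintegrable mu f -> Rintegrable mu g ->
  (forall x, f x <= g x) -> \int[mu]_x f x <= \int[mu]_x g x.
Proof. by move=> fi gi fg; apply: le_Rintegral. Qed.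

Lemma Rintegral_norm_le f g : Rintegrable mu f -> Rintegrable mu g ->
  (forall x, `|f x| <= g x) -> `|\int[mu]_x f x| <= \int[mu]_x g x.
Proof.
move=> fi gi fg; apply: (le_trans (le_normr_Rintegral _ fi)) => //.
by apply: Rintegral_le => //; exact: Rintegrable_norm.
Qed.

Lemma eq_Rintegrable f g : f =1 g -> Rintegrable mu f -> Rintegrable mu g.
Proof. by move=> /funext ->. Qed.

Lemma Rintegral_ext f g : f =1 g -> \int[mu]_x f x = \int[mu]_x g x.
Proof. by move=> fg; apply: eq_Rintegral => x _; exact: fg. Qed.

Definition sq_integrable f :=
  measurable_fun setT f /\ Rintegrable mu (fun x => f x ^+ 2).

Lemma sq_integrable_mul f g : sq_integrable f -> sq_integrable g ->
  Rintegrable mu (fun x => f x * g x).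
Proof.
move=> [mf fi] [mg gi]; apply: Rintegrable_le (RintegrableD fi gi).
  exact: measurable_funM.
move=> x; rewrite normrM -(real_normK (num_real (f x))).
rewrite -(real_normK (num_real (g x))).
have := sqr_ge0 (`|f x| - `|g x|); have := normr_ge0 (f x).
have := normr_ge0 (g x); nra.
Qed.

Lemma sq_integrableD f g : sq_integrable f -> sq_integrable g ->
  sq_integrable (fun x => f x + g x).
Proof.
move=> sf sg; case: (sf) (sg) => [mf fi] [mg gi]; split.
  exact: measurable_funD.
have fgi := RintegrableZ 2 (sq_integrable_mul sf sg).
apply: eq_integrable (RintegrableD (RintegrableD fi gi) fgi) => // x _ /=.
by congr EFin; ring.
Qed.

Lemma sq_integrableZ a f : sq_integrable f -> sq_integrable (fun x => a * f x).
Proof.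
move=> [mf fi]; split; first exact: measurable_funM.
apply: eq_integrable (RintegrableZ (a ^+ 2) fi) => // x _ /=.
by congr EFin; ring.
Qed.

Lemma sq_integrableB f g : sq_integrable f -> sq_integrable g ->
  sq_integrable (fun x => f x - g x).
Proof.
move=> sf /(sq_integrableZ (-1)) sg; have := sq_integrableD sf sg.
by under eq_fun do rewrite mulN1r.
Qed.

Lemma sq_integrable_bounded f (M : R) : measurable_fun setT f ->
  (forall x, `|f x| <= M) -> sq_integrable f.
Proof.
move=> mf fM; split => //; apply: (@Rintegrable_bounded _ (M ^+ 2)).
  exact: measurable_funX.
by move=> x; rewrite normrX lerXn2r// nnegrE (le_trans _ (fM x)).
Qed.

Lemma sq_integrable_le f g : measurable_fun setT f ->
  (forall x, `|f x| <= `|g x|) -> sq_integrable g -> sq_integrable f.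
Proof.
move=> mf fg [mg gi]; split=> //; apply: Rintegrable_le gi.
  exact: measurable_funX.
move=> x; rewrite normrX -[leRHS]real_normK ?num_real//.
by rewrite lerXn2r ?nnegrE.
Qed.

Lemma sq_integrable_integrable f : sq_integrable f -> Rintegrable mu f.
Proof.
move=> sf; have s1 : sq_integrable (cst 1).
  by apply: (@sq_integrable_bounded _ 1) => // x; rewrite normr1.
by apply: eq_integrable (sq_integrable_mul sf s1) => // x _ /=; rewrite mulr1.
Qed.

Lemma Rintegral_sqr_ge0 f : 0 <= \int[mu]_x (f x ^+ 2).
Proof. by apply: Rintegral_ge0 => x _; exact: sqr_ge0. Qed.

Lemma Rintegral_sqrD f g : sq_integrable f -> sq_integrable g ->
  \int[mu]_x ((f x + g x) ^+ 2) =
  \int[mu]_x (f x ^+ 2) + 2 * \int[mu]_x (f x * g x) + \int[mu]_x (g x ^+ 2).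
Proof.
move=> sf sg; have fgi := sq_integrable_mul sf sg.
rewrite -RintegralZl// -RintegralD//; [|exact: sf.2|exact: RintegrableZ].
rewrite -RintegralD//; [|exact: RintegrableD sf.2 (RintegrableZ _ fgi)|].
  by apply: Rintegral_ext => x; ring.
exact: sg.2.
Qed.

Lemma cauchy_schwarz f g : sq_integrable f -> sq_integrable g ->
  (\int[mu]_x (f x * g x)) ^+ 2 <=
  \int[mu]_x (f x ^+ 2) * \int[mu]_x (g x ^+ 2).
Proof.
move=> sf sg.
set A := \int[mu]_x (f x ^+ 2); set B := \int[mu]_x (g x ^+ 2).
set C := \int[mu]_x (f x * g x).
have H t : 0 <= A + 2 * t * C + t ^+ 2 * B.
  have := Rintegral_sqr_ge0 (fun x => f x + t * g x).
  rewrite Rintegral_sqrD//; last exact: sq_integrableZ.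
  under [X in _ + _ * X]eq_Rintegral do rewrite mulrCA.
  under [X in _ + X]eq_Rintegral do rewrite exprMn.
  rewrite RintegralZl ?RintegralZl//; [|exact: sg.2|exact: sq_integrable_mul].
  by rewrite -/A -/B -/C mulrA.
have B0 : 0 <= B by exact: Rintegral_sqr_ge0.
have [B00|Bn0] := eqVneq B 0.
  have [->|Cn0] := eqVneq C 0; first by rewrite expr0n/= B00 mulr0.
  (* With B = 0 the quadratic is affine in t, and at this t it equals -1. *)
  have := H (- (A + 1) / (2 * C)); rewrite B00 mulr0 addr0.
  rewrite mulrA -(mulrA _ _ C) invfM; have -> : 2 * (- (A + 1)) * (2^-1 * C^-1 * C) = - (A + 1).
    by rewrite mulfVK//; field.
  lra.
have Bp : 0 < B by rewrite lt_neqAle eq_sym Bn0.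
have := H (- C / B).
have -> : A + 2 * (- C / B) * C + (- C / B) ^+ 2 * B = (A * B - C ^+ 2) / B by field.
by rewrite pmulr_lge0 ?invr_gt0// subr_ge0.
Qed.

Lemma cauchy_schwarz_le f g (a b : R) : sq_integrable f -> sq_integrable g ->
  0 <= a -> 0 <= b ->
  \int[mu]_x (f x ^+ 2) <= a ^+ 2 -> \int[mu]_x (g x ^+ 2) <= b ^+ 2 ->
  `|\int[mu]_x (f x * g x)| <= a * b.
Proof.
move=> sf sg a0 b0 fa gb; rewrite -ler_sqr ?nnegrE ?mulr_ge0//.
rewrite real_normK ?num_real// exprMn.
apply: (le_trans (cauchy_schwarz sf sg)).
by apply: ler_pM => //; exact: Rintegral_sqr_ge0.
Qed.

End real_integrals.

(** * Product measures and densities *)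

(** Fixes the structure of a probability on the product, so that the lemmas on finite measures apply
    to it. *)
Definition prodP (d1 d2 : measure_display) (T1 : measurableType d1)
    (T2 : measurableType d2) (R : realType)
    (m1 : probability T1 R) (m2 : probability T2 R) :
  probability (T1 * T2)%type R := (m1 \x m2)%E.

Lemma Rintegral_prob_cst (d : measure_display) (T : measurableType d)
  (R : realType) (P : probability T R) (c : R) : \int[P]_x c = c.
Proof. by rewrite Rintegral_cst//= probability_setT mulr1. Qed.

Section product_integrals.
Context (d1 d2 : measure_display) (T1 : measurableType d1).
Context (T2 : measurableType d2) (R : realType).
Variables (m1 : probability T1 R) (m2 : probability T2 R).

Lemma Rintegral_prod (F : T1 * T2 -> R) : Rintegrable (prodP m1 m2) F ->
  (\int[prodP m1 m2]_z F z)%:E = (\int[m1]_x \int[m2]_y (F (x, y))%:E)%E.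
Proof. by move=> iF; rewrite (EFin_Rintegral iF) -(integral12_prod_meas1 iF). Qed.

Lemma Rintegrable_tensor (u : T1 -> R) (w : T2 -> R) :
  Rintegrable m1 u -> Rintegrable m2 w ->
  Rintegrable (prodP m1 m2) (fun z => u z.1 * w z.2).
Proof.
move=> iu iw; have mu := Rintegrable_measurable iu.
have mw := Rintegrable_measurable iw.
have mF : measurable_fun setT (fun z : T1 * T2 => (u z.1 * w z.2)%:E).
  apply/measurable_EFinP/measurable_funM.
    exact: measurableT_comp mu measurable_fst.
  exact: measurableT_comp mw measurable_snd.
apply: (iffRL (@integrable12ltyP _ _ _ _ _ m1 m2 _ mF)).
under eq_integral => x _.
  under eq_integral => y _ do rewrite /= normrM EFinM.
  rewrite ge0_integralZl//; first over.
  by do 2 apply: measurableT_comp => //.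
rewrite ge0_integralZr//.
- apply: lte_mul_pinfty => //; first exact: integral_ge0.
    by case/integrableP: iu => ? ?; rewrite ge0_fin_numE// integral_ge0.
  by case/integrableP: iw.
- by do 2 apply: measurableT_comp => //.
- exact: integral_ge0.
Qed.

Lemma Rintegral_tensor (u : T1 -> R) (w : T2 -> R) :
  Rintegrable m1 u -> Rintegrable m2 w ->
  \int[prodP m1 m2]_z (u z.1 * w z.2) = \int[m1]_x u x * \int[m2]_y w y.
Proof.
move=> iu iw; apply: EFin_inj; rewrite Rintegral_prod; last first.
  exact: Rintegrable_tensor.
under eq_integral => x _.
  under eq_integral => y _ do rewrite /= EFinM.
  rewrite integralZl// -EFin_Rintegral//; over.
by rewrite integralZr// -EFin_Rintegral// -EFinM.
Qed.

Variables (F : T1 * T2 -> R) (M : R).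
Hypotheses (mF : measurable_fun setT F) (FM : forall z, `|F z| <= M).

Let iF : Rintegrable (prodP m1 m2) F.
Proof. exact: Rintegrable_bounded FM. Qed.

Let iF2 x : Rintegrable m2 (fun y => F (x, y)).
Proof.
apply: Rintegrable_bounded (fun y => FM (x, y)).
exact: measurableT_comp mF (measurable_pair1 x).
Qed.

Let iF1 y : Rintegrable m1 (fun x => F (x, y)).
Proof.
apply: Rintegrable_bounded (fun x => FM (x, y)).
exact: measurableT_comp mF (measurable_pair2 y).
Qed.

Lemma Rintegrable_section2 : Rintegrable m1 (fun x => \int[m2]_y F (x, y)).
Proof.
apply: eq_integrable (integrable_fubini_F iF) => // x _ /=.
by rewrite EFin_Rintegral.
Qed.

Lemma Rintegrable_section1 : Rintegrable m2 (fun y => \int[m1]_x F (x, y)).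
Proof.
apply: (@Rintegrable_bounded _ _ _ _ _ M).
  exact: measurableT_comp (measurable_fubini_G iF).
move=> y; apply: (le_trans (Rintegral_norm_le (iF1 y) _ (fun x => FM (x, y)))).
  exact: finite_measure_integrable_cst.
by rewrite Rintegral_prob_cst.
Qed.

(** A bounded integrand has only integrable sections, so the iterated real-valued integral involves
    no exceptional null set. *)
Lemma Rintegral_fubini12 :
  \int[prodP m1 m2]_z F z = \int[m1]_x \int[m2]_y F (x, y).
Proof.
apply: EFin_inj; rewrite Rintegral_prod// EFin_Rintegral.
  by apply: eq_integral => x _; rewrite EFin_Rintegral.
exact: Rintegrable_section2.
Qed.

Lemma Rintegral_fubini :
  \int[m1]_x \int[m2]_y F (x, y) = \int[m2]_y \int[m1]_x F (x, y).
Proof.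
rewrite -Rintegral_fubini12; apply: EFin_inj.
rewrite EFin_Rintegral// -integral21_prod_meas1// EFin_Rintegral.
  by apply: eq_integral => x _; rewrite EFin_Rintegral.
exact: Rintegrable_section1.
Qed.

End product_integrals.

Section densities.
Context (d : measure_display) (T : measurableType d) (R : realType).
Variables (P nu : probability T R).
Implicit Types (p F : T -> R).

(** Tested on nonnegative extended-valued functions instead of sets: in this form the property
    passes to n-fold products by Tonelli's theorem alone. *)
Definition is_density p :=
  [/\ measurable_fun setT p, forall t, 0 <= p t &
   forall F : T -> \bar R, measurable_fun setT F -> (forall t, 0 <= F t)%E ->
     (\int[P]_t F t = \int[nu]_t (F t * (p t)%:E))%E].

(* No integrability is needed: both sides are the difference of the integrals
   of the positive and negative parts. *)
Lemma integral_density p F : is_density p -> measurable_fun setT F ->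
  (\int[P]_x (F x)%:E = \int[nu]_x (F x * p x)%:E)%E.
Proof.
move=> [mp p0 dens] mF.
have mF' : measurable_fun setT (EFin \o F) by exact/measurable_EFinP.
rewrite [LHS]integralE [RHS]integralE; congr (_ - _)%E.
- rewrite dens//; last exact: measurable_funepos.
  apply: eq_integral => x _; rewrite !funeposE /= -!EFin_max -EFinM.
  by rewrite maxr_pMl ?mul0r.
- rewrite dens//; last exact: measurable_funeneg.
  apply: eq_integral => x _; rewrite !funenegE /= -!EFin_max -EFinM.
  by rewrite maxr_pMl ?mul0r ?mulNr.
Qed.

Lemma Rintegral_density p F : is_density p -> measurable_fun setT F ->
  \int[P]_x F x = \int[nu]_x (F x * p x).
Proof. by move=> dens mF; congr fine; exact: integral_density. Qed.

Lemma Rintegrable_density p F : is_density p ->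
  Rintegrable P F -> Rintegrable nu (fun x => F x * p x).
Proof.
move=> dens iF; have [mp p0 _] := dens; have mF := Rintegrable_measurable iF.
apply/integrableP; split; first by apply/measurable_EFinP/measurable_funM.
case/integrableP: iF => _; under eq_integral do rewrite /=.
rewrite (integral_density (F := fun x => `|F x|) dens); last exact: measurableT_comp.
by under [X in (_ -> X < _)%E]eq_integral do rewrite /= normrM (ger0_norm (p0 _)).
Qed.

End densities.

Section iid_integrals.
Context (d : measure_display) (T : measurableType d) (R : realType).
Implicit Types (P nu : probability T R) (k g : T -> R).

Definition tsum n (k : T -> R) (x : n.-tuple T) : R := \sum_(i < n) k (tnth x i).
Definition tprod n (g : T -> R) (x : n.-tuple T) : R := \prod_(i < n) g (tnth x i).

Lemma tsumS n k (z : T * n.-tuple T) :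
  tsum k (sample_cons z) = k z.1 + tsum k z.2.
Proof.
by rewrite /tsum big_ord_recl; congr (_ + _); apply: eq_bigr => i _; rewrite tnthS.
Qed.

Lemma tprodS n g (z : T * n.-tuple T) :
  tprod g (sample_cons z) = g z.1 * tprod g z.2.
Proof.
by rewrite /tprod big_ord_recl; congr (_ * _); apply: eq_bigr => i _; rewrite tnthS.
Qed.

Lemma measurable_tsum n k : measurable_fun setT k ->
  measurable_fun setT (@tsum n k).
Proof.
move=> mk; apply: measurable_sum => i.
exact: measurableT_comp mk (measurable_tnth i).
Qed.

Lemma measurable_tprod n g : measurable_fun setT g ->
  measurable_fun setT (@tprod n g).
Proof.
move=> mk; apply: measurable_prod => i _.
exact: measurableT_comp mk (measurable_tnth i).
Qed.

Lemma tprod_ge0 n g (x : n.-tuple T) : (forall t, 0 <= g t) -> 0 <= tprod g x.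
Proof. by move=> g0; apply: prodr_ge0 => i _. Qed.

Lemma tprodM n g k (x : n.-tuple T) :
  tprod g x * tprod k x = tprod (fun t => g t * k t) x.
Proof. by rewrite /tprod big_split. Qed.

Lemma tprodX n g (x : n.-tuple T) : tprod g x ^+ 2 = tprod (fun t => g t ^+ 2) x.
Proof. by rewrite /tprod prodrXl. Qed.

Lemma Rintegrable_iidS P n (F : n.+1.-tuple T -> R) : measurable_fun setT F ->
  Rintegrable (prodP P (iid P n)) (F \o @sample_cons _ T n) ->
  Rintegrable (iid P n.+1) F.
Proof. by move=> mF iF; apply: integrable_pushforward => //; exact/measurable_EFinP. Qed.

Lemma Rintegral_iidS P n (F : n.+1.-tuple T -> R) : measurable_fun setT F ->
  Rintegrable (prodP P (iid P n)) (F \o @sample_cons _ T n) ->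
  \int[iid P n.+1]_x F x = \int[prodP P (iid P n)]_z F (sample_cons z).
Proof.
move=> mF iF; congr fine.
by rewrite integral_distribution//; exact/measurable_EFinP.
Qed.

Lemma ge0_integral_iidS P n (F : n.+1.-tuple T -> \bar R) :
  measurable_fun setT F -> (forall x, 0 <= F x)%E ->
  (\int[iid P n.+1]_x F x =
   \int[P]_x \int[iid P n]_y F (sample_cons (x, y)))%E.
Proof.
move=> mF F0; rewrite ge0_integral_distribution//.
rewrite fubini_tonelli1//.
- exact: measurableT_comp mF (@measurable_sample_cons _ T n).
- by move=> x; exact: F0.
Qed.

Lemma integral_iid0 P (F : 0.-tuple T -> \bar R) :
  (\int[iid P 0]_x F x = F [tuple])%E.
Proof.
rewrite /= (_ : F = cst (F [tuple])).
  by rewrite integral_cst//= diracT mule1.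
by apply/funext => x; rewrite (tuple0 x).
Qed.

Lemma Rintegral_iid0 P (F : 0.-tuple T -> R) : \int[iid P 0]_x F x = F [tuple].
Proof. by rewrite /Rintegral integral_iid0. Qed.

Lemma Rintegrable_iid0 P (F : 0.-tuple T -> R) : Rintegrable (iid P 0) F.
Proof.
apply: (@Rintegrable_bounded _ _ _ _ _ `|F [tuple]|) => [|x]; last first.
  by rewrite (tuple0 x).
rewrite (_ : F = cst (F [tuple]))//; apply/funext => x.
by rewrite (tuple0 x).
Qed.

Lemma Rintegrable_tprod P n g : Rintegrable P g -> Rintegrable (iid P n) (tprod g).
Proof.
move=> ig; elim: n => [|n IH]; first exact: Rintegrable_iid0.
apply: Rintegrable_iidS; first exact: measurable_tprod (Rintegrable_measurable ig).
apply: eq_integrable (Rintegrable_tensor ig IH) => // z _ /=.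
by rewrite tprodS.
Qed.

Lemma Rintegral_tprod P n g : Rintegrable P g ->
  \int[iid P n]_x tprod g x = (\int[P]_t g t) ^+ n.
Proof.
move=> ig; elim: n => [|n IH]; first by rewrite Rintegral_iid0 /tprod big_ord0.
rewrite Rintegral_iidS; first last.
- apply: eq_integrable (Rintegrable_tensor ig (Rintegrable_tprod n ig)) => // z _ /=.
  by rewrite tprodS.
- exact: measurable_tprod (Rintegrable_measurable ig).
rewrite exprS -IH -(Rintegral_tensor ig (Rintegrable_tprod n ig)).
by apply: Rintegral_ext => z; rewrite tprodS.
Qed.

(* Summing over the coordinate carrying [k], the remaining n-1 coordinates each
   contribute a factor [g]. *)
Lemma Rintegral_tsum_tprod P n k g : measurable_fun setT k ->
  Rintegrable P g -> Rintegrable P (fun t => k t * g t) ->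
  Rintegrable (iid P n) (fun x => tsum k x * tprod g x) /\
  \int[iid P n]_x (tsum k x * tprod g x) =
  n%:R * (\int[P]_t (k t * g t)) * (\int[P]_t g t) ^+ n.-1.
Proof.
move=> mk ig ikg; have mg := Rintegrable_measurable ig.
elim: n => [|n [IH1 IH2]].
  split; first exact: Rintegrable_iid0.
  by rewrite Rintegral_iid0 /tsum big_ord0 !mul0r.
have ip := Rintegrable_tprod n ig.
have i1 := Rintegrable_tensor ikg ip; have i2 := Rintegrable_tensor ig IH1.
have E z : (k z.1 * g z.1) * tprod g z.2 + g z.1 * (tsum k z.2 * tprod g z.2) =
    tsum k (sample_cons z) * tprod g (sample_cons z) :> R.
  by rewrite tsumS tprodS; ring.
have mF : measurable_fun setT (fun x : n.+1.-tuple T => tsum k x * tprod g x).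
  by apply: measurable_funM; [exact: measurable_tsum|exact: measurable_tprod].
have iF : Rintegrable (prodP P (iid P n)) ((fun x : n.+1.-tuple T => tsum k x * tprod g x) \o
    @sample_cons _ T n).
  by apply: eq_integrable (RintegrableD i1 i2) => // z _ /=; rewrite -E.
split; first exact: Rintegrable_iidS.
rewrite Rintegral_iidS//; under eq_Rintegral do rewrite -E.
rewrite RintegralD// (Rintegral_tensor ikg ip) (Rintegral_tensor ig IH1).
rewrite Rintegral_tprod// IH2.
case: n {IH1 IH2 ip i1 i2 E mF iF} => [|n] /=; first by rewrite expr0; ring.
by rewrite exprS (natrD _ 1 n.+1); ring.
Qed.

Lemma sq_integrable_tsum P n k : sq_integrable P k ->
  sq_integrable (iid P n) (tsum k).
Proof.
move=> sk; have mk := sk.1; elim: n => [|n [_ IH]].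
  split; first exact: measurable_tsum.
  exact: Rintegrable_iid0.
split; first exact: measurable_tsum.
have ik := sq_integrable_integrable sk.
have one : Rintegrable P (cst 1) by exact: finite_measure_integrable_cst.
have one' : Rintegrable (iid P n) (cst 1) by exact: finite_measure_integrable_cst.
have is_ : Rintegrable (iid P n) (tsum k).
  by apply: sq_integrable_integrable; split => //; exact: measurable_tsum.
apply: Rintegrable_iidS; first by apply: measurable_funX; exact: measurable_tsum.
have i1 := Rintegrable_tensor sk.2 one'; have i2 := Rintegrable_tensor one IH.
have i3 := RintegrableZ 2 (Rintegrable_tensor ik is_).
apply: eq_integrable (RintegrableD i1 (RintegrableD i2 i3)) => // z _ /=.
by rewrite tsumS; congr EFin; ring.
Qed.

Lemma Rintegral_tsum_sqr P n k : sq_integrable P k -> \int[P]_t k t = 0 ->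
  \int[iid P n]_x (tsum k x ^+ 2) = n%:R * \int[P]_t (k t ^+ 2).
Proof.
move=> sk k0; have mk := sk.1; elim: n => [|n IH].
  by rewrite Rintegral_iid0 /tsum big_ord0 expr0n mul0r.
have ik := sq_integrable_integrable sk.
have one : Rintegrable P (cst 1) by exact: finite_measure_integrable_cst.
have one' : Rintegrable (iid P n) (cst 1) by exact: finite_measure_integrable_cst.
have ss := sq_integrable_tsum n sk.
have is_ := sq_integrable_integrable ss.
have i1 := Rintegrable_tensor sk.2 one'; have i2 := Rintegrable_tensor one ss.2.
have i3' := Rintegrable_tensor ik is_; have i3 := RintegrableZ 2 i3'.
have E z : k z.1 ^+ 2 * 1 + (1 * tsum k z.2 ^+ 2 + 2 * (k z.1 * tsum k z.2)) =
    tsum k (sample_cons z) ^+ 2 :> R by rewrite tsumS; ring.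
have iF : Rintegrable (prodP P (iid P n)) ((fun x : n.+1.-tuple T => tsum k x ^+ 2) \o
    @sample_cons _ T n).
  by apply: eq_integrable (RintegrableD i1 (RintegrableD i2 i3)) => // z _ /=; rewrite -E.
rewrite Rintegral_iidS//; last by apply: measurable_funX; exact: measurable_tsum.
under eq_Rintegral do rewrite -E.
rewrite RintegralD//; last exact: RintegrableD.
have /= e1 := Rintegral_tensor sk.2 one'.
have /= e2 := Rintegral_tensor one ss.2.
rewrite RintegralD// e1 e2 RintegralZl// (Rintegral_tensor ik is_) k0 IH.
rewrite !Rintegral_prob_cst.
by rewrite (natrD _ 1 n); ring.
Qed.

(** Tonelli splits off the first coordinate, [dens] changes its law, and the induction hypothesis
    changes the law of the others. *)
Lemma ge0_integral_density_iid P nu p : is_density P nu p ->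
  forall n (F : n.-tuple T -> \bar R), measurable_fun setT F ->
  (forall x, 0 <= F x)%E ->
  (\int[iid P n]_x F x = \int[iid nu n]_x (F x * (tprod p x)%:E))%E.
Proof.
move=> [mp p0 dens]; elim => [|n IH] F mF F0.
  by rewrite !integral_iid0 /tprod big_ord0 mule1.
have mFc : measurable_fun setT (F \o @sample_cons _ T n).
  exact: measurableT_comp mF (@measurable_sample_cons _ T n).
rewrite ge0_integral_iidS// ge0_integral_iidS//; first last.
- move=> x; apply: mule_ge0; first exact: F0. by rewrite lee_fin tprod_ge0.
- by apply: emeasurable_funM => //; apply/measurable_EFinP; exact: measurable_tprod.
rewrite dens; first last.
- by move=> t; exact: integral_ge0.
- apply: (measurable_fun_fubini_tonelli_F (F \o @sample_cons _ T n)) => // z; exact: F0.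
apply: eq_integral => t _.
have mFt : measurable_fun setT (fun y => F (sample_cons (t, y))).
  exact: measurableT_comp mFc (measurable_pair1 t).
rewrite IH// -ge0_integralZr//; first last.
- by rewrite lee_fin.
- by move=> y _; apply: mule_ge0 => //; rewrite lee_fin; exact: (tprod_ge0 _ p0).
- by apply: emeasurable_funM => //; apply/measurable_EFinP; exact: measurable_tprod.
apply: eq_integral => y _.
by rewrite tprodS /= EFinM -muleA; congr (_ * _)%E; rewrite muleC.
Qed.

Lemma is_density_iid P nu p n : is_density P nu p ->
  is_density (iid P n) (iid nu n) (tprod p).
Proof.
move=> dens; have [mp p0 _] := dens; split; first exact: measurable_tprod.
  by move=> x; exact: tprod_ge0.
exact: ge0_integral_density_iid.
Qed.

End iid_integrals.

(** * Root densities and quadratic mean differentiability *)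

Lemma mnormalizeE (d : measure_display) (T : measurableType d) (R : realType)
    (m : {measure set T -> \bar R}) (P : probability T R) (A : set T) (c : R) :
  m setT = c%:E -> c != 0 -> (mnormalize m P A = m A * (c^-1)%:E)%E.
Proof. by move=> mc c0; rewrite /mnormalize mc eqe (negbTE c0) orbF. Qed.

(** The root itself is the datum: quadratic mean differentiability lives in L2(nu), and sign and
    measurability are required pointwise so that products of roots are again roots. *)
Definition is_root_density (d : measure_display) (T : measurableType d)
    (R : realType) (P nu : probability T R) (v : T -> R) : Prop :=
  [/\ measurable_fun setT v, forall t, 0 <= v t &
      is_density P nu (fun t => v t ^+ 2)].

Section root_densities.
Context (d : measure_display) (T : measurableType d) (R : realType).
Variables Q P : probability T R.
Local Notation mu := (dominating Q P).

Let mu_setT : mu setT = 2%:E.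
Proof.
rewrite /dominating measure_addE [X in (X + _)%E]probability_setT.
by rewrite [X in (_ + X)%E]probability_setT -EFinD.
Qed.

(** [Q + P] has mass 2, and [iid] is defined for probabilities; the factor [Num.sqrt 2] on root
    densities compensates the normalisation. The argument [P] is the value of [mnormalize] at the
    masses 0 and infinity. *)
Definition half_dominating : probability T R := mnormalize mu P.

Let half_dominatingE A : mu A = (mscale 2%:nng half_dominating) A.
Proof.
have two0 : 2 != 0 :> R by rewrite pnatr_eq0.
have E : (half_dominating A = mu A * (2^-1)%:E)%E := mnormalizeE P A mu_setT two0.
by rewrite /mscale /= E muleCA -EFinM divff ?mule1// pnatr_eq0.
Qed.

Lemma ge0_integral_dominating (f : T -> \bar R) : measurable_fun setT f ->
  (forall t, 0 <= f t)%E ->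
  (\int[mu]_t f t = \int[half_dominating]_t (2%:E * f t))%E.
Proof.
move=> mf f0; rewrite (eq_measure_integral (mscale 2%:nng half_dominating)).
  by rewrite ge0_integral_mscale// ge0_integralZl.
by move=> A mA _; exact: half_dominatingE.
Qed.

Variable S : probability T R.
Hypothesis Smu : S `<< mu.

Lemma measurable_root_density : measurable_fun setT (root_density Q P S).
Proof.
apply: measurableT_comp.
  by apply: continuous_measurable_fun; exact: sqrt_continuous.
apply: measurableT_comp; first exact: fine_measurable.
have H := Radon_Nikodym_integrable (nu := charge_of_finite_measure S) Smu.
exact: measurable_int H.
Qed.

Lemma is_root_density_scaled :
  is_root_density S half_dominating (fun t => Num.sqrt 2 * root_density Q P S t).
Proof.
have mr := measurable_root_density.
have mr2 : measurable_fun setT (fun t => (root_density Q P S t) ^+ 2).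
  exact: measurable_funX.
split; first exact: measurable_funM.
  by move=> t; rewrite mulr_ge0// sqrtr_ge0.
split.
- by apply: measurable_funX; exact: measurable_funM.
- by move=> t; exact: sqr_ge0.
move=> F mF F0.
rewrite -(Radon_Nikodym_SigmaFinite.change_of_variables Smu F0)//.
transitivity (\int[mu]_t (F t * ((root_density Q P S t) ^+ 2)%:E))%E.
  apply: ae_eq_integral => //.
  - apply: emeasurable_funM => //.
    exact: measurable_int (Radon_Nikodym_SigmaFinite.f_integrable _).
  - by apply: emeasurable_funM => //; exact/measurable_EFinP.
  apply: ae_eqe_mul2l.
  (* The derivative inside [root_density] agrees almost everywhere with one that is finite and
     nonnegative, so [fine] and [Num.sqrt] lose nothing. *)
  apply: filterS (ae_eq_Radon_Nikodym_SigmaFinite Smu measurableT) => t /= E _.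
  rewrite /root_density -E// sqr_sqrtr.
    by rewrite fineK// Radon_Nikodym_SigmaFinite.f_fin_num.
  by rewrite fine_ge0// Radon_Nikodym_SigmaFinite.f_ge0.
rewrite ge0_integral_dominating; last 2 first.
- by apply: emeasurable_funM => //; exact/measurable_EFinP.
- by move=> t; rewrite mule_ge0// lee_fin sqr_ge0.
apply: eq_integral => t _; rewrite exprMn (sqr_sqrtr (ler0n R 2)) EFinM.
by rewrite muleCA.
Qed.

End root_densities.

Section DQM_sequences.
Context (d : measure_display) (T : measurableType d) (R : realType).
Variable P : probability T R.

Lemma dominatingE (Q : probability T R) A : dominating Q P A = (Q A + P A)%E.
Proof. by rewrite /dominating measure_addE. Qed.

Lemma dominated_left (Q : probability T R) : Q `<< dominating Q P.
Proof.
apply/null_content_dominatesP => A mA mu0.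
have /eqP : (Q A + P A = 0)%E by rewrite -dominatingE.
by rewrite padde_eq0// => /andP[/eqP].
Qed.

Lemma dominated_right (Q : probability T R) : P `<< dominating Q P.
Proof.
apply/null_content_dominatesP => A mA mu0.
have /eqP : (Q A + P A = 0)%E by rewrite -dominatingE.
by rewrite padde_eq0// => /andP[_ /eqP].
Qed.

Lemma measurable_L2 (h : L2 P) : measurable_fun setT h.
Proof. exact: measurable_funP. Qed.

Lemma sq_integrable_L2 (h : L2 P) : sq_integrable P h.
Proof. by split; [exact: measurable_L2|exact: Lfun2_integrable_sqr (LfunP h)]. Qed.

Lemma L2norm_sqr (h : L2 P) : L2norm h ^+ 2 = \int[P]_x (h x ^+ 2).
Proof.
have [mh ih] := sq_integrable_L2 h.
rewrite -powR_mulrn ?fine_ge0 ?Lnorm_ge0// -fine_poweR powR_Lnorm//.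
congr fine; apply: eq_integral => x _.
by rewrite /= powR_mulrn// real_normK ?num_real.
Qed.

Lemma L2norm_ge0 (h : L2 P) : 0 <= L2norm h.
Proof. by rewrite fine_ge0// Lnorm_ge0. Qed.

Lemma DQM_remainderE (h : L2 P) (Pt : R -> probability T R) (t : R) :
  let Q := Pt t in
  let u x := Num.sqrt 2 * root_density Q P Q x in
  let v x := Num.sqrt 2 * root_density Q P P x in
  DQM_remainder h Pt t =
  (\int[half_dominating Q P]_x
     (((u x - v x) / t - 2^-1 * h x * v x) ^+ 2)%:E)%E.
Proof.
move=> Q u v.
have mQ := measurable_root_density (@dominated_left Q).
have mP := measurable_root_density (@dominated_right Q).
rewrite /DQM_remainder ge0_integral_dominating; first last.
- by move=> x; rewrite lee_fin sqr_ge0.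
- apply/measurable_EFinP/measurable_funX/measurable_funB.
    by apply: measurable_funM => //; exact: measurable_funB.
  apply: measurable_funM => //.
  by apply: measurable_funM => //; exact: measurable_L2.
apply: eq_integral => x _; rewrite -EFinM; congr EFin.
rewrite -[X in X * _](sqr_sqrtr (ler0n R 2)) -exprMn; congr (_ ^+ 2).
by rewrite /u /v; ring.
Qed.

End DQM_sequences.

Lemma cvg_squeeze0 (R : realType) (a b : R^nat) (l : R) :
  (forall n, `|a n - l| <= b n) -> b @ \oo --> 0 -> a @ \oo --> l.
Proof.
move=> ab b0; apply/cvgrPdist_le => e e0.
move/cvgrPdist_le : b0 => /(_ e e0); apply: filterS => n.
rewrite sub0r normrN distrC => bn; apply: (le_trans (ab n)).
by rewrite (le_trans _ bn)// ler_norm.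
Qed.

Lemma cvg_sqrt0 (R : realType) (a : R^nat) :
  a @ \oo --> 0 -> (Num.sqrt (a n)) @[n --> \oo] --> 0.
Proof.
move=> a0; rewrite -[X in _ --> X](@sqrtr0 R).
by apply: (cvg_comp _ _ a0); exact: sqrt_continuous.
Qed.

Lemma invsqrt_cvg_right (R : realType) :
  (Num.sqrt n%:R)^-1 @[n --> \oo] --> (0 : R)^'+.
Proof.
move=> A [e /= e0 eA].
(* Beyond this index n > e^-2, that is, (sqrt n)^-1 < e. The bound is positive, which excludes n =
   0, where the inverse is 0 and does not lie to the right of 0. *)
exists (Num.bound (e ^- 2)) => // n /= Nn; apply: eA => /=; last first.
  by rewrite invr_gt0 sqrtr_gt0 ltr0n (leq_trans _ Nn).
have en : e ^- 2 < n%:R.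
  apply: (lt_le_trans (archi_boundP _)); first by rewrite invr_ge0 sqr_ge0.
  by rewrite ler_nat.
rewrite sub0r normrN ger0_norm ?invr_ge0 ?sqrtr_ge0//.
rewrite -[e]invrK ltf_pV2 ?posrE ?invr_gt0 ?sqrtr_gt0//; last first.
  by rewrite (lt_trans _ en)// invr_gt0 exprn_gt0.
rewrite -(ger0_norm (_ : 0 <= e^-1)) ?invr_ge0 ?ltW//.
by rewrite -sqrtr_sqr ltr_sqrt ?exprVn// (lt_trans _ en)// invr_gt0 exprn_gt0.
Qed.

Lemma invsqrt_cvg0 (R : realType) : (Num.sqrt n%:R)^-1 @[n --> \oo] --> (0 : R).
Proof. exact: cvg_trans (@invsqrt_cvg_right R) (@cvg_within _ _ _ _). Qed.

Section root_density_facts.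
Context (d : measure_display) (T : measurableType d) (R : realType).
Variables (P nu : probability T R) (v : T -> R).
Hypothesis Pv : is_root_density P nu v.
Implicit Types f : T -> R.

Let mv : measurable_fun setT v. Proof. by case: Pv. Qed.
Let dens : is_density P nu (fun t => v t ^+ 2). Proof. by case: Pv. Qed.

Lemma sq_integrable_mul_root f : sq_integrable P f ->
  sq_integrable nu (fun t => f t * v t).
Proof.
move=> [mf if2]; split; first exact: measurable_funM.
apply: eq_integrable (Rintegrable_density dens if2) => // t _ /=.
by rewrite exprMn.
Qed.

Lemma Rintegral_sqr_mul_root f : measurable_fun setT f ->
  \int[nu]_t ((f t * v t) ^+ 2) = \int[P]_t (f t ^+ 2).
Proof.
move=> mf; rewrite (Rintegral_density dens); last exact: measurable_funX.
by apply: Rintegral_ext => t; rewrite exprMn.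
Qed.

Lemma sq_integrable_root : sq_integrable nu v.
Proof.
have s1 : sq_integrable P (cst 1).
  by apply: (@sq_integrable_bounded _ _ _ _ _ 1) => // x; rewrite normr1.
by have := sq_integrable_mul_root s1; under eq_fun do rewrite mul1r.
Qed.

Lemma Rintegral_sqr_root : \int[nu]_t (v t ^+ 2) = 1.
Proof.
rewrite -[RHS](Rintegral_prob_cst P) (Rintegral_density dens)//.
by apply: Rintegral_ext => t; rewrite mul1r.
Qed.

End root_density_facts.

Section DQM_limits.
Context (d : measure_display) (T : measurableType d) (R : realType).
Variables (P : probability T R) (Q nu : nat -> probability T R).
Variables (u v : nat -> T -> R) (h : T -> R).
Hypothesis Qu : forall n, is_root_density (Q n) (nu n) (u n).
Hypothesis Pv : forall n, is_root_density P (nu n) (v n).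
Hypothesis sh : sq_integrable P h.

(** The residual of quadratic mean differentiability at t = n^(-1/2). Each n has its own dominating
    measure [nu n], so the limits below concern inner products in L2(nu n) and never convergence of
    functions. *)
Definition DQM_error n t : R :=
  Num.sqrt n%:R * (u n t - v n t) - 2^-1 * (h t * v n t).

Hypothesis DQM_error0 : \int[nu n]_t (DQM_error n t ^+ 2) @[n --> \oo] --> 0.

Let su n : sq_integrable (nu n) (u n). Proof. exact: sq_integrable_root. Qed.
Let sv n : sq_integrable (nu n) (v n). Proof. exact: sq_integrable_root. Qed.
Let dens n : is_density P (nu n) (fun t => v n t ^+ 2). Proof. by case: (Pv n). Qed.
Let shv n : sq_integrable (nu n) (fun t => 2^-1 * (h t * v n t)).
Proof. by apply: sq_integrableZ; exact: sq_integrable_mul_root. Qed.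

Lemma sq_integrable_root_diff n : sq_integrable (nu n) (fun t => u n t - v n t).
Proof. exact: sq_integrableB. Qed.

Lemma sq_integrable_DQM_error n : sq_integrable (nu n) (DQM_error n).
Proof.
by apply: sq_integrableB => //; apply: sq_integrableZ; exact: sq_integrable_root_diff.
Qed.

Let N n := \int[nu n]_t (DQM_error n t ^+ 2).

Let N_ge0 n : 0 <= N n. Proof. exact: Rintegral_sqr_ge0. Qed.

(** Against k v, the linear part h v / 2 of the root difference contributes exactly <h, k> / 2, and
    by Cauchy-Schwarz the residual contributes at most its norm times that of k. *)
Lemma DQM_cross k : sq_integrable P k ->
  Num.sqrt n%:R * \int[nu n]_t ((u n t - v n t) * (k t * v n t)) @[n --> \oo] -->
  2^-1 * \int[P]_t (h t * k t).
Proof.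
move=> sk; have [mk _] := sk; set K := \int[P]_t (k t ^+ 2).
apply: (@cvg_squeeze0 _ _ (fun n => Num.sqrt (N n) * Num.sqrt K)) => [n|]; last first.
  rewrite -[X in _ --> X](mul0r (Num.sqrt K)).
  by apply: cvgMr_tmp; exact: cvg_sqrt0.
have skv := sq_integrable_mul_root (Pv n) sk.
have -> : Num.sqrt n%:R * \int[nu n]_t ((u n t - v n t) * (k t * v n t)) -
    2^-1 * \int[P]_t (h t * k t) = \int[nu n]_t (DQM_error n t * (k t * v n t)).
  rewrite (Rintegral_density (dens n)); last first.
    by apply: measurable_funM => //; case: sh.
  rewrite -RintegralZl//; last exact: sq_integrable_mul (sq_integrable_root_diff n) skv.
  rewrite -RintegralZl//; last first.
    exact: Rintegrable_density (dens n) (sq_integrable_mul sh sk).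
  rewrite -RintegralB//; first by apply: Rintegral_ext => t; rewrite /DQM_error; ring.
    by apply: RintegrableZ; exact: sq_integrable_mul (sq_integrable_root_diff n) skv.
  by apply: RintegrableZ; exact: Rintegrable_density (dens n) (sq_integrable_mul sh sk).
apply: cauchy_schwarz_le => //; first exact: sq_integrable_DQM_error.
- by rewrite sqr_sqrtr.
- by rewrite (Rintegral_sqr_mul_root (Pv n))// sqr_sqrtr// Rintegral_sqr_ge0.
Qed.

(** Expanding the squared norm of the residual gives n |u - v|^2 - sqrt n <u - v, h v> + |h|^2 / 4.
    It tends to 0 and the cross term tends to |h|^2 / 2, by [DQM_cross] at k = h. *)
Lemma DQM_hellinger :
  n%:R * \int[nu n]_t ((u n t - v n t) ^+ 2) @[n --> \oo] -->
  4^-1 * \int[P]_t (h t ^+ 2).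
Proof.
have mh := sh.1.
have E n : n%:R * \int[nu n]_t ((u n t - v n t) ^+ 2) =
   N n - 4^-1 * \int[P]_t (h t ^+ 2) +
   Num.sqrt n%:R * \int[nu n]_t ((u n t - v n t) * (h t * v n t)).
  have sd := sq_integrable_root_diff n.
  have shv' := sq_integrable_mul_root (Pv n) sh.
  rewrite -(Rintegral_sqr_mul_root (Pv n) mh) /N.
  have i1 := RintegrableZ n%:R sd.2.
  have i2 := RintegrableZ 4^-1 shv'.2.
  have i3 := RintegrableZ (Num.sqrt n%:R) (sq_integrable_mul sd shv').
  have i4 := RintegrableB i1 i3.
  have -> : \int[nu n]_t (DQM_error n t ^+ 2) = \int[nu n]_t
     (n%:R * (u n t - v n t) ^+ 2 - Num.sqrt n%:R * ((u n t - v n t) * (h t * v n t)) +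
      4^-1 * (h t * v n t) ^+ 2).
    apply: Rintegral_ext => t; rewrite /DQM_error sqrrB exprMn sqr_sqrtr//.
    by field.
  rewrite RintegralD// RintegralB// !RintegralZl//; first ring.
  - exact: shv'.2.
  - exact: sq_integrable_mul.
  - exact: sd.2.
have H := cvgD (cvgB DQM_error0 (cvg_cst (4^-1 * \int[P]_t (h t ^+ 2)))) (DQM_cross sh).
have e : 0 - 4^-1 * \int[P]_t (h t ^+ 2) + 2^-1 * \int[P]_t (h t * h t) =
   4^-1 * \int[P]_t (h t ^+ 2).
  have -> : \int[P]_t (h t * h t) = \int[P]_t (h t ^+ 2) by [].
  by field.
by rewrite e in H; under eq_cvg do rewrite E; exact: H.
Qed.

(** With a = sqrt n (u - v) and b = h v, a^2 <= 2 (a - b/2)^2 + b^2 / 2. The first term is the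
    residual, so n (u - v)^2 has no asymptotic mass where h^2 has none. This serves for rare events
    and for Lindeberg weights. *)
Lemma DQM_hellinger_weighted (w : nat -> T -> R) :
  (forall n, measurable_fun setT (w n)) -> (forall n t, 0 <= w n t <= 1) ->
  \int[P]_t (w n t * h t ^+ 2) @[n --> \oo] --> 0 ->
  n%:R * \int[nu n]_t (w n t * (u n t - v n t) ^+ 2) @[n --> \oo] --> 0.
Proof.
move=> mw w01 wh; have [mh h2i] := sh.
apply: (@cvg_squeeze0 _ _
  (fun n => 2 * N n + 2^-1 * \int[P]_t (w n t * h t ^+ 2))) => [n|]; last first.
  rewrite -[X in _ --> X](_ : 2 * 0 + 2^-1 * 0 = 0); last by rewrite !mulr0 addr0.
  by apply: cvgD; apply: cvgMl_tmp.
have sd := sq_integrable_root_diff n.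
have iw f : Rintegrable (nu n) (fun t => f t ^+ 2) ->
    Rintegrable (nu n) (fun t => w n t * f t ^+ 2).
  move=> if2; apply: Rintegrable_le (if2).
    by apply: measurable_funM => //; exact: Rintegrable_measurable if2.
  move=> t; case/andP: (w01 n t) => w0 w1.
  by rewrite normrM (ger0_norm w0) normrX real_normK ?num_real// ler_piMl// sqr_ge0.
rewrite subr0 ger0_norm; last first.
  rewrite mulr_ge0// Rintegral_ge0// => t _.
  by case/andP: (w01 n t) => w0 _; rewrite mulr_ge0// sqr_ge0.
have iwP : Rintegrable P (fun t => w n t * h t ^+ 2).
  apply: Rintegrable_le h2i; first by apply: measurable_funM => //; exact: measurable_funX.
  move=> t; case/andP: (w01 n t) => w0 w1.
  by rewrite normrM (ger0_norm w0) normrX real_normK ?num_real// ler_piMl// sqr_ge0.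
rewrite (Rintegral_density (dens n)); last exact: Rintegrable_measurable iwP.
have i1 := RintegrableZ n%:R (iw _ sd.2).
have i2 := RintegrableZ 2 (sq_integrable_DQM_error n).2.
have i3 := RintegrableZ 2^-1 (Rintegrable_density (dens n) iwP).
rewrite -!RintegralZl//; [|exact: (Rintegrable_density (dens n) iwP)
  |exact: (sq_integrable_DQM_error n).2|exact: iw sd.2].
rewrite -RintegralD//; apply: Rintegral_le => //; first exact: RintegrableD.
move=> t; case/andP: (w01 n t) => w0 w1.
set a := Num.sqrt n%:R * (u n t - v n t); set b := h t * v n t.
have -> : n%:R * (w n t * (u n t - v n t) ^+ 2) = w n t * a ^+ 2.
  by rewrite /a exprMn sqr_sqrtr//; ring.
have -> : w n t * h t ^+ 2 * v n t ^+ 2 = w n t * b ^+ 2 by rewrite /b; ring.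
have -> : DQM_error n t = a - 2^-1 * b by [].
have H : a ^+ 2 <= 2 * (a - 2^-1 * b) ^+ 2 + 2^-1 * b ^+ 2.
  have := sqr_ge0 (a - b); nra.
apply: (le_trans (ler_wpM2l w0 H)); rewrite mulrDr lerD//.
  by rewrite ler_piMl// mulr_ge0// sqr_ge0.
by rewrite mulrCA.
Qed.

End DQM_limits.

(** * First-order expansion and contiguity of local laws *)

Lemma bernoulli_onem_expr (R : realFieldType) (x : R) n : 0 <= x <= 1 ->
  0 <= 1 - x ^+ n <= n%:R * (1 - x).
Proof.
move=> /andP[x0 x1]; elim: n => [|n /andP[IH0 IH1]]; first by rewrite expr0 subrr mul0r lexx.
have xn0 : 0 <= x ^+ n by exact: exprn_ge0.
rewrite exprS (natrD _ 1 n); apply/andP; split; nra.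
Qed.

Section local_expansion.
Context (d : measure_display) (T : measurableType d) (R : realType).
Variables (P : probability T R) (Q nu : nat -> probability T R).
Variables (u v : nat -> T -> R) (h : T -> R).
Hypothesis Qu : forall n, is_root_density (Q n) (nu n) (u n).
Hypothesis Pv : forall n, is_root_density P (nu n) (v n).
Hypothesis sh : sq_integrable P h.
Hypothesis h_mean0 : \int[P]_t h t = 0.
Hypothesis DQM_error0 :
  \int[nu n]_t (DQM_error u v h n t ^+ 2) @[n --> \oo] --> 0.

Let kappa := \int[P]_t (h t ^+ 2).
Let H n := \int[nu n]_t ((u n t - v n t) ^+ 2).
Let beta n := \int[nu n]_t ((u n t - v n t) * (h t * v n t)).
Let rho n := \int[nu n]_t (u n t * v n t).
Let densu n : is_density (Q n) (nu n) (fun t => u n t ^+ 2). Proof. by case: (Qu n). Qed.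
Let densv n : is_density P (nu n) (fun t => v n t ^+ 2). Proof. by case: (Pv n). Qed.
Let mu n : measurable_fun setT (u n). Proof. by case: (Qu n). Qed.
Let mv n : measurable_fun setT (v n). Proof. by case: (Pv n). Qed.
Let su n : sq_integrable (nu n) (u n). Proof. exact: sq_integrable_root (Qu n). Qed.
Let sv n : sq_integrable (nu n) (v n). Proof. exact: sq_integrable_root (Pv n). Qed.
Let mh : measurable_fun setT h. Proof. by case: sh. Qed.

Let rhoE n : rho n = 1 - H n / 2.
Proof.
have -> : H n = 2 - 2 * rho n; last by field.
have sv' := sq_integrableZ (-1) (sv n).
have E : H n = \int[nu n]_t ((u n t + -1 * v n t) ^+ 2).
  by apply: Rintegral_ext => t; ring.
rewrite E Rintegral_sqrD// (Rintegral_sqr_root (Qu n)).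
have -> : \int[nu n]_t ((-1 * v n t) ^+ 2) = 1.
  by rewrite -[RHS](Rintegral_sqr_root (Pv n)); apply: Rintegral_ext => t; ring.
have -> : \int[nu n]_t (u n t * (-1 * v n t)) = - rho n; last by ring.
rewrite -[RHS]mulN1r /rho -RintegralZl//; last exact: sq_integrable_mul.
by apply: Rintegral_ext => t; ring.
Qed.

Let rho01 n : 0 <= rho n <= 1.
Proof.
rewrite {2}rhoE gerBl divr_ge0 ?Rintegral_sqr_ge0// andbT.
apply: Rintegral_ge0 => t _; rewrite mulr_ge0//; first by case: (Qu n).
by case: (Pv n).
Qed.

Let U n : n.-tuple T -> R := tprod (u n).
Let V n : n.-tuple T -> R := tprod (v n).
Let Delta n (x : n.-tuple T) := (Num.sqrt n%:R)^-1 * tsum h x.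
Let D n := \int[iid (nu n) n]_x ((U x - V x) ^+ 2).
Let Rem n (x : n.-tuple T) : R := (U x - V x) - 2^-1 * (Delta x * V x).
Let S n := \int[iid (nu n) n]_x (Rem x ^+ 2).

Let sq_integrable_tprod n (nu' : probability T R) (g : T -> R) :
  sq_integrable nu' g -> sq_integrable (iid nu' n) (tprod g).
Proof.
move=> [mg ig]; split; first exact: measurable_tprod.
apply: eq_integrable (Rintegrable_tprod n ig) => // x _ /=.
by rewrite tprodX.
Qed.

Let Rintegral_tprod_sqr n (nu' P' : probability T R) (g : T -> R) :
  is_root_density P' nu' g -> \int[iid nu' n]_x (tprod g x ^+ 2) = 1.
Proof.
move=> gP; have sg := sq_integrable_root gP.
under eq_Rintegral do rewrite tprodX.
by rewrite Rintegral_tprod; [rewrite (Rintegral_sqr_root gP) expr1n|exact: sg.2].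
Qed.

Let sU n : sq_integrable (iid (nu n) n) (@U n). Proof. exact: sq_integrable_tprod. Qed.
Let sV n : sq_integrable (iid (nu n) n) (@V n). Proof. exact: sq_integrable_tprod. Qed.

Let Vroot n : is_root_density (iid P n) (iid (nu n) n) (@V n).
Proof.
split; first exact: measurable_tprod.
  by move=> x; apply: tprod_ge0; case: (Pv n).
have -> : (fun x => @V n x ^+ 2) = tprod (fun t => v n t ^+ 2).
  by apply/funext => x; rewrite /V tprodX.
exact: is_density_iid.
Qed.

Let Uroot n : is_root_density (iid (Q n) n) (iid (nu n) n) (@U n).
Proof.
split; first exact: measurable_tprod.
  by move=> x; apply: tprod_ge0; case: (Qu n).
have -> : (fun x => @U n x ^+ 2) = tprod (fun t => u n t ^+ 2).
  by apply/funext => x; rewrite /U tprodX.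
exact: is_density_iid.
Qed.

Let sDelta n : sq_integrable (iid P n) (@Delta n).
Proof. by apply: sq_integrableZ; exact: sq_integrable_tsum. Qed.

Let sDeltaV n : sq_integrable (iid (nu n) n) (fun x => @Delta n x * V x).
Proof. have := sq_integrable_mul_root (Vroot n) (sDelta n). exact. Qed.

Let sUV n : sq_integrable (iid (nu n) n) (fun x => @U n x - V x).
Proof. exact: sq_integrableB. Qed.

Let sRem n : sq_integrable (iid (nu n) n) (@Rem n).
Proof. by apply: sq_integrableB => //; exact: sq_integrableZ. Qed.

(** The affinity of the product laws is the n-th power of the affinity [rho n] of one coordinate. *)
Let DE n : D n = 2 * (1 - rho n ^+ n).
Proof.
have sV' := sq_integrableZ (-1) (sV n).
have -> : D n = \int[iid (nu n) n]_x ((U x + -1 * V x) ^+ 2).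
  by apply: Rintegral_ext => t; ring.
rewrite Rintegral_sqrD// (Rintegral_tprod_sqr n (Qu n)).
have -> : \int[iid (nu n) n]_x ((-1 * V x) ^+ 2) = 1.
  rewrite -[RHS](Rintegral_tprod_sqr n (Pv n)); apply: Rintegral_ext => t.
  by rewrite /V; ring.
have -> : \int[iid (nu n) n]_x (U x * (-1 * V x)) = - (rho n ^+ n); last by ring.
rewrite -Rintegral_tprod; last exact: sq_integrable_mul.
rewrite -[RHS]mulN1r -RintegralZl//; last exact: Rintegrable_tprod (sq_integrable_mul _ _).
by apply: Rintegral_ext => t; rewrite -tprodM /U /V; ring.
Qed.

Let D_le n : D n <= n%:R * H n.
Proof.
have /andP[_] := bernoulli_onem_expr n (rho01 n); rewrite DE {2}rhoE; lra.
Qed.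

(** In [tsum h] times U V, each coordinate contributes the integral of h u v times rho^(n-1); in
    [tsum h] times V^2 it contributes the integral of h v^2, which is 0. The same centring
    identifies the integral of h u v with [beta n]. *)
Let cross n : (0 < n)%N -> \int[iid (nu n) n]_x ((U x - V x) * (Delta x * V x)) =
  Num.sqrt n%:R * beta n * rho n ^+ n.-1.
Proof.
move=> n0.
have i1 : Rintegrable (nu n) (fun t => h t * (u n t * v n t)).
  apply: eq_integrable (sq_integrable_mul (su n) (sq_integrable_mul_root (Pv n) sh)) => // t _ /=.
  by congr EFin; ring.
have i2 := Rintegrable_density (densv n) (sq_integrable_integrable sh).
have [j1 E1] := Rintegral_tsum_tprod n mh (sq_integrable_mul (su n) (sv n)) i1.
have [j2 E2] := Rintegral_tsum_tprod n mh (sv n).2 i2.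
have hv0 : \int[nu n]_t (h t * v n t ^+ 2) = 0 by rewrite -(Rintegral_density (densv n)).
have betaE : beta n = \int[nu n]_t (h t * (u n t * v n t)).
  rewrite -[RHS]subr0 -hv0 -RintegralB//.
  by apply: Rintegral_ext => t; ring.
have -> : \int[iid (nu n) n]_x ((U x - V x) * (Delta x * V x)) =
  \int[iid (nu n) n]_x ((Num.sqrt n%:R)^-1 *
    (tsum h x * tprod (fun t => u n t * v n t) x - tsum h x * tprod (fun t => v n t ^+ 2) x)).
  by apply: Rintegral_ext => x; rewrite /Delta -tprodM -tprodX /U /V; ring.
rewrite RintegralZl//; last exact: RintegrableB.
rewrite RintegralB// E1 E2 hv0 -betaE.
have sn : Num.sqrt n%:R != 0 :> R by rewrite sqrtr_eq0 -ltNge ltr0n.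
rewrite mulr0 mul0r subr0.
rewrite -/(rho n).
have -> : (Num.sqrt n%:R)^-1 * (n%:R * beta n * rho n ^+ n.-1) =
  ((Num.sqrt n%:R)^-1 * n%:R) * (beta n * rho n ^+ n.-1) :> R by ring.
by rewrite -{2}(sqr_sqrtr (ler0n R n)) expr2 mulKf// mulrA.
Qed.

Let SE n : (0 < n)%N ->
  S n = D n + kappa / 4 - Num.sqrt n%:R * beta n * rho n ^+ n.-1.
Proof.
move=> n0; have sDV' := sq_integrableZ (- 2^-1) (sDeltaV n).
have -> : S n = \int[iid (nu n) n]_x (((U x - V x) + - 2^-1 * (Delta x * V x)) ^+ 2).
  by apply: Rintegral_ext => x; rewrite /Rem; ring.
rewrite Rintegral_sqrD//.
have -> : \int[iid (nu n) n]_x ((U x - V x) * (- 2^-1 * (Delta x * V x))) =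
  - 2^-1 * (Num.sqrt n%:R * beta n * rho n ^+ n.-1).
  rewrite -cross// -RintegralZl//; last exact: sq_integrable_mul.
  by apply: Rintegral_ext => x; ring.
have -> : \int[iid (nu n) n]_x ((- 2^-1 * (Delta x * V x)) ^+ 2) = kappa / 4.
  have -> : kappa = \int[iid P n]_x (Delta x ^+ 2).
    under eq_Rintegral do rewrite exprMn.
    rewrite RintegralZl//; last by have [] := sq_integrable_tsum n sh.
    rewrite (Rintegral_tsum_sqr n sh h_mean0) exprVn sqr_sqrtr// mulKf//.
    by rewrite pnatr_eq0 -lt0n.
  rewrite -(Rintegral_sqr_mul_root (Vroot n)); last by case: (sDelta n).
  rewrite mulrC -RintegralZl//; last by case: (sDeltaV n).
  by apply: Rintegral_ext => x; field.
by rewrite -/(D n); field.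
Qed.

(** A bound for D + 2 sqrt S made of quantities with known limits: n H tends to kappa / 4 and sqrt n
    beta to kappa / 2, and Bernoulli's inequality bounds 1 - rho^(n-1) by n H / 2. Under the root
    the terms of first order in kappa cancel and (kappa / 4)^2 remains, so the whole error is of
    order kappa, quadratic in the size of h. *)
Let B n := n%:R * H n + 2 * Num.sqrt (n%:R * H n + kappa / 4
  - Num.sqrt n%:R * beta n + `|Num.sqrt n%:R * beta n| * (n%:R * H n / 2)).

Let DS_le n : (0 < n)%N -> D n + 2 * Num.sqrt (S n) <= B n.
Proof.
move=> n0; rewrite /B lerD ?D_le// ler_pM2l// ler_wsqrtr// SE//.
have := D_le n; set b := Num.sqrt n%:R * beta n.
have := bernoulli_onem_expr n.-1 (rho01 n).
have : n.-1%:R * (1 - rho n) <= n%:R * (1 - rho n).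
  by rewrite ler_wpM2r ?ler_nat ?leq_pred// subr_ge0; case/andP: (rho01 n).
rewrite [in X in _ <= X]rhoE.
have := ler_norm (b * (1 - rho n ^+ n.-1)); rewrite normrM.
set c := 1 - rho n ^+ n.-1 => A1 A2 /andP[c0 A3] A4.
rewrite (ger0_norm c0) in A1.
have : `|b| * c <= `|b| * (n%:R * H n / 2) by apply: ler_wpM2l => //; lra.
have -> : b * rho n ^+ n.-1 = b - b * c by rewrite /c; ring.
lra.
Qed.

Let B_cvg : B n @[n --> \oo] --> 3 / 4 * kappa.
Proof.
have k0 : 0 <= kappa by exact: Rintegral_sqr_ge0.
have c1 : n%:R * H n @[n --> \oo] --> 4^-1 * kappa.
  exact: (DQM_hellinger Qu Pv sh DQM_error0).
have c2 : Num.sqrt n%:R * beta n @[n --> \oo] --> 2^-1 * kappa.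
  exact: (DQM_cross Qu Pv sh DQM_error0 sh).
have c3 : (n%:R * H n + kappa / 4 - Num.sqrt n%:R * beta n +
    `|Num.sqrt n%:R * beta n| * (n%:R * H n / 2)) @[n --> \oo] -->
    4^-1 * kappa + kappa / 4 - 2^-1 * kappa + `|2^-1 * kappa| * (4^-1 * kappa * 2^-1).
  apply: cvgD; first by apply: cvgB => //; apply: cvgD => //; exact: cvg_cst.
  by apply: cvgM; [exact: cvg_norm|apply: cvgM => //; exact: cvg_cst].
have c4 : B n @[n --> \oo] --> 4^-1 * kappa + 2 * Num.sqrt
    (4^-1 * kappa + kappa / 4 - 2^-1 * kappa + `|2^-1 * kappa| * (4^-1 * kappa * 2^-1)).
  apply: cvgD => //; apply: cvgM; first exact: cvg_cst.
  by apply: (cvg_comp _ _ c3); exact: sqrt_continuous.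
suff <- : 4^-1 * kappa + 2 * Num.sqrt (4^-1 * kappa + kappa / 4 - 2^-1 * kappa +
   `|2^-1 * kappa| * (4^-1 * kappa * 2^-1)) = 3 / 4 * kappa by exact: c4.
have -> : 4^-1 * kappa + kappa / 4 - 2^-1 * kappa +
   `|2^-1 * kappa| * (4^-1 * kappa * 2^-1) = (kappa / 4) ^+ 2.
  by rewrite ger0_norm ?mulr_ge0//; field.
by rewrite sqrtr_sqr ger0_norm ?mulr_ge0//; field.
Qed.

Let expansion_le n (M : R) (F : n.-tuple T -> R) : 0 <= M -> (0 < n)%N ->
  measurable_fun setT F -> (forall x, `|F x| <= M) ->
  `|\int[iid (Q n) n]_x F x - \int[iid P n]_x F x -
    \int[iid P n]_x (F x * Delta x)| <= M * (D n + 2 * Num.sqrt (S n)).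
Proof.
move=> M0 n0 mF FM.
have bF (m : probability (n.-tuple T) R) (f : n.-tuple T -> R) :
    Rintegrable m f -> Rintegrable m (fun x => F x * f x).
  move=> fi; apply: Rintegrable_le (RintegrableZ M (Rintegrable_norm fi)).
    by apply: measurable_funM => //; exact: Rintegrable_measurable fi.
  by move=> x; rewrite normrM ler_wpM2r.
have iF (m : probability (n.-tuple T) R) : Rintegrable m F by exact: Rintegrable_bounded mF FM.
have dU : is_density (iid (Q n) n) (iid (nu n) n) (fun x => U x ^+ 2) by case: (Uroot n).
have dV : is_density (iid P n) (iid (nu n) n) (fun x => V x ^+ 2) by case: (Vroot n).
have iFD := bF _ _ (sq_integrable_integrable (sDelta n)).
rewrite (Rintegral_density dU)// (Rintegral_density dV)// (Rintegral_density dV); last first.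
  exact: Rintegrable_measurable iFD.
have i1 := Rintegrable_density dU (iF _); have i2 := Rintegrable_density dV (iF _).
have i3 := Rintegrable_density dV iFD.
rewrite -RintegralB// -RintegralB//; last exact: RintegrableB.
have sFV : sq_integrable (iid (nu n) n) (fun x => F x * V x).
  apply: (sq_integrable_le _ _ (sq_integrableZ M (sV n))).
    by apply: measurable_funM => //; exact: measurable_tprod.
  by move=> x; rewrite !normrM ler_wpM2r// (ger0_norm M0).
have i4 := bF _ _ (sUV n).2.
have i5 := sq_integrable_mul sFV (sRem n).
have -> : \int[iid (nu n) n]_x (F x * U x ^+ 2 - F x * V x ^+ 2 - F x * Delta x * V x ^+ 2) =
  \int[iid (nu n) n]_x (F x * (U x - V x) ^+ 2) + 2 * \int[iid (nu n) n]_x (F x * V x * Rem x).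
  rewrite -RintegralZl// -RintegralD//; last exact: RintegrableZ.
  by apply: Rintegral_ext => x; rewrite /Rem; field.
apply: (le_trans (ler_normD _ _)); rewrite mulrDr lerD//.
  rewrite /D -RintegralZl//; last by case: (sUV n).
  apply: Rintegral_norm_le => //; first by apply: RintegrableZ; case: (sUV n).
  by move=> x; rewrite normrM (ger0_norm (sqr_ge0 _)) ler_wpM2r// sqr_ge0.
rewrite normrM ger0_norm// mulrCA ler_pM2l//.
apply: cauchy_schwarz_le => //.
- have -> : M ^+ 2 = \int[iid (nu n) n]_x (M ^+ 2 * V x ^+ 2).
    rewrite RintegralZl//; last by case: (sV n).
    by rewrite (Rintegral_tprod_sqr n (Pv n)) mulr1.
  apply: Rintegral_le => //; first by case: sFV.
    by apply: RintegrableZ; case: (sV n).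
  move=> x; rewrite exprMn ler_wpM2r ?sqr_ge0//.
  by rewrite -(real_normK (num_real (F x))) lerXn2r ?nnegrE.
- by rewrite sqr_sqrtr// Rintegral_sqr_ge0.
Qed.

(* U^2 - V^2 - Delta V^2 = (U - V)^2 + 2 V Rem, where Rem = U - V - Delta V / 2:
   in the limit the two terms cost at most kappa / 4 and kappa / 2. *)
Lemma local_expansion (M e : R) : 0 <= M -> 0 < e ->
  \forall n \near \oo, forall F : n.-tuple T -> R, measurable_fun setT F ->
    (forall x, `|F x| <= M) ->
    `|\int[iid (Q n) n]_x F x - \int[iid P n]_x F x -
      \int[iid P n]_x (F x * ((Num.sqrt n%:R)^-1 * tsum h x))| <=
    M * (\int[P]_t (h t ^+ 2) + e).
Proof.
move=> M0 e0; have k0 : 0 <= kappa by exact: Rintegral_sqr_ge0.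
have : \forall n \near \oo, B n <= kappa + e.
  have /cvgrPdist_le /(_ e e0) := B_cvg; apply: filterS => n.
  by rewrite distrC ler_norml => /andP[_]; lra.
apply: filter_app; near=> n => Bn F mF FM.
have n0 : (0 < n)%N by near: n; exact: nbhs_infty_gt.
apply: (le_trans (expansion_le M0 n0 mF FM)); rewrite ler_wpM2l//.
exact: le_trans (DS_le n0) Bn.
Unshelve. all: by end_near.
Qed.

End local_expansion.

Section bounded_weights.
Context (d : measure_display) (T : measurableType d) (R : realType).
Variable P : probability T R.

Lemma Rintegral_indic (A : set T) : measurable A ->
  (\int[P]_t (\1_A t : R))%:E = P A.
Proof.
move=> mA; rewrite /Rintegral integral_indic// setIT fineK//.
exact: fin_num_measure.
Qed.

Lemma Rintegrable_indic (A : set T) : measurable A -> Rintegrable P (\1_A : T -> R).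
Proof. by move=> mA; exact: integrable_indic. Qed.

Lemma markov_Rintegral (f : T -> R) (e : R) : 0 < e -> Rintegrable P f ->
  (forall t, 0 <= f t) -> (P [set t | (e < f t)%R] <= (e^-1 * \int[P]_t f t)%:E)%E.
Proof.
move=> e0 fi f0; have mf := Rintegrable_measurable fi.
have mA : measurable [set t | e < f t].
  rewrite -[X in measurable X]setTI.
  by apply: (@measurable_fun_ltr _ _ _ setT (cst e) f) => //.
rewrite -Rintegral_indic// lee_fin -RintegralZl//.
apply: Rintegral_le; [exact: Rintegrable_indic|exact: RintegrableZ|move=> t].
rewrite indicE; case: (boolP (t \in _)) => [|_]; last by rewrite mulr_ge0 ?invr_ge0// ltW.
by rewrite inE /= => /ltW; rewrite mulrC ler_pdivlMr// mul1r.
Qed.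

(** Where w exceeds a level c, Markov's inequality makes the set small and the absolute continuity
    of the integral of f applies; elsewhere w f <= c f. *)
Lemma bounded_weight_cvg0 (f : T -> R) (w : nat -> T -> R) :
  Rintegrable P f -> (forall t, 0 <= f t) ->
  (forall n, measurable_fun setT (w n)) -> (forall n t, 0 <= w n t <= 1) ->
  \int[P]_t w n t @[n --> \oo] --> 0 ->
  \int[P]_t (w n t * f t) @[n --> \oo] --> 0.
Proof.
move=> fi f0 mw w01 w0; have mf := Rintegrable_measurable fi.
have wi n : Rintegrable P (w n).
  apply: (@Rintegrable_bounded _ _ _ _ _ 1) => // t.
  by case/andP: (w01 n t) => a b; rewrite ger0_norm.
have wfi n : Rintegrable P (fun t => w n t * f t).
  apply: Rintegrable_le fi; first exact: measurable_funM.
  move=> t; case/andP: (w01 n t) => a b.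
  by rewrite normrM !ger0_norm// ler_piMl.
set K := \int[P]_t f t; have K0 : 0 <= K by exact: Rintegral_ge0.
apply/cvgrPdist_le => e e0.
(* Gives c K <= e / 2; the 1 covers K = 0. *)
pose c := e / 2 / (K + 1); have c0 : 0 < c by rewrite !divr_gt0// ltr_wpDl.
have [dl [dl0 Hdl]] := integral_normr_continuous fi (divr_gt0 e0 (ltr0Sn R 1)).
move/cvgrPdist_lt : w0 => /(_ (c * dl) (mulr_gt0 c0 dl0)); apply: filterS => n.
rewrite !sub0r !normrN => H.
rewrite ger0_norm; last first.
  by apply: Rintegral_ge0 => t _; case/andP: (w01 n t) => a b; rewrite mulr_ge0.
pose A := [set t | c < w n t].
have mA : measurable A.
  rewrite -[X in measurable X]setTI.
  by apply: (@measurable_fun_ltr _ _ _ setT (cst c) (w n)) => //.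
have PA : (P A < dl%:E)%E.
  apply: (le_lt_trans (markov_Rintegral c0 (wi n) _)) => [t|].
    by case/andP: (w01 n t).
  rewrite lte_fin mulrC ltr_pdivrMr// mulrC.
  exact: le_lt_trans (ler_norm _) H.
have fAi : Rintegrable P (fun t => \1_A t * f t).
  apply: Rintegrable_le fi; first by apply: measurable_funM => //.
  move=> t; rewrite normrM (ger0_norm (f0 _)) ler_piMl// indicE.
  by case: (_ \in _); rewrite ?normr1 ?normr0.
have := Hdl A mA PA; rewrite Rintegral_mkcond.
have -> : \int[P]_t ((fun t => `|f t|) \_ A) t = \int[P]_t (\1_A t * f t).
  apply: Rintegral_ext => t; rewrite patchE indicE.
  by case: ifPn => tA; rewrite ?mul1r ?mul0r// ger0_norm.
move=> HA; apply: (@le_trans _ _ (\int[P]_t (\1_A t * f t) + c * K)).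
  rewrite -RintegralZl// -RintegralD//; last exact: RintegrableZ.
  apply: Rintegral_le => //; first by apply: RintegrableD => //; exact: RintegrableZ.
  move=> t; rewrite -mulrDl ler_wpM2r// indicE.
  case/andP: (w01 n t) => a b.
  case: (boolP (t \in A)) => [_|]; first by rewrite (le_trans b)// lerDl ltW.
  by rewrite notin_setE /A /= => /negP; rewrite -leNgt add0r.
have : c * K <= e / 2.
  by rewrite /c mulrAC ler_pdivrMr ?ltr_wpDl// ler_pM2l ?lerDl// divr_gt0.
lra.
Qed.

End bounded_weights.

(** * Contiguity of the local product laws *)

Section contiguity.
Context (d : measure_display) (T : measurableType d) (R : realType).
Variables (P : probability T R) (Q nu : nat -> probability T R).
Variables (u v : nat -> T -> R) (h : T -> R).
Hypothesis Qu : forall n, is_root_density (Q n) (nu n) (u n).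
Hypothesis Pv : forall n, is_root_density P (nu n) (v n).
Hypothesis sh : sq_integrable P h.
Hypothesis DQM_error0 :
  \int[nu n]_t (DQM_error u v h n t ^+ 2) @[n --> \oo] --> 0.

Let H n := \int[nu n]_t ((u n t - v n t) ^+ 2).
Let densu n : is_density (Q n) (nu n) (fun t => u n t ^+ 2). Proof. by case: (Qu n). Qed.
Let densv n : is_density P (nu n) (fun t => v n t ^+ 2). Proof. by case: (Pv n). Qed.
Let mu n : measurable_fun setT (u n). Proof. by case: (Qu n). Qed.
Let mv n : measurable_fun setT (v n). Proof. by case: (Pv n). Qed.
Let u0 n t : 0 <= u n t. Proof. by case: (Qu n). Qed.
Let v0 n t : 0 <= v n t. Proof. by case: (Pv n). Qed.
Let su n : sq_integrable (nu n) (u n). Proof. exact: sq_integrable_root (Qu n). Qed.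
Let sv n : sq_integrable (nu n) (v n). Proof. exact: sq_integrable_root (Pv n). Qed.
Let sd n : sq_integrable (nu n) (fun t => u n t - v n t).
Proof. exact: sq_integrableB. Qed.

Let B n := [set t | 2 * v n t < u n t].
Let mB n : measurable (B n).
Proof.
rewrite -[X in measurable X]setTI.
apply: (@measurable_fun_ltr _ _ _ setT (fun t => 2 * v n t) (u n)) => //.
exact: measurable_funM.
Qed.

Let b n : T -> R := \1_(B n).
Let b01 n t : 0 <= b n t <= 1.
Proof. by rewrite /b indicE; case: (_ \in _); rewrite ?ler01 ?lexx. Qed.
Let mb n : measurable_fun setT (b n). Proof. exact: measurable_indic. Qed.

Let ib n f : Rintegrable (nu n) f -> Rintegrable (nu n) (fun t => b n t * f t).
Proof.
move=> fi; apply: Rintegrable_le (Rintegrable_norm fi).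
  by apply: measurable_funM => //; exact: Rintegrable_measurable fi.
by move=> t; rewrite normrM ler_piMl//; case/andP: (b01 n t) => ? ?; rewrite ger0_norm.
Qed.

Let H0 : H n @[n --> \oo] --> 0.
Proof.
have c1 : n%:R * H n @[n --> \oo] --> 4^-1 * \int[P]_t (h t ^+ 2).
  exact: (DQM_hellinger Qu Pv sh DQM_error0).
have c0 : (n%:R^-1 : R) @[n --> \oo] --> 0.
  apply: (@cvg_squeeze0 _ _ (fun n => (Num.sqrt n%:R)^-1 * (Num.sqrt n%:R)^-1)) => [n|].
    by rewrite subr0 ger0_norm// -invfM -expr2 sqr_sqrtr.
  by have := cvgM (@invsqrt_cvg0 R) (@invsqrt_cvg0 R); rewrite mulr0; exact.
have c2 : (n%:R^-1 * (n%:R * H n)) @[n --> \oo] --> 0 * (4^-1 * \int[P]_t (h t ^+ 2)).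
  exact: cvgM.
rewrite mul0r in c2.
apply/cvgrPdist_le => e e0; move/cvgrPdist_le : c2 => /(_ e e0).
apply: filter_app; exists 1%N => // n /= n0.
by rewrite mulrA mulVf ?mul1r// pnatr_eq0 -lt0n.
Qed.

(** On the event u > 2v one has v <= u - v, so its P-probability is at most [H n]. *)
Let b_P : \int[P]_t b n t @[n --> \oo] --> 0.
Proof.
apply: (cvg_squeeze0 _ H0) => n; rewrite subr0 ger0_norm; last first.
  by apply: Rintegral_ge0 => t _; case/andP: (b01 n t).
rewrite (Rintegral_density (densv n))//.
apply: Rintegral_le; [exact: ib (sv n).2|exact: (sd n).2|move=> t].
rewrite /b indicE; case: (boolP (t \in B n)) => [|_]; last by rewrite mul0r sqr_ge0.
by rewrite inE /B /= mul1r => Bt; rewrite lerXn2r ?nnegrE//; have := v0 n t; lra.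
Qed.

Let nb : n%:R * \int[nu n]_t (b n t * (u n t - v n t) ^+ 2) @[n --> \oo] --> 0.
Proof.
apply: (DQM_hellinger_weighted Qu Pv sh DQM_error0) => //.
apply: bounded_weight_cvg0 => //; first by case: sh.
by move=> t; exact: sqr_ge0.
Qed.

(** [g] is the density of [Q n] off the event u > 2v. The integral of w^2 is the second moment under
    P of the truncated likelihood ratio g / v^2. Off the event, v = 0 forces u = 0, so the
    convention for division by 0 is consistent with w v = g. *)
Let g n t : R := (1 - b n t) * u n t ^+ 2.
Let w n t : R := (1 - b n t) * u n t ^+ 2 / v n t.

Let mw n : measurable_fun setT (w n).
Proof.
apply: measurable_funM.
  by apply: measurable_funM; [exact: measurable_funB|exact: measurable_funX].
have -> : (fun t => (v n t)^-1) = (fun t => v n t `^ (-1)).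
  by apply/funext => t; rewrite powR_inv1.
exact: measurableT_comp (measurable_powR _) (mv n).
Qed.

Let wv n t : w n t * v n t = g n t.
Proof.
rewrite /w /g; have [v00|vn0] := eqVneq (v n t) 0; last by rewrite divfK.
rewrite v00 mulr0; rewrite /b indicE; case: (boolP (t \in B n)) => [_|].
  by rewrite subrr mul0r.
rewrite notin_setE /B /= => /negP; rewrite -leNgt v00 mulr0 => ule.
have -> : u n t = 0 by apply/eqP; rewrite eq_le ule u0.
by rewrite expr0n mulr0.
Qed.

(** With r = u / v <= 2 this is r^4 <= 1 + 4 (r - 1) + 11 (r - 1)^2: the exact coefficient of (r -
    1)^2 is r^2 + 2r + 3, at most 11. The linear term must be kept because it integrates to -2H, of
    second order. Hence the second moment is at most 1 + 9H, and its n-th power at most exp(9 n H),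
    which stays bounded. *)
Let w2 n t : w n t ^+ 2 <=
  v n t ^+ 2 + 4 * (v n t * (u n t - v n t)) + 11 * (u n t - v n t) ^+ 2.
Proof.
have := u0 n t; have := v0 n t; rewrite /w /b indicE.
case: (boolP (t \in B n)) => [|].
  rewrite inE /B /= subrr !mul0r expr0n /=; nra.
rewrite notin_setE /B /= => /negP; rewrite -leNgt subr0 mul1r => uv vt ut.
have [v00|vn0] := eqVneq (v n t) 0.
  by rewrite v00 invr0 mulr0 expr0n /= mul0r !mulr0 !add0r mulr_ge0// sqr_ge0.
have vp : 0 < v n t by rewrite lt_neqAle eq_sym vn0.
set r := u n t / v n t.
have ur : u n t = r * v n t by rewrite /r divfK.
have r0 : 0 <= r by rewrite divr_ge0.
have r2 : r <= 2 by rewrite ler_pdivrMr.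
have -> : (u n t ^+ 2 / v n t) ^+ 2 = r ^+ 4 * v n t ^+ 2 by rewrite ur; field.
have -> : v n t ^+ 2 + 4 * (v n t * (u n t - v n t)) + 11 * (u n t - v n t) ^+ 2 =
  (1 + 4 * (r - 1) + 11 * (r - 1) ^+ 2) * v n t ^+ 2 by rewrite ur; ring.
rewrite ler_wpM2r ?sqr_ge0//.
have -> : r ^+ 4 = 1 + 4 * (r - 1) + (r ^+ 2 + 2 * r + 3) * (r - 1) ^+ 2 by ring.
by rewrite lerD2l ler_wpM2r ?sqr_ge0//; nra.
Qed.

Let rhoE n : \int[nu n]_t (v n t * (u n t - v n t)) = - H n / 2.
Proof.
have e1 := Rintegral_sqrD (sv n) (sd n).
have : \int[nu n]_t ((v n t + (u n t - v n t)) ^+ 2) = 1.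
  by rewrite -(Rintegral_sqr_root (Qu n)); apply: Rintegral_ext => t; ring.
rewrite e1 (Rintegral_sqr_root (Pv n)) -/(H n).
by move=> e2; lra.
Qed.

Let iw n : Rintegrable (nu n) (fun t => w n t ^+ 2).
Proof.
apply: (@Rintegrable_le _ _ _ _ _
  (fun t => v n t ^+ 2 + 4 * (v n t * (u n t - v n t)) + 11 * (u n t - v n t) ^+ 2)).
- exact: measurable_funX.
- by move=> t; rewrite ger0_norm ?sqr_ge0// w2.
apply: RintegrableD; last by apply: RintegrableZ; exact: (sd n).2.
apply: RintegrableD; first exact: (sv n).2.
by apply: RintegrableZ; exact: sq_integrable_mul.
Qed.

Let int_w2 n : \int[nu n]_t (w n t ^+ 2) <= 1 + 9 * H n.
Proof.
have i1 := RintegrableZ 4 (sq_integrable_mul (sv n) (sd n)).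
have i2 := RintegrableZ 11 (sd n).2.
apply: (le_trans (Rintegral_le (iw n) _ (w2 n))).
  by apply: RintegrableD => //; apply: RintegrableD => //; exact: (sv n).2.
rewrite RintegralD//; last by apply: RintegrableD => //; exact: (sv n).2.
rewrite RintegralD//; last exact: (sv n).2.
rewrite !RintegralZl//; [|exact: (sd n).2|exact: sq_integrable_mul].
by rewrite rhoE (Rintegral_sqr_root (Pv n)) -/(H n); lra.
Qed.

Let int_w2_expn n : (\int[nu n]_t (w n t ^+ 2)) ^+ n <= expR (9 * (n%:R * H n)).
Proof.
have -> : expR (9 * (n%:R * H n)) = expR (9 * H n) ^+ n.
  by rewrite -expRM_natl; congr expR; ring.
rewrite lerXn2r ?nnegrE ?Rintegral_sqr_ge0 ?expR_ge0//.
exact: le_trans (int_w2 n) (expR_ge1Dx _).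
Qed.

Let ig n : Rintegrable (nu n) (g n).
Proof.
apply: (Rintegrable_le _ _ (su n).2).
  by apply: measurable_funM; [exact: measurable_funB|exact: measurable_funX].
move=> t; case/andP: (b01 n t) => b0 b1; rewrite /g normrM.
rewrite (ger0_norm (sqr_ge0 _)) ler_piMl ?sqr_ge0// ger0_norm; lra.
Qed.

Let eps n := \int[nu n]_t (b n t * u n t ^+ 2).

(** On the event u > 2v one has u <= 2 (u - v). So the mass [eps n] that the truncation removes is
    o(1/n), and n coordinates together lose o(1). *)
Let eps_le n : n%:R * eps n <= 4 * (n%:R * \int[nu n]_t (b n t * (u n t - v n t) ^+ 2)).
Proof.
rewrite mulrCA ler_wpM2l// -RintegralZl//; last exact: ib (sd n).2.
apply: Rintegral_le; [exact: ib (su n).2|by apply: RintegrableZ; exact: ib (sd n).2|].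
move=> t; rewrite /b indicE; case: (boolP (t \in B n)) => [|_]; last by rewrite !mul0r mulr0.
rewrite inE /B /= !mul1r; have := v0 n t; have := u0 n t; nra.
Qed.

Let int_g n : \int[nu n]_t g n t = 1 - eps n.
Proof.
rewrite -(Rintegral_sqr_root (Qu n)) -RintegralB//; last 2 first.
- exact: (su n).2.
- exact: ib (su n).2.
by apply: Rintegral_ext => t; rewrite /g; ring.
Qed.

Let g0 n t : 0 <= g n t.
Proof. by case/andP: (b01 n t) => b0 b1; rewrite /g mulr_ge0 ?sqr_ge0// subr_ge0. Qed.

Let g_le n t : g n t <= u n t ^+ 2.
Proof. by case/andP: (b01 n t) => b0 b1; rewrite /g ler_piMl ?sqr_ge0//; lra. Qed.

Let truncation_le n : 1 - (\int[nu n]_t g n t) ^+ n <= n%:R * eps n.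
Proof.
have e01 : 0 <= \int[nu n]_t g n t <= 1.
  rewrite {2}int_g Rintegral_ge0//= gerBl; apply: Rintegral_ge0 => t _.
  by case/andP: (b01 n t) => b0 _; rewrite mulr_ge0// sqr_ge0.
by have /andP[_] := bernoulli_onem_expr n e01; rewrite [in X in _ <= X]int_g; lra.
Qed.

(* Off the event that some u > 2v, the likelihood ratio is square integrable
   under P^n, uniformly in n. *)
Lemma DQM_contiguity (F : forall n, n.-tuple T -> R) :
  (forall n, measurable_fun setT (F n)) -> (forall n x, 0 <= F n x <= 1) ->
  \int[iid P n]_x F n x @[n --> \oo] --> 0 ->
  \int[iid (Q n) n]_x F n x @[n --> \oo] --> 0.
Proof.
move=> mF F01 FP.
pose G n := n%:R * \int[nu n]_t (b n t * (u n t - v n t) ^+ 2).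
pose bound n := 4 * G n +
  Num.sqrt (expR (9 * (n%:R * H n))) * Num.sqrt (\int[iid P n]_x F n x).
have F0 n x : 0 <= F n x by case/andP: (F01 n x).
have F1 n x : F n x <= 1 by case/andP: (F01 n x).
have iF n (m : probability (n.-tuple T) R) : Rintegrable m (F n).
  apply: (@Rintegrable_bounded _ _ _ _ _ 1); first exact: mF.
  by move=> x; rewrite ger0_norm.
have iFf n (m : probability (n.-tuple T) R) (f : n.-tuple T -> R) : Rintegrable m f ->
    Rintegrable m (fun x => F n x * f x).
  move=> fi; apply: Rintegrable_le (Rintegrable_norm fi).
    by apply: measurable_funM; [exact: mF|exact: Rintegrable_measurable fi].
  by move=> x; rewrite normrM (ger0_norm (F0 _ _)) ler_piMl.
apply: (@cvg_squeeze0 _ _ bound) => [n|]; last first.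
  rewrite -[X in _ --> X](_ : 4 * 0 +
    Num.sqrt (expR (9 * (4^-1 * \int[P]_t (h t ^+ 2)))) * 0 = 0); last first.
    by rewrite !mulr0 addr0.
  apply: cvgD; first by apply: cvgM; [exact: cvg_cst|exact: nb].
  apply: cvgM; last exact: cvg_sqrt0.
  apply: cvg_comp; last exact: sqrt_continuous.
  apply: cvg_comp; last exact: continuous_expR.
  apply: cvgM; first exact: cvg_cst.
  exact: (DQM_hellinger Qu Pv sh DQM_error0).
rewrite subr0 ger0_norm; last by apply: Rintegral_ge0 => x _.
have dU := is_density_iid n (densu n); have dV := is_density_iid n (densv n).
rewrite (Rintegral_density dU); last exact: mF.
have ig' := Rintegrable_tprod n (ig n).
have iu' := Rintegrable_tprod n (su n).2.
have sw : sq_integrable (iid (nu n) n) (tprod (w n)).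
  split; first exact: measurable_tprod.
  by apply: eq_integrable (Rintegrable_tprod n (iw n)) => // x _ /=; rewrite tprodX.
have sV : sq_integrable (iid (nu n) n) (tprod (v n)).
  split; first exact: measurable_tprod.
  by apply: eq_integrable (Rintegrable_tprod n (sv n).2) => // x _ /=; rewrite tprodX.
have sFV : sq_integrable (iid (nu n) n) (fun x => F n x * tprod (v n) x).
  apply: (sq_integrable_le _ _ sV).
    by apply: measurable_funM; [exact: mF|exact: measurable_tprod].
  by move=> x; rewrite normrM (ger0_norm (F0 _ _)) ler_piMl.
have gu (x : n.-tuple T) : tprod (g n) x <= tprod (fun t => u n t ^+ 2) x.
  by apply: ler_prod => i _; rewrite g0 g_le.
(* As F <= 1, replacing u^2 by g in every coordinate costs at most the difference of total masses, 1
   - (1 - eps)^n. *)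
have step : \int[iid (nu n) n]_x (F n x * tprod (fun t => u n t ^+ 2) x) <=
    \int[iid (nu n) n]_x (F n x * tprod (g n) x) + n%:R * eps n.
  apply: (@le_trans _ _ (\int[iid (nu n) n]_x (F n x * tprod (g n) x) +
    (\int[iid (nu n) n]_x tprod (fun t => u n t ^+ 2) x -
     \int[iid (nu n) n]_x tprod (g n) x))).
    rewrite -RintegralB// -RintegralD//; [|exact: iFf|exact: RintegrableB].
    apply: Rintegral_le; [exact: iFf| |move=> x].
      by apply: RintegrableD; [exact: iFf|exact: RintegrableB].
    have := gu x; have := F0 n x; have := F1 n x; nra.
  rewrite lerD2l Rintegral_tprod; last exact: (su n).2.
  rewrite Rintegral_tprod// (Rintegral_sqr_root (Qu n)) expr1n.
  exact: truncation_le.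
apply: (le_trans step); rewrite addrC /bound lerD//.
(* Cauchy-Schwarz pairs the product of the w with F times the product of the v; by F^2 <= F the
   latter has squared norm at most the mean of F under P^n. *)
have -> : \int[iid (nu n) n]_x (F n x * tprod (g n) x) =
    \int[iid (nu n) n]_x (tprod (w n) x * (F n x * tprod (v n) x)).
  apply: Rintegral_ext => x; rewrite mulrCA tprodM; congr (_ * _).
  by apply: eq_bigr => i _; rewrite wv.
apply: (le_trans (ler_norm _)); apply: cauchy_schwarz_le => //.
  rewrite sqr_sqrtr ?expR_ge0//.
  under eq_Rintegral do rewrite tprodX.
  by rewrite Rintegral_tprod// int_w2_expn.
rewrite sqr_sqrtr; last by apply: Rintegral_ge0 => x _.
rewrite (Rintegral_density dV); last exact: mF.
apply: Rintegral_le.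
- by case: sFV.
- exact: Rintegrable_density dV (iF _ _).
move=> x; rewrite exprMn -tprodX ler_wpM2r ?sqr_ge0//.
have := F0 n x; have := F1 n x; nra.
Qed.

End contiguity.

(** * Centered normal laws *)

Section normal_integrals.
Context (R : realType).
Local Notation leb := (@lebesgue_measure R).
Implicit Types (m s t v : R) (f g : R -> R).

Lemma ge0_integral_normal m s (F : R -> \bar R) : measurable_fun setT F ->
  (forall x, 0 <= F x)%E ->
  (\int[normal_prob m s]_x F x = \int[leb]_x (F x * (normal_pdf m s x)%:E))%E.
Proof.
move=> mF F0.
have dom := normal_prob_dominates m s.
rewrite -(Radon_Nikodym_SigmaFinite.change_of_variables dom F0)//.
have mpdf : measurable_fun setT (fun x => (normal_pdf m s x)%:E).
  by apply/measurable_EFinP; exact: measurable_normal_pdf.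
have mf : measurable_fun setT (Radon_Nikodym_SigmaFinite.f (normal_prob m s) leb).
  exact: measurable_int (Radon_Nikodym_SigmaFinite.f_integrable _).
apply: ae_eq_integral => //; [exact: emeasurable_funM|exact: emeasurable_funM|].
apply: ae_eqe_mul2l; apply: integral_ae_eq => //.
  exact: Radon_Nikodym_SigmaFinite.f_integrable.
by move=> A _ mA; rewrite -Radon_Nikodym_SigmaFinite.f_integral.
Qed.

Lemma ge0_integral_shift (c : R) g : continuous g -> (forall x, 0 <= g x) ->
  (\int[leb]_x (g x)%:E = \int[leb]_x (g (x + c))%:E)%E.
Proof.
move=> cg g0; pose F (x : R^o) : R^o := x + c.
have F1 : F^`()%classic = cst 1.
  by apply/funext => x; rewrite /F derive1E deriveD// derive_id derive_cst addr0.
rewrite (@increasing_ge0_integration_by_substitutionT _ F)//.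
- by apply: eq_integral => x _; rewrite F1 /= mulr1.
- by move=> x y xy; rewrite /F ltrD2r.
- by rewrite F1 => x; exact: cvg_cst.
- by rewrite F1; exact: is_cvg_cst.
- by rewrite F1; exact: is_cvg_cst.
- exact: cvg_addrr_Ny.
- exact: cvg_addrr.
Qed.

(** Bayes' formula for Gaussians: if y is N(0, s^2) and z - y is an independent N(0, t^2), then z is
    N(0, r^2), and given z the law of y is normal with mean z s^2 / r^2 and standard deviation s t /
    r. *)
Lemma normal_pdf_convolution s t (y z : R) : 0 < s -> 0 < t ->
  let r := Num.sqrt (s ^+ 2 + t ^+ 2) in
  normal_pdf 0 t (z - y) * normal_pdf 0 s y =
  normal_pdf 0 r z * normal_pdf (z * (s / r) ^+ 2) (s * t / r) y.
Proof.
move=> s0 t0 r.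
have r2 : r ^+ 2 = s ^+ 2 + t ^+ 2 by rewrite sqr_sqrtr// addr_ge0 ?sqr_ge0.
have r0 : 0 < r by rewrite sqrtr_gt0 addr_gt0 ?exprn_gt0.
have q0 : 0 < s * t / r by rewrite divr_gt0 ?mulr_gt0.
rewrite !normal_pdfE ?gt_eqF// /normal_fun mulrACA [RHS]mulrACA; congr (_ * _).
  rewrite /normal_peak -!invfM; congr (_^-1).
  have nn (x : R) : 0 <= x ^+ 2 * pi *+ 2.
    by apply: mulrn_wge0; apply: mulr_ge0; [exact: sqr_ge0|exact: pi_ge0].
  rewrite -(sqrtrM _ (nn t)) -(sqrtrM _ (nn r)); congr Num.sqrt.
  by field; rewrite gt_eqF.
rewrite -!expRD; congr expR; rewrite !subr0.
have -> : (s / r) ^+ 2 = s ^+ 2 / (s ^+ 2 + t ^+ 2) by rewrite expr_div_n r2.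
have -> : (s * t / r) ^+ 2 = s ^+ 2 * t ^+ 2 / (s ^+ 2 + t ^+ 2).
  by rewrite expr_div_n exprMn r2.
rewrite r2; field.
by rewrite !gt_eqF ?addr_gt0 ?exprn_gt0.
Qed.

(** A substitution moves the shift from g to the density, Tonelli exchanges the integrals, and the
    conditional density of y integrates to 1. *)
Lemma ge0_normal_convolution s t g : 0 < s -> 0 < t ->
  continuous g -> (forall x, 0 <= g x) ->
  (\int[normal_prob 0 s]_y \int[normal_prob 0 t]_z (g (y + z))%:E =
   \int[normal_prob 0 (Num.sqrt (s ^+ 2 + t ^+ 2))]_z (g z)%:E)%E.
Proof.
move=> s0 t0 cg g0; set r := Num.sqrt _.
have mg : measurable_fun setT g by exact: continuous_measurable_fun.
have cpdf : continuous (normal_pdf 0 t) by apply: continuous_normal_pdf; rewrite gt_eqF.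
have inner y : (\int[normal_prob 0 t]_z (g (y + z))%:E =
    \int[leb]_z (g z * normal_pdf 0 t (z - y))%:E)%E.
  rewrite ge0_integral_normal; first last.
  - by move=> z; rewrite lee_fin.
  - apply/measurable_EFinP; apply: measurableT_comp => //.
    exact: measurable_funD.
  rewrite (@ge0_integral_shift y (fun z => g z * normal_pdf 0 t (z - y))).
  - by apply: eq_integral => z _; rewrite -EFinM addrK addrC.
  - move=> z; apply: cvgM; first exact: cg.
    apply: cvg_comp; last exact: cpdf.
    by apply: (@cvgB _ R^o); [exact: cvg_id|exact: cvg_cst].
  - by move=> z; rewrite mulr_ge0// normal_pdf_ge0.
under eq_integral do rewrite inner.
pose h (p : R * R) := (g p.2 * normal_pdf 0 t (p.2 - p.1) * normal_pdf 0 s p.1)%:E.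
have mh0 : measurable_fun setT (fun p : R * R => g p.2 * normal_pdf 0 t (p.2 - p.1)).
  apply: measurable_funM; first exact: measurableT_comp mg measurable_snd.
  apply: measurableT_comp (measurable_normal_pdf _ _) _.
  exact: measurable_funB measurable_snd measurable_fst.
have mh : measurable_fun setT h.
  apply/measurable_EFinP/measurable_funM => //.
  exact: measurableT_comp (measurable_normal_pdf _ _) measurable_fst.
have h0 p : (0 <= h p)%E by rewrite lee_fin !mulr_ge0// normal_pdf_ge0.
rewrite [LHS]ge0_integral_normal; first last.
- by move=> y; apply: integral_ge0 => z _; rewrite lee_fin mulr_ge0// normal_pdf_ge0.
- pose k (p : R * R) := (g p.2 * normal_pdf 0 t (p.2 - p.1))%:E.
  have k0 p : (0 <= k p)%E by rewrite lee_fin mulr_ge0// normal_pdf_ge0.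
  have mk : measurable_fun setT k by exact/measurable_EFinP.
  exact: (@measurable_fun_fubini_tonelli_F _ _ _ _ _ leb k mk k0).
transitivity (\int[leb]_y \int[leb]_z h (y, z))%E.
  apply: eq_integral => y _; rewrite -ge0_integralZr//.
  - apply/measurable_EFinP; exact: measurableT_comp mh0 (measurable_pair1 y).
  - by move=> z _; rewrite lee_fin mulr_ge0// normal_pdf_ge0.
  - by rewrite lee_fin normal_pdf_ge0.
rewrite fubini_tonelli// ge0_integral_normal//; last exact/measurable_EFinP.
apply: eq_integral => z _.
under eq_integral do rewrite /h/= -mulrA normal_pdf_convolution// mulrA EFinM.
rewrite ge0_integralZl//; first by rewrite integral_normal_pdf mule1 EFinM.
- by apply/measurable_EFinP; exact: measurable_normal_pdf.
- by move=> y _; rewrite lee_fin normal_pdf_ge0.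
- by rewrite lee_fin mulr_ge0// normal_pdf_ge0.
Qed.

(** Adding the bound M makes the integrand nonnegative; M is then subtracted on both sides. *)
Lemma normal_convolution s t g (M : R) : 0 < s -> 0 < t ->
  continuous g -> (forall x, `|g x| <= M) ->
  \int[normal_prob 0 s]_y \int[normal_prob 0 t]_z g (y + z) =
  \int[normal_prob 0 (Num.sqrt (s ^+ 2 + t ^+ 2))]_z g z.
Proof.
move=> s0 t0 cg gM.
pose Ns : probability (measurableTypeR R) R := normal_prob 0 s.
pose Nt : probability (measurableTypeR R) R := normal_prob 0 t.
pose Nr : probability (measurableTypeR R) R := normal_prob 0 (Num.sqrt (s ^+ 2 + t ^+ 2)).
have mg : measurable_fun setT g by exact: continuous_measurable_fun.
have ig (N : probability (measurableTypeR R) R) : Rintegrable N g.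
  exact: (@Rintegrable_bounded _ (measurableTypeR R) _ N _ M mg gM).
have mgD (y : R) : measurable_fun setT (fun z => g (y + z)).
  by apply: measurableT_comp => //; exact: measurable_funD.
have igD (N : probability (measurableTypeR R) R) (y : R) : Rintegrable N (fun z => g (y + z)).
  exact: (@Rintegrable_bounded _ (measurableTypeR R) _ N _ M (mgD y) (fun z => gM _)).
have icst (N : probability (measurableTypeR R) R) (c : R) : Rintegrable N (fun=> c).
  exact: finite_measure_integrable_cst.
have mg2 : measurable_fun setT (fun p : R * R => g (p.1 + p.2)).
  by apply: measurableT_comp => //; exact: measurable_funD measurable_fst measurable_snd.
have ig2 := @Rintegrable_section2 _ _ (measurableTypeR R) (measurableTypeR R) _
  Ns Nt _ M mg2 (fun p => gM _).
have gM0 x : 0 <= g x + M by have := gM x; rewrite ler_norml => /andP[]; lra.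
have cgM : continuous (fun x => g x + M).
  by move=> x; apply: cvgD; [exact: cg|exact: cvg_cst].
have iN (N : probability (measurableTypeR R) R) f : Rintegrable N f ->
    (\int[N]_z (f z + M)%:E = (\int[N]_z f z + M)%:E)%E.
  move=> fi; rewrite -{2}(Rintegral_prob_cst N M) -(RintegralD measurableT fi (icst N M)).
  by rewrite (EFin_Rintegral (RintegrableD fi (icst N M))).
have E := ge0_normal_convolution s0 t0 cgM gM0.
have ER := iN Nr g (ig Nr).
have EL : (\int[Ns]_y \int[Nt]_z (g (y + z) + M)%:E =
    (\int[Ns]_y \int[Nt]_z g (y + z) + M)%:E)%E.
  rewrite -(iN Ns _ ig2); apply: eq_integral => y _.
  exact: iN Nt _ (igD Nt y).
apply: (@addIr _ M); apply: EFin_inj.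
by rewrite -[LHS]EL -[RHS]ER; exact: E.
Qed.

End normal_integrals.

Section normal_moments.
Context (R : realType).
Local Notation leb := (@lebesgue_measure R).
Variable s : R.
Hypothesis s0 : 0 < s.
Let N : probability (measurableTypeR R) R := normal_prob 0 s.

(* The likelihood ratio of N(m, t^2) with respect to N(0, s^2). *)
Let ratio (m t x : R) : R :=
  s / t * expR (x ^+ 2 / (s ^+ 2 *+ 2) - (x - m) ^+ 2 / (t ^+ 2 *+ 2)).

Let measurable_ratio m t : measurable_fun setT (ratio m t).
Proof.
apply: measurable_funM => //; apply: measurableT_comp => //.
apply: measurable_funB; apply: measurable_funM => //; apply: measurable_funX => //.
exact: measurable_funB.
Qed.

Let ratio_pdf m t x : 0 < t -> ratio m t x * normal_pdf 0 s x = normal_pdf m t x.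
Proof.
move=> t0; rewrite /ratio !normal_pdfE ?gt_eqF// mulrACA -expRD.
congr (_ * _); last by congr expR; rewrite subr0; ring.
have peakE r : 0 < r -> normal_peak r = (r * Num.sqrt (pi *+ 2))^-1.
  move=> r0; rewrite /normal_peak -mulrnAr sqrtrM ?sqr_ge0//.
  by rewrite sqrtr_sqr gtr0_norm.
rewrite !peakE//; field.
by rewrite !gt_eqF// sqrtr_gt0 pmulrn_lgt0// pi_gt0.
Qed.

Let ge0_integral_ratio m t : 0 < t -> (\int[N]_x (ratio m t x)%:E = 1)%E.
Proof.
move=> t0; rewrite ge0_integral_normal.
- rewrite -(integral_normal_pdf m t); apply: eq_integral => x _.
  by rewrite -EFinM ratio_pdf.
- by apply/measurable_EFinP; exact: measurable_ratio.
- by move=> x; rewrite lee_fin mulr_ge0 ?expR_ge0// divr_ge0// ltW.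
Qed.

Let Rintegrable_ratio m t : 0 < t -> Rintegrable N (ratio m t).
Proof.
move=> t0; apply/integrableP; split.
  by apply/measurable_EFinP; exact: measurable_ratio.
under eq_integral => x _.
  rewrite /= ger0_norm; last by rewrite mulr_ge0 ?expR_ge0// divr_ge0// ltW.
  over.
by rewrite ge0_integral_ratio// ltry.
Qed.

Let Rintegral_ratio m t : 0 < t -> \int[N]_x ratio m t x = 1.
Proof. by move=> t0; rewrite /Rintegral ge0_integral_ratio. Qed.

Let sqr_le_expR (y : R) : 0 <= y -> y ^+ 2 <= expR (2 * y).
Proof.
move=> y0; rewrite expRM_natl lerXn2r ?nnegrE ?expR_ge0//.
by apply: (le_trans _ (expR_ge1Dx y)); rewrite lerDr.
Qed.

(* The bound is 64 s^4 times the likelihood ratio of N(0, 2 s^2), up to a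
   factor sqrt 2 <= 2. *)
Let pow4_le x : x ^+ 4 <= 128 * s ^+ 4 * ratio 0 (Num.sqrt 2 * s) x.
Proof.
have sq2 : Num.sqrt 2 ^+ 2 = 2 :> R by rewrite sqr_sqrtr.
have sq2p : 0 < Num.sqrt 2 :> R by rewrite sqrtr_gt0.
have y0 : 0 <= x ^+ 2 / (8 * s ^+ 2) by apply: divr_ge0; rewrite ?sqr_ge0// mulr_ge0// sqr_ge0.
have H := sqr_le_expR y0.
rewrite /ratio subr0.
have -> : x ^+ 2 / (s ^+ 2 *+ 2) - x ^+ 2 / ((Num.sqrt 2 * s) ^+ 2 *+ 2) =
    2 * (x ^+ 2 / (8 * s ^+ 2)).
  by rewrite exprMn sq2; field; rewrite gt_eqF.
have -> : x ^+ 4 = 64 * s ^+ 4 * (x ^+ 2 / (8 * s ^+ 2)) ^+ 2 by field; rewrite gt_eqF.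
set e := expR _ in H *; have e0 : 0 <= e by exact: expR_ge0.
have -> : s / (Num.sqrt 2 * s) = (Num.sqrt 2)^-1 by field; rewrite !gt_eqF.
have i2 : 2^-1 <= (Num.sqrt 2)^-1 :> R.
  have sq22 : Num.sqrt 2 <= 2 :> R by rewrite leNgt; apply/negP => h; nra.
  by rewrite lef_pV2 ?posrE.
have -> : 128 * s ^+ 4 * ((Num.sqrt 2)^-1 * e) = 64 * s ^+ 4 * (2 * (Num.sqrt 2)^-1 * e) by ring.
apply: ler_wpM2l; first by rewrite mulr_ge0// exprn_ge0// ltW.
apply: (le_trans H); rewrite ler_peMl//. lra.
Qed.

Let sqrt2s : 0 < Num.sqrt 2 * s. Proof. by rewrite mulr_gt0// sqrtr_gt0. Qed.

Lemma Rintegrable_normal_pow4 : Rintegrable N (fun x => x ^+ 4).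
Proof.
apply: Rintegrable_le (RintegrableZ (128 * s ^+ 4) (Rintegrable_ratio 0 sqrt2s)).
  exact: measurable_funX.
move=> x; rewrite ger0_norm; first exact: pow4_le.
by rewrite exprn_even_ge0.
Qed.

Lemma Rintegral_normal_pow4_le : \int[N]_x (x ^+ 4) <= 128 * s ^+ 4.
Proof.
apply: (@le_trans _ _ (\int[N]_x (128 * s ^+ 4 * ratio 0 (Num.sqrt 2 * s) x))).
  apply: Rintegral_le; [exact: Rintegrable_normal_pow4| |exact: pow4_le].
  by apply: RintegrableZ; exact: Rintegrable_ratio.
rewrite RintegralZl//; last exact: Rintegrable_ratio.
by rewrite Rintegral_ratio// mulr1.
Qed.

Lemma sq_integrable_normal : sq_integrable N id.
Proof.
split => //.
apply: (@Rintegrable_le _ (measurableTypeR R) _ N (fun x => x ^+ 2) (fun x => 1 + x ^+ 4)).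
- exact: measurable_funX.
- move=> x; rewrite ger0_norm ?sqr_ge0//; have := sqr_ge0 (x ^+ 2 - 2^-1).
  have -> : x ^+ 4 = (x ^+ 2) ^+ 2 by ring.
  by rewrite /=; nra.
apply: RintegrableD; last exact: Rintegrable_normal_pow4.
exact: finite_measure_integrable_cst.
Qed.

Let Rintegrable_normal_id : Rintegrable N id.
Proof. exact: sq_integrable_integrable sq_integrable_normal. Qed.

(* Jensen's inequality for the logarithm of the likelihood ratio. *)
Let gibbs m t : 0 < t ->
  s / t * (1 + \int[N]_x (x ^+ 2 / (s ^+ 2 *+ 2) - (x - m) ^+ 2 / (t ^+ 2 *+ 2))) <= 1.
Proof.
move=> t0; have i2 := sq_integrable_normal.2.
have i1 := Rintegrable_normal_id.
have ic c : Rintegrable N (fun=> c) by exact: finite_measure_integrable_cst.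
pose q (x : R) := x ^+ 2 / (s ^+ 2 *+ 2) - (x - m) ^+ 2 / (t ^+ 2 *+ 2).
have iq : Rintegrable N q.
  have := RintegrableD (RintegrableD (RintegrableZ ((s ^+ 2 *+ 2)^-1 - (t ^+ 2 *+ 2)^-1) i2)
    (RintegrableZ (2 * m / (t ^+ 2 *+ 2)) i1)) (ic (- m ^+ 2 / (t ^+ 2 *+ 2))).
  by apply: eq_integrable => // x _ /=; congr EFin; rewrite /q; ring.
have i1q := RintegrableD (ic 1) iq.
have -> : s / t * (1 + \int[N]_x q x) = \int[N]_x (s / t * (1 + q x)).
  by rewrite (RintegralZl _ measurableT i1q) (RintegralD measurableT (ic 1) iq) Rintegral_prob_cst.
rewrite -[leRHS](Rintegral_ratio m t0).
apply: Rintegral_le; [exact: RintegrableZ|exact: Rintegrable_ratio|].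
by move=> x; apply: ler_wpM2l; [rewrite divr_ge0// ltW|exact: expR_ge1Dx].
Qed.

(** [gibbs] for the shifted law N(m, s^2) says m a <= m^2 / 2 for every m, where a is the mean; at m
    = a this forces a = 0. *)
Lemma Rintegral_normal_id : \int[N]_x x = 0.
Proof.
set a := \int[N]_x x.
have H m : m * a <= m ^+ 2 / 2.
  have := gibbs m s0; rewrite divff ?gt_eqF// mul1r gerDl.
  have -> : \int[N]_x (x ^+ 2 / (s ^+ 2 *+ 2) - (x - m) ^+ 2 / (s ^+ 2 *+ 2)) =
     \int[N]_x (m / s ^+ 2 * x - m ^+ 2 / (s ^+ 2 *+ 2)).
    by apply: Rintegral_ext => x; field; rewrite gt_eqF.
  rewrite RintegralB//; last 2 first.
  - exact: RintegrableZ.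
  - exact: finite_measure_integrable_cst.
  rewrite RintegralZl// -/a Rintegral_prob_cst subr_le0.
  have s2 : 0 < s ^+ 2 by rewrite exprn_gt0.
  have -> : m / s ^+ 2 * a = m * a / s ^+ 2 by ring.
  have -> : m ^+ 2 / (s ^+ 2 *+ 2) = m ^+ 2 / 2 / s ^+ 2 by field; rewrite gt_eqF.
  by rewrite ler_pM2r ?invr_gt0.
have := H a; rewrite -expr2 => Ha.
by apply/eqP; rewrite -sqrf_eq0 eq_le sqr_ge0 andbT; have := sqr_ge0 a; lra.
Qed.

(** [gibbs] at mean 0 and scale s / t gives t (1 - (t^2 - 1) k / 2) <= 1 for all t > 0, with
    equality at t = 1. The derivative there is 1 - k, so k = 1. [E] is this inequality at t = 1 + d,
    with the terms of higher order on the right. *)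
Lemma Rintegral_normal_sqr : \int[N]_x (x ^+ 2) = s ^+ 2.
Proof.
have s2 : 0 < s ^+ 2 by rewrite exprn_gt0.
set k := \int[N]_x (x ^+ 2) / s ^+ 2.
suff : k = 1 by rewrite /k => /(canRL (mulfVK (lt0r_neq0 s2))); rewrite mul1r.
have k0 : 0 <= k by rewrite divr_ge0 ?sqr_ge0 ?Rintegral_sqr_ge0.
have H (t : R) : 0 < t -> t * (1 - (t ^+ 2 - 1) * k / 2) <= 1.
  move=> t0; have st0 : 0 < s / t by rewrite divr_gt0.
  have := gibbs 0 st0.
  have -> : \int[N]_x (x ^+ 2 / (s ^+ 2 *+ 2) - (x - 0) ^+ 2 / ((s / t) ^+ 2 *+ 2)) =
     \int[N]_x ((1 - t ^+ 2) / (s ^+ 2 *+ 2) * x ^+ 2).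
    by apply: Rintegral_ext => x; field; rewrite !gt_eqF.
  rewrite RintegralZl//; last exact: sq_integrable_normal.2.
  have -> : s / (s / t) = t by field; rewrite !gt_eqF.
  have -> : (1 - t ^+ 2) / (s ^+ 2 *+ 2) * \int[N]_x (x ^+ 2) = - ((t ^+ 2 - 1) * k / 2).
    by rewrite /k; field; rewrite gt_eqF.
  by [].
have E (d : R) : `|d| < 1 -> d * (1 - k) <= d ^+ 2 * (2 * k).
  move=> /ltr_normlP[d1 d2]; have t0 : 0 < 1 + d by lra.
  have := H (1 + d) t0.
  have -> : (1 + d) * (1 - ((1 + d) ^+ 2 - 1) * k / 2) =
    1 + d * (1 - k) - d ^+ 2 * k * (3 + d) / 2 by field.
  have : d ^+ 2 * k * (3 + d) / 2 <= d ^+ 2 * (2 * k).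
    have -> : d ^+ 2 * (2 * k) = d ^+ 2 * k * 4 / 2 by field.
    rewrite ler_pM2r ?invr_gt0//; apply: ler_wpM2l; last by lra.
    by apply: mulr_ge0 => //; exact: sqr_ge0.
  lra.
apply/eqP; rewrite -subr_eq0; apply/eqP.
have key c : (forall d, 0 < d -> d < 1 -> c <= d * (2 * k)) -> c <= 0.
  move=> Hc; rewrite leNgt; apply/negP => c0.
  (* Small enough that d (2k) <= c / 2, against c <= d (2k) with c > 0. *)
  pose d := Num.min 2^-1 (c / (4 * (k + 1))).
  have k1 : 0 < k + 1 by lra.
  have dp : 0 < d by rewrite lt_min invr_gt0 ltr0n divr_gt0 ?mulr_gt0.
  have d1 : d < 1 by rewrite gt_min; apply/orP; left; lra.
  have dc : d <= c / (4 * (k + 1)) by rewrite ge_min lexx orbT.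
  have := Hc d dp d1.
  have : d * (2 * k) <= c / (4 * (k + 1)) * (2 * (k + 1)).
    by apply: ler_pM => //; [rewrite ltW|rewrite mulr_ge0|lra].
  have -> : c / (4 * (k + 1)) * (2 * (k + 1)) = c / 2 by field; rewrite gt_eqF.
  lra.
apply/eqP; rewrite eq_le; apply/andP; split.
  apply: key => d d0 d1; have := E (- d); rewrite normrN gtr0_norm// => /(_ d1).
  have -> : - d * (1 - k) = d * (k - 1) by ring.
  have -> : (- d) ^+ 2 * (2 * k) = d * (d * (2 * k)) by ring.
  by rewrite ler_pM2l.
rewrite -oppr_le0 opprB; apply: key => d d0 d1; have := E d; rewrite gtr0_norm// => /(_ d1).
have -> : d ^+ 2 * (2 * k) = d * (d * (2 * k)) by ring.
by rewrite ler_pM2l.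
Qed.

End normal_moments.

Section centered_normal_facts.
Context (R : realType).
Local Notation delta0 := (\d_(0 : measurableTypeR R) : probability (measurableTypeR R) R).
Implicit Types (u v : R) (g : R -> R).

Lemma centered_normal0 : @centered_normal R 0 = delta0.
Proof. by rewrite /centered_normal eqxx. Qed.

Lemma centered_normal_gt0 v : 0 < v ->
  centered_normal v = normal_prob 0 (Num.sqrt v) :> probability _ _.
Proof. by move=> v0; rewrite /centered_normal gt_eqF. Qed.

Lemma Rintegral_delta0 g : measurable_fun setT g -> \int[delta0]_x g x = g 0.
Proof.
move=> mg; rewrite /Rintegral integral_dirac//; last exact/measurable_EFinP.
by rewrite [X in (X * _)%E](_ : _ = 1%E) ?mul1e//; exact: diracT.
Qed.

Lemma Rintegrable_delta0 g : measurable_fun setT g -> Rintegrable delta0 g.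
Proof.
move=> mg; apply/integrableP; split; first exact/measurable_EFinP.
rewrite integral_dirac//; last by do 2 apply: measurableT_comp => //.
by rewrite [X in (X * _)%E](_ : _ = 1%E) ?mul1e ?ltry//; exact: diracT.
Qed.

Lemma centered_normal_convolution u v g (M : R) : 0 <= u -> 0 <= v ->
  continuous g -> (forall x, `|g x| <= M) ->
  \int[centered_normal u]_y \int[centered_normal v]_z g (y + z) =
  \int[centered_normal (u + v)]_z g z.
Proof.
move=> u0 v0 cg gM; have mg : measurable_fun setT g by exact: continuous_measurable_fun.
have mgD (y : R) : measurable_fun setT (fun z => g (y + z)).
  by apply: measurableT_comp => //; exact: measurable_funD.
have [->|un0] := eqVneq u 0.
  rewrite centered_normal0 add0r Rintegral_delta0; last first.
    have mg2 : measurable_fun setT (fun p : R * R => g (p.1 + p.2)).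
      by apply: measurableT_comp => //; exact: measurable_funD measurable_fst measurable_snd.
    have := @Rintegrable_section2 _ _ (measurableTypeR R) (measurableTypeR R) _
      (centered_normal v) (centered_normal v) _ M mg2 (fun p => gM _).
    exact: Rintegrable_measurable.
  by apply: Rintegral_ext => z; rewrite add0r.
have [->|vn0] := eqVneq v 0.
  rewrite centered_normal0 addr0; apply: Rintegral_ext => y.
  by rewrite Rintegral_delta0// addr0.
have up : 0 < u by rewrite lt_neqAle eq_sym un0.
have vp : 0 < v by rewrite lt_neqAle eq_sym vn0.
have su : 0 < Num.sqrt u by rewrite sqrtr_gt0.
have sv : 0 < Num.sqrt v by rewrite sqrtr_gt0.
have E := normal_convolution su sv cg gM.
rewrite (sqr_sqrtr u0) (sqr_sqrtr v0) in E.
rewrite (centered_normal_gt0 up) (centered_normal_gt0 vp).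
by rewrite (centered_normal_gt0 (addr_gt0 up vp)); exact: E.
Qed.

Section moments.
Variable v : R.
Hypothesis v0 : 0 <= v.
Local Notation N := (centered_normal v).

Let cases : v = 0 \/ 0 < v.
Proof. by move: v0; rewrite le_eqVlt => /predU1P[->|]; [left|right]. Qed.

Lemma sq_integrable_centered_normal : sq_integrable N id.
Proof.
case: cases => [->|vp].
  rewrite centered_normal0; split => //; apply: Rintegrable_delta0.
  exact: measurable_funX.
by rewrite centered_normal_gt0//; apply: sq_integrable_normal; rewrite sqrtr_gt0.
Qed.

Lemma Rintegral_centered_normal_id : \int[N]_x x = 0.
Proof.
case: cases => [->|vp]; first by rewrite centered_normal0 Rintegral_delta0.
by rewrite centered_normal_gt0//; apply: Rintegral_normal_id; rewrite sqrtr_gt0.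
Qed.

Lemma Rintegral_centered_normal_sqr : \int[N]_x (x ^+ 2) = v.
Proof.
case: cases => [->|vp].
  by rewrite centered_normal0 Rintegral_delta0 ?expr0n//; exact: measurable_funX.
by rewrite centered_normal_gt0// Rintegral_normal_sqr ?sqrtr_gt0// sqr_sqrtr.
Qed.

(** The arithmetic-geometric mean inequality gives |x|^3 <= s x^2 / 2 + x^4 / (2s). With the bound
    128 s^4 for the fourth moment the integral is at most s^3 / 2 + 64 s^3. *)
Lemma centered_normal_abs3 : Rintegrable N (fun x => `|x| ^+ 3) /\
  \int[N]_x (`|x| ^+ 3) <= 65 * (v * Num.sqrt v).
Proof.
have m3 : measurable_fun setT (fun x : R => `|x| ^+ 3).
  by apply: measurable_funX; exact: normr_measurable.
case: cases => [->|vp].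
  rewrite centered_normal0; split; first exact: (Rintegrable_delta0 m3).
  by rewrite (Rintegral_delta0 m3) normr0 expr0n/= mul0r mulr0.
rewrite centered_normal_gt0//; set s := Num.sqrt v.
have s0 : 0 < s by rewrite sqrtr_gt0.
have vs : v = s ^+ 2 by rewrite sqr_sqrtr.
pose M : probability (measurableTypeR R) R := normal_prob 0 s.
have i2 : Rintegrable M (fun x => x ^+ 2) := (sq_integrable_normal s0).2.
have i4 : Rintegrable M (fun x => x ^+ 4) := Rintegrable_normal_pow4 s0.
have i5 := RintegrableD (RintegrableZ (s / 2) i2) (RintegrableZ ((s *+ 2)^-1) i4).
have H x : `|x| ^+ 3 <= s / 2 * x ^+ 2 + (s *+ 2)^-1 * x ^+ 4.
  have -> : x ^+ 4 = (`|x| ^+ 2) ^+ 2 by rewrite real_normK ?num_real//; ring.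
  rewrite -(real_normK (num_real x)); set a := `|x|.
  have -> : s / 2 * a ^+ 2 + (s *+ 2)^-1 * (a ^+ 2) ^+ 2 =
    a ^+ 3 + (s *+ 2)^-1 * (a * (s - a)) ^+ 2 by field; rewrite gt_eqF.
  by rewrite lerDl mulr_ge0 ?sqr_ge0// invr_ge0 mulrn_wge0// ltW.
have i3 : Rintegrable M (fun x => `|x| ^+ 3).
  apply: Rintegrable_le i5 => // x; rewrite ger0_norm; first exact: H.
  exact: exprn_ge0.
split => //; apply: (le_trans (Rintegral_le i3 i5 H)).
have e2 : \int[M]_x (x ^+ 2) = s ^+ 2 := Rintegral_normal_sqr s0.
have e4 : \int[M]_x (x ^+ 4) <= 128 * s ^+ 4 := Rintegral_normal_pow4_le s0.
rewrite (RintegralD measurableT (RintegrableZ (s / 2) i2) (RintegrableZ ((s *+ 2)^-1) i4)).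
rewrite (RintegralZl _ measurableT i2) (RintegralZl _ measurableT i4) e2 vs.
apply: (@le_trans _ _ (s / 2 * s ^+ 2 + (s *+ 2)^-1 * (128 * s ^+ 4))).
  by rewrite lerD2l ler_wpM2l// invr_ge0 mulrn_wge0// ltW.
have -> : (s *+ 2)^-1 * (128 * s ^+ 4) = 64 * s ^+ 3 by field; rewrite gt_eqF.
have : 0 < s ^+ 3 by rewrite exprn_gt0.
have -> : s / 2 * s ^+ 2 = s ^+ 3 / 2 by field.
have -> : s ^+ 2 * s = s ^+ 3 by ring.
lra.
Qed.

End moments.

End centered_normal_facts.

(** * Smooth test functions *)

Section smoothing.
Context (R : realType).
Implicit Types (f g F : R -> R) (a b x y tau M K e : R).

(** Uniform continuity in which only x is confined to the segment and y may leave it; compactness is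
    used in its near-covering form. *)
Lemma heine_cantor f a b e : continuous f -> 0 < e ->
  exists2 dl : R, 0 < dl &
    forall x y, a <= x <= b -> `|y - x| < dl -> `|f y - f x| < e.
Proof.
move=> cf e0; have /compact_near_coveringP cov := @segment_compact R a b.
pose Pr dl x := forall y, `|y - x| < dl -> `|f y - f x| < e.
have : \forall dl \near (0 : R)^'+, `[a, b]%classic `<=` Pr dl.
  apply: cov => x _.
  have /cvgrPdist_lt /(_ (e / 2)) := cf x; rewrite divr_gt0// => /(_ isT).
  move=> /nbhs_ballP[eta /= eta0 H].
  exists (ball x (eta / 2), [set dl | dl < eta / 2]); first split => /=.
  - by apply: nbhsx_ballx; rewrite divr_gt0.
  - by apply: nbhs_right_lt; rewrite divr_gt0.
  move=> [x' dl] /= [xx' dle] y yx'.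
  have h1 : `|f x - f x'| < e / 2.
    by apply: H; apply: le_ball xx'; lra.
  have h2 : `|f x - f y| < e / 2.
    apply: H; rewrite /ball /=.
    have -> : x - y = (x - x') - (y - x') by ring.
    rewrite (le_lt_trans (ler_normB _ _))// [ltRHS]splitr ltrD//.
    exact: lt_trans dle.
  have -> : f y - f x' = (f x - f x') - (f x - f y) by ring.
  by rewrite (le_lt_trans (ler_normB _ _))// [ltRHS]splitr ltrD.
move=> H; near (0 : R)^'+ => dl; exists dl.
  by near: dl; exact: nbhs_right_gt.
have Hdl : `[a, b]%classic `<=` Pr dl by near: dl.
by move=> x y xab; apply: Hdl; rewrite /= in_itv.
Unshelve. all: by end_near.
Qed.

Lemma is_derive_continuous f (df : R -> R) :
  (forall z : R, is_derive z 1 f (df z)) -> continuous f.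
Proof.
by move=> fd z; have [dz _] := fd z; exact/differentiable_continuous/derivable1_diffP.
Qed.

Lemma mean_value f (df : R -> R) x y :
  (forall z : R, is_derive z 1 f (df z)) ->
  exists2 c, `|c - x| <= `|y| & f (x + y) - f x = df c * y.
Proof.
move=> fd; have cf := is_derive_continuous fd.
have mvt a b : a <= b -> exists2 c, c \in `[a, b]%R & f b - f a = df c * (b - a).
  by move=> ab; apply: MVT_segment => //; exact: continuous_subspaceT.
have [y0|y0] := leP 0 y.
  have xy : x <= x + y by rewrite lerDl.
  have [c] := mvt _ _ xy.
  rewrite in_itv /= => /andP[xc cy] E; exists c; last by rewrite E addrAC subrr add0r.
  by rewrite !ger0_norm ?subr_ge0// lerBlDl.
have xy : x + y <= x by rewrite gerDl ltW.
have [c] := mvt _ _ xy.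
rewrite in_itv /= => /andP[yc cx] E; exists c.
  by rewrite ler0_norm ?subr_le0// (ltr0_norm y0); lra.
by rewrite -opprB E; ring.
Qed.

Lemma lipschitz_of_derivative f (df : R -> R) K x y :
  (forall z : R, is_derive z 1 f (df z)) -> (forall z, `|df z| <= K) ->
  `|f (x + y) - f x| <= K * `|y|.
Proof.
move=> fd dK; have [c _ ->] := mean_value x y fd.
by rewrite normrM ler_wpM2r.
Qed.

Lemma taylor1_of_lipschitz f (df : R -> R) K x y :
  (forall z : R, is_derive z 1 f (df z)) ->
  (forall z w, `|df (z + w) - df z| <= K * `|w|) ->
  `|f (x + y) - f x - df x * y| <= K * `|y| ^+ 2.
Proof.
move=> fd dK; have [c cx ->] := mean_value x y fd.
have K0 : 0 <= K by have := dK 0 1; rewrite normr1 mulr1; exact: le_trans.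
rewrite -mulrBl normrM expr2 mulrA ler_wpM2r//.
have := dK x (c - x); rewrite (_ : x + (c - x) = c); last by ring.
move=> /le_trans; apply.
by rewrite ler_wpM2l.
Qed.

Lemma taylor2_of_lipschitz f (df ddf : R -> R) K x y :
  (forall z : R, is_derive z 1 f (df z)) -> (forall z : R, is_derive z 1 df (ddf z)) ->
  (forall z w, `|ddf (z + w) - ddf z| <= K * `|w|) ->
  `|f (x + y) - f x - df x * y - 2^-1 * ddf x * y ^+ 2| <= K * `|y| ^+ 3.
Proof.
move=> fd dfd dK.
pose h z := f z - df x * (z - x) - 2^-1 * ddf x * (z - x) ^+ 2.
pose dh z := df z - df x - ddf x * (z - x).
have hd (z : R) : is_derive z 1 h (dh z).
  have F := fd z.
  rewrite /h; apply: is_derive_eq.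
  rewrite /dh /GRing.scale /=.
  by field.
have [c cx E] := mean_value x y hd.
have -> : f (x + y) - f x - df x * y - 2^-1 * ddf x * y ^+ 2 = h (x + y) - h x.
  by rewrite /h; ring.
rewrite E normrM exprSr mulrA ler_wpM2r//.
have K0 : 0 <= K by have := dK 0 1; rewrite normr1 mulr1; exact: le_trans.
have := taylor1_of_lipschitz x (c - x) dfd dK.
rewrite (_ : x + (c - x) = c); last by ring.
move=> /le_trans; apply.
by rewrite ler_wpM2l// lerXn2r ?nnegrE.
Qed.

Definition vanishes_outside (f : R -> R) (a : R) := forall x, a < `|x| -> f x = 0.

(** Compact support makes f integrable on the line, so the integral from minus infinity is a
    primitive everywhere. *)
Lemma primitive_of_compact_support f a : continuous f -> vanishes_outside f a ->
  exists F, forall x : R, is_derive x 1 F (f x).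
Proof.
move=> cf fa; have mf : measurable_fun setT f by exact: continuous_measurable_fun.
have ifT : (@lebesgue_measure R).-integrable setT (EFin \o f).
  have i1 : (@lebesgue_measure R).-integrable `[- a, a] (EFin \o f).
    by apply: continuous_compact_integrable; [exact: segment_compact|exact: continuous_subspaceT].
  move: i1; rewrite integrable_mkcond// restrict_EFin => i1.
  apply: eq_integrable i1 => // x _ /=; congr EFin; rewrite patchE.
  case: ifPn => // /negP xa; rewrite fa// ltNge; apply/negP => xa'; apply: xa.
  by rewrite inE /= in_itv /= -ler_norml.
pose F x := \int[@lebesgue_measure R]_(t in `]-oo, x]) f t.
exists F => x.
have x1 : x < x + 1 by rewrite ltrDl.
have i1 : (@lebesgue_measure R).-integrable `]-oo, (x + 1)] (EFin \o f).
  by apply: integrableS ifT.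
have [dF EF] := @continuous_FTC1 R f -oo%O x (x + 1) x1 i1 (ltNyr _) (cf x).
by rewrite -EF derive1E; exact: derivableP.
Qed.

(** Averaging over [x, x + tau] gains one derivative, a difference quotient of f and thus bounded
    through sup |f| and tau. Every average is a value of f in the window, so bounds and closeness to
    f persist. *)
Lemma moving_average f a tau : 0 < tau -> continuous f -> vanishes_outside f a ->
  exists g, [/\ vanishes_outside g (a + tau),
    forall x : R, is_derive x 1 g ((f (x + tau) - f x) / tau) &
    forall x, exists2 c, x <= c <= x + tau & g x = f c].
Proof.
move=> tau0 cf fa; have [F dF] := primitive_of_compact_support cf fa.
have cF := is_derive_continuous dF.
pose g x := (F (x + tau) - F x) / tau.
have gc x : exists2 c, x <= c <= x + tau & g x = f c.
  have xt : x <= x + tau by rewrite lerDl ltW.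
  have [c] := @MVT_segment R F f x (x + tau) xt (fun z _ => dF z) (continuous_subspaceT cF).
  rewrite in_itv /= => cx E; exists c => //.
  by rewrite /g E [x + tau]addrC addrK mulfK ?gt_eqF.
exists g; split => //.
  move=> x xa; have [c /andP[xc cx] ->] := gc x; apply: fa.
  have : `|x| <= `|c| + tau.
    by have /ler_normlP[c1 c2] := lexx `|c|; apply/ler_normlP; split; lra.
  lra.
move=> x; have F1 := dF x.
have F2 := dF (x + tau).
pose sh (z : R) := z + tau.
have dsh : is_derive x 1 sh 1 by apply: is_derive_eq; rewrite addr0.
have := is_deriveZ tau^-1 (is_deriveB (@is_derive1_comp R F sh x _ _ F2 dsh) F1).
have -> : tau^-1 \*: (F \o sh - F) = g.
  by apply/funext => z; rewrite /g mulrC.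
by rewrite mulr1 [X in is_derive _ _ _ X]mulrC.
Qed.

(* The Taylor and Lipschitz bounds of a bounded C^3 function with bounded
   derivatives; g1 and g2 are its first two derivatives. *)
Definition smooth_test (K : R) (g g1 g2 : R -> R) :=
  continuous g /\ forall x,
  [/\ `|g x| <= K, `|g1 x| <= K & `|g2 x| <= K] /\
  forall y, [/\ `|g (x + y) - g x| <= K * `|y|,
    `|g2 (x + y) - g2 x| <= K * `|y|,
    `|g (x + y) - g x - g1 x * y| <= K * `|y| ^+ 2 &
    `|g (x + y) - g x - g1 x * y - 2^-1 * g2 x * y ^+ 2| <= K * `|y| ^+ 3].

(** Three successive moving averages. The constant K grows as tau shrinks, but tau depends on f and
    e only, and K is fixed before any limit in n. *)
Lemma smooth_approximation f a e : continuous f -> vanishes_outside f a -> 0 < e ->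
  exists K, exists g, exists g1, exists g2,
    smooth_test K g g1 g2 /\ forall x, `|f x - g x| <= e.
Proof.
move=> cf fa e0.
have [M fM] : exists M, forall x, `|f x| <= M.
  have cnf : {within `[- a, a], continuous (fun x => `|f x|)}.
    apply: continuous_subspaceT => x; apply: cvg_norm; exact: cf.
  have [aa|aa] := leP (- a) a; last first.
    exists 0 => x; rewrite fa ?normr0//; have := normr_ge0 x; lra.
  have [c _ Hc] := EVT_max aa cnf.
  exists `|f c| => x; have [xa|xa] := leP `|x| a; last by rewrite fa// normr0.
  by apply: Hc; rewrite in_itv /= -ler_norml.
have M0 : 0 <= M by exact: le_trans (normr_ge0 _) (fM 0).
have [dl dl0 Hdl] := heine_cantor (- (a + 1)) (a + 1) cf e0.
(* Three windows move a point by at most 3 tau: less than [dl] for the uniform continuity, and at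
   most 3/4, so that beyond a + 1 the averages see only zeros of f. *)
have [tau [tau0 taudl tau4]] : exists tau, [/\ 0 < tau, tau <= dl / 4 & tau <= 4^-1].
  exists (Num.min (dl / 4) (4^-1)); rewrite lt_min !divr_gt0 ?invr_gt0//=.
  by rewrite !ge_min !lexx orbT.
have itau0 : 0 <= tau^-1 by rewrite invr_ge0 ltW.
have [f1 [f1a df1 f1c]] := moving_average tau0 cf fa.
have [f2 [f2a df2 f2c]] := moving_average tau0 (is_derive_continuous df1) f1a.
have [g [ga dg gc]] := moving_average tau0 (is_derive_continuous df2) f2a.
pose g1 x := (f2 (x + tau) - f2 x) / tau.
pose df2' x := (f1 (x + tau) - f1 x) / tau.
pose g2 x := (df2' (x + tau) - df2' x) / tau.
have f1M x : `|f1 x| <= M by have [c _ ->] := f1c x.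
have f2M x : `|f2 x| <= M by have [c _ ->] := f2c x.
have gM x : `|g x| <= M by have [c _ ->] := gc x.
have quot (p : R -> R) (L : R) : (forall x, `|p x| <= L) ->
    forall x, `|(p (x + tau) - p x) / tau| <= 2 * L / tau.
  move=> pL x; rewrite normrM (ger0_norm itau0).
  rewrite ler_wpM2r//; apply: (le_trans (ler_normB _ _)).
  by have := pL x; have := pL (x + tau); lra.
have g1M := quot f2 M f2M.
have df2M := quot f1 M f1M.
have g2M := quot df2' (2 * M / tau) df2M.
have df1M := quot f M fM.
have df2lip x y : `|df2' (x + y) - df2' x| <= 2 * (2 * M / tau) / tau * `|y|.
  have l1 z := lipschitz_of_derivative z y df1 df1M.
  have -> : df2' (x + y) - df2' x =
    ((f1 (x + tau + y) - f1 (x + tau)) - (f1 (x + y) - f1 x)) / tau.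
    by rewrite /df2' (addrAC x tau y); field; rewrite gt_eqF.
  rewrite normrM (ger0_norm itau0).
  have -> : 2 * (2 * M / tau) / tau * `|y| = (2 * (2 * M / tau) * `|y|) / tau.
    by field; rewrite gt_eqF.
  rewrite ler_wpM2r//; apply: (le_trans (ler_normB _ _)).
  by have := l1 x; have := l1 (x + tau); lra.
have g2lip x y : `|g2 (x + y) - g2 x| <= 2 * (2 * (2 * M / tau) / tau) / tau * `|y|.
  have -> : g2 (x + y) - g2 x =
    ((df2' (x + tau + y) - df2' (x + tau)) - (df2' (x + y) - df2' x)) / tau.
    by rewrite /g2 (addrAC x tau y); field; rewrite gt_eqF.
  rewrite normrM (ger0_norm itau0).
  set L := 2 * (2 * M / tau) / tau in df2lip *.
  have -> : 2 * L / tau * `|y| = (2 * L * `|y|) / tau by field; rewrite gt_eqF.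
  rewrite ler_wpM2r//; apply: (le_trans (ler_normB _ _)).
  by have := df2lip x y; have := df2lip (x + tau) y; lra.
have dg1 (x : R) : is_derive x 1 g1 (g2 x).
  have F1 := df2 x; have F2 := df2 (x + tau).
  pose sh (z : R) := z + tau.
  have dsh : is_derive x 1 sh 1 by apply: is_derive_eq; rewrite addr0.
  have := is_deriveZ tau^-1 (is_deriveB (@is_derive1_comp R f2 sh x _ _ F2 dsh) F1).
  have -> : tau^-1 \*: (f2 \o sh - f2) = g1.
    by apply/funext => z; rewrite /g1 mulrC.
  by rewrite mulr1 [X in is_derive _ _ _ X]mulrC.
(* [t1] and [t2] bound the first two derivatives of g, and [t3] is a Lipschitz constant of the
   second. *)
pose t1 := 2 * M / tau; pose t2 := 2 * t1 / tau; pose t3 := 2 * t2 / tau.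
have t10 : 0 <= t1 by rewrite divr_ge0 ?mulr_ge0// ltW.
have t20 : 0 <= t2 by rewrite divr_ge0 ?mulr_ge0// ltW.
have t30 : 0 <= t3 by rewrite divr_ge0 ?mulr_ge0// ltW.
pose K := M + t1 + t2 + t3.
exists K, g, g1, g2; split; last first.
  move=> x; have [c1 /andP[h1 h1'] ->] := gc x.
  have [c2 /andP[h2 h2'] ->] := f2c c1; have [c3 /andP[h3 h3'] ->] := f1c c2.
  have [xa|xa] := leP `|x| (a + 1).
    rewrite distrC; apply/ltW/Hdl; first by rewrite -ler_norml.
    by rewrite ger0_norm; lra.
  have xc : `|x| <= `|c3| + 3 / 4.
    by have /ler_normlP[? ?] := lexx `|c3|; apply/ler_normlP; split; lra.
  have fx : f x = 0 by apply: fa; lra.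
  have fc : f c3 = 0 by apply: fa; lra.
  by rewrite fx fc subr0 normr0 ltW.
have wK L y : L <= K -> 0 <= y -> L * y <= K * y by move=> ? ?; rewrite ler_wpM2r.
split; first exact: is_derive_continuous dg.
move=> x; split.
  split; [apply: le_trans (gM x) _|apply: le_trans (g1M x) _|apply: le_trans (g2M x) _];
    rewrite /K -/t1 -/t2; lra.
move=> y; split.
- apply: (le_trans (lipschitz_of_derivative x y dg g1M)).
  by apply: wK => //; rewrite -/t1 /K; lra.
- apply: (le_trans (g2lip x y)).
  by apply: wK => //; rewrite -/t1 -/t2 -/t3 /K; lra.
- apply: (le_trans (taylor1_of_lipschitz x y dg (fun z w => lipschitz_of_derivative z w dg1 g2M))).
  by apply: wK; [rewrite -/t1 -/t2 /K; lra|exact: exprn_ge0].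
- apply: (le_trans (taylor2_of_lipschitz x y dg dg1 g2lip)).
  by apply: wK; [rewrite -/t1 -/t2 -/t3 /K; lra|exact: exprn_ge0].
Qed.

End smoothing.

(** * Weak convergence from smooth test functions *)

Section weak_convergence.
Context (d : measure_display) (T : measurableType d) (R : realType).
Variables (Q : forall n, probability (n.-tuple T) R).
Variables (Z : forall n, n.-tuple T -> R) (L : probability (measurableTypeR R) R).
Hypothesis mZ : forall n, measurable_fun setT (@Z n).
Hypothesis L2nd : Rintegrable L (fun y => y ^+ 2).

Definition tent (A y : R) := Num.max 0 (Num.min 1 (A + 1 - `|y|)).

Lemma tent_continuous A : continuous (tent A).
Proof.
move=> y.
apply: (@continuous_max _ _ (cst 0) (fun y => Num.min 1 (A + 1 - `|y|))); first exact: cvg_cst.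
apply: (@continuous_min _ _ (cst 1) (fun y => A + 1 - `|y|)); first exact: cvg_cst.
by apply: cvgB; [exact: cvg_cst|exact: cvg_norm].
Qed.

Lemma tent01 A y : 0 <= tent A y <= 1.
Proof. by rewrite /tent le_max lexx /= ge_max ler01 ge_min lexx. Qed.

Lemma tent_vanishes A : vanishes_outside (tent A) (A + 1).
Proof.
move=> y Ay; rewrite /tent; apply/max_idPl; rewrite ge_min; apply/orP; right.
by rewrite subr_le0 ltW.
Qed.

Lemma tent_tail A y : 0 < A -> 1 - tent A y <= (A ^+ 2)^-1 * y ^+ 2.
Proof.
move=> A0; have [yA|yA] := leP `|y| A.
  have -> : tent A y = 1.
    rewrite /tent; have -> : Num.min 1 (A + 1 - `|y|) = 1 by apply/min_idPl; lra.
    by apply/max_idPr.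
  by rewrite subrr mulr_ge0 ?invr_ge0 ?sqr_ge0.
have /andP[t0 _] := tent01 A y; apply: (@le_trans _ _ 1); first by lra.
rewrite mulrC ler_pdivlMr ?exprn_gt0// mul1r -(real_normK (num_real y)).
by rewrite lerXn2r ?nnegrE// ltW.
Qed.

(** A bounded continuous f is uniformly approximable by smooth functions only after a cutoff chi.
    The tail of L is controlled by its second moment. Tightness of the laws of Z is derived, not
    assumed: the mass where chi < 1 is read off the convergence for a smooth approximation of chi
    itself. *)
Lemma weak_cvg_smooth :
  (forall K g g1 g2, smooth_test K g g1 g2 ->
    \int[Q n]_x g (Z x) @[n --> \oo] --> \int[L]_y g y) ->
  weak_cvg Q (@Z) L.
Proof.
move=> H f cf [M0 fM0].
have M0ge : 0 <= M0 by exact: le_trans (normr_ge0 _) (fM0 0).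
pose M := M0 + 1.
have M1 : 0 < M by rewrite /M; lra.
have fM y : `|f y| <= M by apply: le_trans (fM0 y) _; rewrite /M; lra.
apply/cvgrPdist_le => e e0.
(* The errors below add up to 5 M c + 3 c, at most 8 M c + 8 c = e. *)
pose c := e / (8 * M + 8); have c0 : 0 < c by rewrite divr_gt0// addr_gt0// mulr_gt0.
pose S := \int[L]_y (y ^+ 2); have S0 : 0 <= S by exact: Rintegral_sqr_ge0.
(* S <= c A and A >= 1 give S / A^2 <= c, the Chebyshev bound for L beyond the plateau of
   [tent A]. *)
pose A := 1 + S / c; have A1 : 1 <= A by rewrite lerDl divr_ge0// ltW.
have A0 : 0 < A by exact: lt_le_trans A1.
have iL (g : R -> R) (B : R) : continuous g -> (forall y, `|g y| <= B) -> Rintegrable L g.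
  move=> cg gB; apply: (@Rintegrable_bounded _ (measurableTypeR R) _ L _ B) => //.
  exact: continuous_measurable_fun.
have iQ n (g : R -> R) (B : R) : continuous g -> (forall y, `|g y| <= B) ->
    Rintegrable (Q n) (fun x => g (Z x)).
  move=> cg gB; apply: (@Rintegrable_bounded _ _ _ (Q n) _ B); last by move=> x; exact: gB.
  exact: measurableT_comp (continuous_measurable_fun cg) (@mZ n).
pose chi := tent A; have cchi : continuous chi by exact: tent_continuous.
have chi01 y : 0 <= chi y <= 1 by exact: tent01.
have chi1 y : `|chi y| <= 1 by have /andP[a b] := chi01 y; rewrite ger0_norm.
pose fc y := f y * chi y.
have cfc : continuous fc by move=> y; apply: continuousM; [exact: cf|exact: cchi].
have fcM y : `|fc y| <= M.
  by rewrite normrM -[leRHS]mulr1 ler_pM.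
have fcv : vanishes_outside fc (A + 1) by move=> y yA; rewrite /fc /chi tent_vanishes// mulr0.
have [K [g [g1 [g2 [sg fg]]]]] := smooth_approximation cfc fcv c0.
have [K' [k [k1 [k2 [sk ck]]]]] := smooth_approximation cchi (@tent_vanishes A) c0.
have cg := sg.1; have ck' := sk.1.
have gK y : `|g y| <= K by have [[]] := sg.2 y.
have kK y : `|k y| <= K' by have [[]] := sk.2 y.
have diffbound (a b : R) : `|a - b| <= c -> a <= b + c /\ b <= a + c.
  by move=> /ler_normlP[? ?]; split; lra.
have Lchi : 1 - c <= \int[L]_y chi y.
  have i1 := iL _ _ cchi chi1.
  have : \int[L]_y (1 - chi y) <= \int[L]_y ((A ^+ 2)^-1 * y ^+ 2).
    apply: Rintegral_le; last by move=> y; exact: tent_tail.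
      by apply: RintegrableB => //; exact: finite_measure_integrable_cst.
    exact: RintegrableZ.
  rewrite RintegralZl// -/S RintegralB//; last exact: finite_measure_integrable_cst.
  rewrite Rintegral_prob_cst.
  suff : (A ^+ 2)^-1 * S <= c by lra.
  rewrite mulrC ler_pdivrMr ?exprn_gt0//.
  have : S <= c * A by rewrite /A mulrDr mulr1 mulrCA divff ?gt_eqF// mulr1; lra.
  move=> /le_trans; apply; rewrite expr2 mulrA ler_peMr//.
  by rewrite mulr_ge0// ltW.
have cstL (m : R) : Rintegrable L (fun=> m) by exact: finite_measure_integrable_cst.
have cstQ n (m : R) : Rintegrable (Q n) (fun=> m) by exact: finite_measure_integrable_cst.
have := H _ _ _ _ sg; move/cvgrPdist_le => /(_ c c0).
have := H _ _ _ _ sk; move/cvgrPdist_le => /(_ c c0).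
apply: filterS2 => n hk hg.
have [k_le k_ge] := diffbound _ _ hk.
have Lk : \int[L]_y chi y <= \int[L]_y k y + c.
  rewrite -[X in _ + X](Rintegral_prob_cst L) -RintegralD//; last exact: iL _ _ ck' kK.
  apply: Rintegral_le; first exact: iL _ _ cchi chi1.
    by apply: RintegrableD => //; exact: iL _ _ ck' kK.
  by move=> y; have [] := diffbound _ _ (ck y).
have Qk : \int[Q n]_x k (Z x) <= \int[Q n]_x chi (Z x) + c.
  rewrite -[X in _ + X](Rintegral_prob_cst (Q n)) -RintegralD//; last exact: iQ _ _ _ cchi chi1.
  apply: Rintegral_le; first exact: iQ _ _ _ ck' kK.
    by apply: RintegrableD => //; exact: iQ _ _ _ cchi chi1.
  by move=> x; have [] := diffbound _ _ (ck (Z x)).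
(* One c for the tail of L, two for exchanging chi with its smooth approximation k under L and under
   [Q n], one for the convergence of the integrals of k. *)
have Qchi : 1 - 4 * c <= \int[Q n]_x chi (Z x) by lra.
have cut (D : measure_display) (U : measurableType D) (m : probability U R) (W : U -> R) :
    Rintegrable m (fun x => f (W x)) -> Rintegrable m (fun x => chi (W x)) ->
    Rintegrable m (fun x => fc (W x)) ->
    `|\int[m]_x f (W x) - \int[m]_x fc (W x)| <= M * (1 - \int[m]_x chi (W x)).
  move=> i1 i2 i3.
  have ic (t : R) : Rintegrable m (fun=> t) by exact: finite_measure_integrable_cst.
  have -> : 1 - \int[m]_x chi (W x) = \int[m]_x (1 - chi (W x)).
    by rewrite (RintegralB measurableT (ic 1) i2) Rintegral_prob_cst.
  rewrite -RintegralB// -RintegralZl//; last exact: RintegrableB.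
  apply: Rintegral_norm_le; [exact: RintegrableB|by apply: RintegrableZ; exact: RintegrableB|].
  move=> x; have -> : f (W x) - fc (W x) = f (W x) * (1 - chi (W x)) by rewrite /fc; ring.
  have /andP[a b] := chi01 (W x).
  by rewrite normrM (ger0_norm (_ : 0 <= 1 - _)) ?subr_ge0// ler_wpM2r// subr_ge0.
have approx (D : measure_display) (U : measurableType D) (m : probability U R) (W : U -> R) :
    Rintegrable m (fun x => g (W x)) -> Rintegrable m (fun x => fc (W x)) ->
    `|\int[m]_x fc (W x) - \int[m]_x g (W x)| <= c.
  move=> i1 i2; rewrite -RintegralB// -[leRHS](Rintegral_prob_cst m c).
  apply: Rintegral_norm_le => //; first exact: RintegrableB.
  exact: finite_measure_integrable_cst.
have q1 := cut _ _ _ _ (iQ n _ _ cf fM) (iQ n _ _ cchi chi1) (iQ n _ _ cfc fcM).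
have q2 := cut _ _ L id (iL _ _ cf fM) (iL _ _ cchi chi1) (iL _ _ cfc fcM).
have q3 := approx _ _ _ _ (iQ n _ _ cg gK) (iQ n _ _ cfc fcM).
have q4 := approx _ _ L id (iL _ _ cg gK) (iL _ _ cfc fcM).
have q1' : `|\int[Q n]_x f (Z x) - \int[Q n]_x fc (Z x)| <= M * (4 * c).
  by apply: (le_trans q1); rewrite ler_pM2l//; lra.
have q2' : `|\int[L]_x f x - \int[L]_x fc x| <= M * c.
  by apply: (le_trans q2); rewrite ler_pM2l//; lra.
have E : M * (8 * c) + 8 * c = e.
  by rewrite /c; field; rewrite gt_eqF// addr_gt0// mulr_gt0.
have Mc : 0 < M * c by rewrite mulr_gt0.
move: q1' q2' q3 q4 hg => /ler_normlP[a1 a2] /ler_normlP[a3 a4] /ler_normlP[a5 a6].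
move=> /ler_normlP[a7 a8] /ler_normlP[a9 a10].
have E' : M * (4 * c) = 4 * (M * c) by ring.
have E'' : M * (8 * c) = 8 * (M * c) by ring.
rewrite E' in a1 a2; rewrite E'' in E.
by apply/ler_normlP; split; lra.
Qed.

End weak_convergence.

(** * A local central limit theorem *)

Section lindeberg.
Context (d : measure_display) (T : measurableType d) (R : realType).
Variables (Q : probability T R) (Y : T -> R) (m w D M : R) (g : R -> R).
Hypothesis mY : measurable_fun setT Y.
Hypothesis w0 : 0 <= w.
Hypothesis cg : continuous g.
Hypothesis gM : forall x, `|g x| <= M.
Hypothesis one_step : forall x,
  `|\int[Q]_t g (x + Y t) - \int[centered_normal w]_z g (x + m + z)| <= D.

Let mg : measurable_fun setT g. Proof. exact: continuous_measurable_fun. Qed.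

Let cgD a : continuous (fun z => g (a + z)).
Proof.
move=> z; apply: continuous_comp; last exact: cg.
by apply: cvgD; [exact: cvg_cst|exact: cvg_id].
Qed.

(** Conditionally on the first coordinate, the induction hypothesis at the starting point x + Y t
    replaces the other k; Fubini then exposes the first one to [one_step], and the two normal laws
    merge by convolution. Both inputs must hold uniformly in x. The errors add, so one step must
    cost o(1/k). *)
Lemma lindeberg_telescope k x :
  `|\int[iid Q k]_y g (x + tsum Y y) -
    \int[centered_normal (k%:R * w)]_z g (x + k%:R * m + z)| <= k%:R * D.
Proof.
have mgf (d' : measure_display) (U : measurableType d') (f : U -> R) :
    measurable_fun setT f -> measurable_fun setT (fun u => g (f u)).
  by move=> mf; exact: measurableT_comp mg mf.
have ib (d' : measure_display) (U : measurableType d') (mu : probability U R) (f : U -> R) :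
    measurable_fun setT f -> Rintegrable mu (fun u => g (f u)).
  move=> mf; apply: (@Rintegrable_bounded _ _ _ mu _ M) => //; exact: mgf.
elim: k x => [|k IH] x.
  rewrite Rintegral_iid0 /tsum big_ord0 !mul0r centered_normal0 Rintegral_delta0.
    by rewrite !addr0 subrr normr0.
  by apply: mgf; apply: measurable_funD.
have mts : measurable_fun setT (@tsum _ T R k Y) by exact: measurable_tsum.
have mF : measurable_fun setT (fun p : T * k.-tuple T => x + (Y p.1 + tsum Y p.2)).
  apply: measurable_funD => //; apply: measurable_funD.
    exact: measurableT_comp mY measurable_fst.
  exact: measurableT_comp mts measurable_snd.
have E1 : \int[iid Q k.+1]_y g (x + tsum Y y) =
    \int[Q]_t \int[iid Q k]_y g (x + Y t + tsum Y y).
  rewrite Rintegral_iidS; last 2 first.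
  - apply: mgf; apply: measurable_funD => //; exact: measurable_tsum.
  - apply: eq_integrable (ib _ _ (prodP Q (iid Q k)) _ mF) => // p _ /=.
    by rewrite tsumS.
  have := @Rintegral_fubini12 _ _ _ _ _ Q (iid Q k) _ M (mgf _ _ _ mF) (fun p => gM _).
  under eq_Rintegral do rewrite -tsumS.
  move=> ->; apply: Rintegral_ext => t; apply: Rintegral_ext => y /=.
  by rewrite addrA.
pose N := centered_normal (k%:R * w).
have mF2 : measurable_fun setT (fun p : T * R => x + Y p.1 + k%:R * m + p.2).
  apply: measurable_funD => //; apply: measurable_funD => //.
  apply: measurable_funD => //; exact: measurableT_comp mY measurable_fst.
have E2 : \int[Q]_t \int[N]_z g (x + Y t + k%:R * m + z) =
    \int[N]_z \int[Q]_t g (x + Y t + k%:R * m + z) :=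
  @Rintegral_fubini _ _ T (measurableTypeR R) _ Q N _ M (mgf _ _ _ mF2) (fun p => gM _).
have mF3 : measurable_fun setT (fun p : R * R => x + k%:R * m + p.1 + m + p.2).
  by apply: measurable_funD => //; apply: measurable_funD => //; apply: measurable_funD.
have kw : 0 <= k%:R * w by rewrite mulr_ge0.
have E3 : \int[N]_z \int[centered_normal w]_z' g (x + k%:R * m + z + m + z') =
    \int[centered_normal (k.+1%:R * w)]_z g (x + k.+1%:R * m + z).
  have -> : k.+1%:R * w = k%:R * w + w by rewrite (natrD _ 1 k); ring.
  have E := @centered_normal_convolution R _ _ _ M kw w0 (@cgD (x + k.+1%:R * m)) (fun z => gM _).
  apply: etrans E; apply: Rintegral_ext => z; apply: Rintegral_ext => z'; congr g.
  by rewrite (natrD _ 1 k); ring.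
have iQ : Rintegrable Q (fun t => \int[iid Q k]_y g (x + Y t + tsum Y y)).
  have i := @Rintegrable_section2 _ _ _ _ _ Q (iid Q k) _ M (mgf _ _ _ mF) (fun p => gM _).
  apply: (eq_Rintegrable _ i) => t; apply: Rintegral_ext => y /=.
  by rewrite addrA.
have iQ2 : Rintegrable Q (fun t => \int[N]_z g (x + Y t + k%:R * m + z)) :=
  @Rintegrable_section2 _ _ T (measurableTypeR R) _ Q N _ M (mgf _ _ _ mF2) (fun p => gM _).
have iN1 : Rintegrable N (fun z => \int[Q]_t g (x + Y t + k%:R * m + z)) :=
  @Rintegrable_section1 _ _ T (measurableTypeR R) _ Q N _ M (mgf _ _ _ mF2) (fun p => gM _).
have iN2 : Rintegrable N (fun z => \int[centered_normal w]_z' g (x + k%:R * m + z + m + z')) :=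
  @Rintegrable_section2 _ _ (measurableTypeR R) (measurableTypeR R) _
    N (centered_normal w) _ M (mgf _ _ _ mF3) (fun p => gM _).
have S1 : `|\int[Q]_t \int[iid Q k]_y g (x + Y t + tsum Y y) -
   \int[Q]_t \int[N]_z g (x + Y t + k%:R * m + z)| <= k%:R * D.
  rewrite -(RintegralB measurableT iQ iQ2) -[leRHS](Rintegral_prob_cst Q).
  apply: Rintegral_norm_le => [||t]; first exact: (RintegrableB iQ iQ2).
    exact: finite_measure_integrable_cst.
  exact: IH.
have S2 : `|\int[N]_z \int[Q]_t g (x + Y t + k%:R * m + z) -
   \int[N]_z \int[centered_normal w]_z' g (x + k%:R * m + z + m + z')| <= D.
  rewrite -(RintegralB measurableT iN1 iN2) -[leRHS](Rintegral_prob_cst N).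
  apply: Rintegral_norm_le => [||z]; first exact: (RintegrableB iN1 iN2).
    exact: finite_measure_integrable_cst.
  apply: le_trans (one_step (x + k%:R * m + z)).
  rewrite le_eqVlt; apply/orP; left; apply/eqP; congr (`|_ - _|).
  by apply: Rintegral_ext => t; congr g; ring.
have glue (a b c e r r' : R) : `|a - b| <= r -> `|c - e| <= r' -> b = c ->
    `|a - e| <= r + r'.
  move=> h1 h2 bc; have -> : a - e = (a - b) + (c - e) by rewrite bc; ring.
  exact: le_trans (ler_normD _ _) (lerD h1 h2).
have -> : k.+1%:R * D = k%:R * D + D by rewrite (natrD _ 1 k); ring.
by rewrite E1 -E3; exact: glue S1 S2 E2.
Qed.

End lindeberg.

Section gaussian_step.
Context (R : realType).
Variables (K : R) (g g1 g2 : R -> R).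
Hypothesis sg : smooth_test K g g1 g2.

Let cg : continuous g. Proof. exact: sg.1. Qed.
Let mg : measurable_fun setT g. Proof. exact: continuous_measurable_fun. Qed.
Let gK x : `|g x| <= K. Proof. by have [[]] := sg.2 x. Qed.
Let K0 : 0 <= K. Proof. exact: le_trans (normr_ge0 _) (gK 0). Qed.

(** Second-order Taylor expansion at x + m, where the mean of the normal vanishes, followed by a
    return to x through the Lipschitz bound of g2 and a first-order expansion of g. With m and w of
    order 1/n every error is o(1/n). *)
Lemma gaussian_step (x m w : R) : 0 <= w ->
  `|\int[centered_normal w]_z g (x + m + z) - g x - (g1 x * m + 2^-1 * g2 x * w)| <=
  K * (65 * (w * Num.sqrt w) + `|m| * w + `|m| ^+ 2).
Proof.
move=> w0; set N := centered_normal w; set x' := x + m.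
have [i3 b3] := centered_normal_abs3 w0; rewrite -/N in i3 b3.
have sid := sq_integrable_centered_normal w0; rewrite -/N in sid.
have i1 : Rintegrable N id := sq_integrable_integrable sid.
have i2 : Rintegrable N (fun z => z ^+ 2) := sid.2.
have ic (a : R) : Rintegrable N (fun=> a) by exact: finite_measure_integrable_cst.
have ig : Rintegrable N (fun z => g (x' + z)).
  apply: (@Rintegrable_bounded _ (measurableTypeR R) _ N _ K) => //.
  by apply: measurableT_comp => //; exact: measurable_funD.
have e1 : \int[N]_z z = 0 := Rintegral_centered_normal_id w0.
have e2 : \int[N]_z (z ^+ 2) = w := Rintegral_centered_normal_sqr w0.
have j1 := RintegrableB ig (ic (g x')).
have j2 := RintegrableB j1 (RintegrableZ (g1 x') i1).
have j3 := RintegrableB j2 (RintegrableZ (2^-1 * g2 x') i2).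
have A1 : `|\int[N]_z g (x' + z) - g x' - 2^-1 * g2 x' * w| <= K * (65 * (w * Num.sqrt w)).
  have -> : \int[N]_z g (x' + z) - g x' - 2^-1 * g2 x' * w =
     \int[N]_z (g (x' + z) - g x' - g1 x' * z - 2^-1 * g2 x' * z ^+ 2).
    rewrite (RintegralB measurableT j2 (RintegrableZ (2^-1 * g2 x') i2)).
    rewrite (RintegralB measurableT j1 (RintegrableZ (g1 x') i1)).
    rewrite (RintegralB measurableT ig (ic (g x'))).
    rewrite (RintegralZl _ measurableT i1) (RintegralZl _ measurableT i2).
    by rewrite Rintegral_prob_cst e1 e2 mulr0 subr0.
  apply: (@le_trans _ _ (K * \int[N]_z (`|z| ^+ 3))); last by rewrite ler_wpM2l.
  rewrite -(RintegralZl _ measurableT i3).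
  apply: Rintegral_norm_le => // [|z]; first exact: RintegrableZ.
  by have [_ /(_ z)[]] := sg.2 x'.
have [_ /(_ m)[_ l2 t1 _]] := sg.2 x.
have -> : \int[N]_z g (x' + z) - g x - (g1 x * m + 2^-1 * g2 x * w) =
  (\int[N]_z g (x' + z) - g x' - 2^-1 * g2 x' * w) +
  (2^-1 * (g2 x' - g2 x) * w + (g x' - g x - g1 x * m)) by ring.
have -> : K * (65 * (w * Num.sqrt w) + `|m| * w + `|m| ^+ 2) =
  K * (65 * (w * Num.sqrt w)) + (K * (`|m| * w) + K * `|m| ^+ 2) by ring.
apply: le_trans (ler_normD _ _) _; apply: lerD => //.
apply: le_trans (ler_normD _ _) _; apply: lerD => //.
rewrite !normrM (ger0_norm w0) mulrA ler_wpM2r//.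
rewrite (ger0_norm (_ : 0 <= 2^-1)) ?invr_ge0//.
have := normr_ge0 (g2 x' - g2 x); rewrite /x'; lra.
Qed.

End gaussian_step.

Section local_step.
Context (d : measure_display) (T : measurableType d) (R : realType).
Variables (P Q nu : probability T R) (u v psi : T -> R).
Variables (K s : R) (g g1 g2 : R -> R).
Hypothesis sg : smooth_test K g g1 g2.
Hypothesis Qu : is_root_density Q nu u.
Hypothesis Pv : is_root_density P nu v.
Hypothesis spsi : sq_integrable P psi.
Hypothesis psi_mean0 : \int[P]_t psi t = 0.
Hypothesis s0 : 0 <= s.

(** Lindeberg's weight, in place of a third moment: psi is only square integrable, but the mean of w
    psi^2 still tends to 0 with s. *)
Definition truncation (t : T) : R := Num.min 1 (s * `|psi t|).
Let w := truncation.
Let omega := \int[P]_t (w t * psi t ^+ 2).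
Let H := \int[nu]_t ((u t - v t) ^+ 2).
Let beta := \int[nu]_t ((u t - v t) * (psi t * v t)).
Let Hw := \int[nu]_t (w t * (u t - v t) ^+ 2).

Let cg : continuous g. Proof. exact: sg.1. Qed.
Let mg : measurable_fun setT g. Proof. exact: continuous_measurable_fun. Qed.
Let gK x : `|g x| <= K. Proof. by have [[]] := sg.2 x. Qed.
Let g1K x : `|g1 x| <= K. Proof. by have [[]] := sg.2 x. Qed.
Let g2K x : `|g2 x| <= K. Proof. by have [[]] := sg.2 x. Qed.
Let K0 : 0 <= K. Proof. exact: le_trans (normr_ge0 _) (gK 0). Qed.
Let mpsi : measurable_fun setT psi. Proof. by case: spsi. Qed.
Let mv : measurable_fun setT v. Proof. by case: Pv. Qed.
Let densu : is_density Q nu (fun t => u t ^+ 2). Proof. by case: Qu. Qed.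
Let densv : is_density P nu (fun t => v t ^+ 2). Proof. by case: Pv. Qed.
Let su : sq_integrable nu u. Proof. exact: sq_integrable_root Qu. Qed.
Let sv : sq_integrable nu v. Proof. exact: sq_integrable_root Pv. Qed.
Let sd : sq_integrable nu (fun t => u t - v t). Proof. exact: sq_integrableB. Qed.
Let spv : sq_integrable nu (fun t => psi t * v t).
Proof. exact: (sq_integrable_mul_root Pv spsi). Qed.

Lemma measurable_truncation : measurable_fun setT w.
Proof.
apply: measurable_minr => //; apply: measurable_funM => //.
exact: measurableT_comp (@normr_measurable R setT) mpsi.
Qed.

Lemma truncation01 t : 0 <= w t <= 1.
Proof. by rewrite /w /truncation le_min ler01 mulr_ge0//= ge_min lexx. Qed.

Let w0 t : 0 <= w t. Proof. by case/andP: (truncation01 t). Qed.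
Let w1 t : w t <= 1. Proof. by case/andP: (truncation01 t). Qed.

Let Rintegrable_bM (m : probability T R) (b f : T -> R) (B : R) :
  measurable_fun setT b -> (forall t, `|b t| <= B) -> Rintegrable m f ->
  Rintegrable m (fun t => b t * f t).
Proof.
move=> mb bB fi; apply: Rintegrable_le (RintegrableZ B (Rintegrable_norm fi)).
  by apply: measurable_funM => //; exact: Rintegrable_measurable fi.
by move=> t; rewrite normrM ler_wpM2r.
Qed.

Let iw (m : probability T R) (f : T -> R) : Rintegrable m f ->
  Rintegrable m (fun t => w t * f t).
Proof.
apply: (@Rintegrable_bM _ _ _ 1); first exact: measurable_truncation.
by move=> t; rewrite ger0_norm.
Qed.

Variable x : R.
Let y t := s * psi t.
Let G t := g (x + y t) - g x.

Let my : measurable_fun setT y. Proof. exact: measurable_funM. Qed.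
Let mG : measurable_fun setT G.
Proof.
apply: measurable_funB => //; apply: measurableT_comp => //.
exact: measurable_funD.
Qed.
Let normy t : `|y t| = s * `|psi t|. Proof. by rewrite normrM (ger0_norm s0). Qed.

(* The remainders of [g] are bounded crudely in the first case, by Taylor's
   formula in the second. *)
Let wcases t : (w t = 1 /\ 1 <= `|y t|) \/ (w t = `|y t| /\ `|y t| <= 1).
Proof.
rewrite /w /truncation -normy; case: (leP 1 `|y t|) => h; [left|right]; split => //.
exact: ltW.
Qed.

Let Gw t : `|G t| <= 2 * K * w t.
Proof.
have [_ /(_ (y t))[h1 _ _ _]] := sg.2 x; rewrite -/(G t) in h1.
case: (wcases t) => -[-> h2]; last first.
  by apply: (le_trans h1); have := mulr_ge0 K0 (normr_ge0 (y t)); lra.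
rewrite mulr1; apply: (le_trans (ler_normB _ _)).
by have := gK (x + y t); have := gK x; lra.
Qed.

Let G1w t : `|G t - g1 x * y t| <= 2 * K * (s * `|psi t| * w t).
Proof.
have [_ /(_ (y t))[h1 _ h2 _]] := sg.2 x; rewrite -/(G t) in h1 h2.
rewrite -normy; case: (wcases t) => -[-> h3]; last first.
  apply: (le_trans h2); rewrite -expr2.
  by have := mulr_ge0 K0 (exprn_ge0 2 (normr_ge0 (y t))); lra.
rewrite mulr1; apply: (le_trans (ler_normB _ _)); rewrite normrM.
have : `|g1 x| * `|y t| <= K * `|y t| by rewrite ler_wpM2r.
lra.
Qed.

Let G2w t : `|G t - g1 x * y t - 2^-1 * g2 x * y t ^+ 2| <=
  2 * K * (s ^+ 2 * (w t * psi t ^+ 2)).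
Proof.
have [_ /(_ (y t))[_ _ h1 h2]] := sg.2 x; rewrite -/(G t) in h1 h2.
have -> : s ^+ 2 * (w t * psi t ^+ 2) = w t * `|y t| ^+ 2.
  by rewrite normy exprMn real_normK ?num_real//; ring.
have y20 : 0 <= `|y t| ^+ 2 by exact: exprn_ge0.
case: (wcases t) => -[-> h3]; last first.
  apply: (le_trans h2); rewrite -exprS -mulrA; have : 0 <= K * `|y t| ^+ 3.
    by rewrite mulr_ge0// exprn_ge0.
  lra.
rewrite mul1r; apply: (le_trans (ler_normB _ _)).
rewrite normrM normrX (normrM 2^-1) (ger0_norm (_ : 0 <= 2^-1)) ?invr_ge0//.
have : `|g2 x| * `|y t| ^+ 2 <= K * `|y t| ^+ 2 by rewrite ler_wpM2r.
have := mulr_ge0 K0 y20; lra.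
Qed.

Let iG (m : probability T R) : Rintegrable m G.
Proof.
apply: (@Rintegrable_bounded _ _ _ m _ (2 * K)) => // t.
by apply: le_trans (Gw t) _; rewrite ler_piMr// mulr_ge0.
Qed.

Let ipsi : Rintegrable P psi. Proof. exact: sq_integrable_integrable. Qed.

Let part1 : `|\int[P]_t G t - 2^-1 * g2 x * (s ^+ 2 * \int[P]_t (psi t ^+ 2))| <=
  2 * K * (s ^+ 2 * omega).
Proof.
have i2 : Rintegrable P (fun t => psi t ^+ 2) by case: spsi.
have iy : Rintegrable P y by exact: RintegrableZ.
have iy2 : Rintegrable P (fun t => y t ^+ 2).
  by apply: (eq_Rintegrable _ (RintegrableZ (s ^+ 2) i2)) => t; rewrite /y exprMn.
have j1 := RintegrableB (iG P) (RintegrableZ (g1 x) iy).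
have j2 := RintegrableB j1 (RintegrableZ (2^-1 * g2 x) iy2).
have j3 := RintegrableZ (2 * K) (RintegrableZ (s ^+ 2) (iw i2)).
have -> : \int[P]_t G t - 2^-1 * g2 x * (s ^+ 2 * \int[P]_t (psi t ^+ 2)) =
   \int[P]_t (G t - g1 x * y t - 2^-1 * g2 x * y t ^+ 2).
  rewrite (RintegralB measurableT j1 (RintegrableZ (2^-1 * g2 x) iy2)).
  rewrite (RintegralB measurableT (iG P) (RintegrableZ (g1 x) iy)).
  rewrite (RintegralZl _ measurableT iy) (RintegralZl _ measurableT iy2).
  have -> : \int[P]_t y t = 0 by rewrite (RintegralZl _ measurableT ipsi) psi_mean0 mulr0.
  have -> : \int[P]_t (y t ^+ 2) = s ^+ 2 * \int[P]_t (psi t ^+ 2).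
    rewrite -(RintegralZl _ measurableT i2); apply: Rintegral_ext => t.
    by rewrite /y exprMn.
  by rewrite mulr0 subr0.
have -> : 2 * K * (s ^+ 2 * omega) =
    \int[P]_t (2 * K * (s ^+ 2 * (w t * psi t ^+ 2))).
  rewrite (RintegralZl _ measurableT (RintegrableZ (s ^+ 2) (iw i2))).
  by rewrite (RintegralZl _ measurableT (iw i2)).
exact: Rintegral_norm_le j2 j3 G2w.
Qed.

(** Removing the linear part of G leaves a factor s |psi| w, and w^2 <= w brings out sqrt(omega)
    sqrt(H). At s = n^(-1/2) this is o(1/n), whereas the Lipschitz bound of G alone would give order
    1/n. *)
Let part2 : `|2 * \int[nu]_t ((G t - g1 x * y t) * (v t * (u t - v t)))| <=
  4 * K * (s * (Num.sqrt omega * Num.sqrt H)).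
Proof.
have i2 : Rintegrable P (fun t => psi t ^+ 2) by case: spsi.
have swp : sq_integrable P (fun t => w t * psi t).
  apply: (sq_integrable_le _ _ spsi).
    by apply: measurable_funM => //; exact: measurable_truncation.
  by move=> t; rewrite normrM (ger0_norm (w0 t)) ler_piMl.
have swpv := sq_integrable_mul_root Pv swp.
have bd t : `|(G t - g1 x * y t) * v t| <= `|2 * K * s * (w t * psi t * v t)|.
  have c0 : 0 <= 2 * K * s by rewrite !mulr_ge0.
  rewrite [leRHS]normrM (ger0_norm c0) normrM (normrM (w t * psi t)) (normrM (w t)).
  rewrite (ger0_norm (w0 t)) mulrA ler_wpM2r//; apply: (le_trans (G1w t)).
  by rewrite le_eqVlt; apply/orP; left; apply/eqP; ring.
have sG1 : sq_integrable nu (fun t => (G t - g1 x * y t) * v t).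
  apply: (sq_integrable_le _ bd (sq_integrableZ (2 * K * s) swpv)).
  by apply: measurable_funM => //; apply: measurable_funB => //; exact: measurable_funM.
have -> : \int[nu]_t ((G t - g1 x * y t) * (v t * (u t - v t))) =
    \int[nu]_t ((G t - g1 x * y t) * v t * (u t - v t)).
  by apply: Rintegral_ext => t; ring.
rewrite normrM ger0_norm//.
have -> : 4 * K * (s * (Num.sqrt omega * Num.sqrt H)) =
   2 * (2 * K * s * Num.sqrt omega * Num.sqrt H) by ring.
have omega0 : 0 <= omega by apply: Rintegral_ge0 => t _; rewrite mulr_ge0// sqr_ge0.
rewrite ler_pM2l//; apply: cauchy_schwarz_le => //.
- by rewrite !mulr_ge0.
- rewrite exprMn sqr_sqrtr//.
  have wo : \int[P]_t ((w t * psi t) ^+ 2) <= omega.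
    apply: Rintegral_le; [by case: swp|exact: iw|move=> t].
    by rewrite exprMn ler_wpM2r ?sqr_ge0// expr2 ler_piMl.
  apply: (@le_trans _ _ ((2 * K * s) ^+ 2 * \int[P]_t ((w t * psi t) ^+ 2))); last first.
    by rewrite ler_wpM2l// sqr_ge0.
  rewrite -(Rintegral_sqr_mul_root Pv); last by case: swp.
  rewrite -RintegralZl//; last by case: swpv.
  apply: Rintegral_le; [by case: sG1|by apply: RintegrableZ; case: swpv|move=> t].
  rewrite -!exprMn -[leLHS]real_normK ?num_real// -[leRHS]real_normK ?num_real//.
  by rewrite lerXn2r ?nnegrE.
- by rewrite sqr_sqrtr// Rintegral_sqr_ge0.
Qed.

Let part3 : `|\int[nu]_t (G t * (u t - v t) ^+ 2)| <= 2 * K * Hw.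
Proof.
have id2 : Rintegrable nu (fun t => (u t - v t) ^+ 2) by case: sd.
rewrite /Hw -(RintegralZl _ measurableT (iw id2)).
apply: Rintegral_norm_le.
- apply: (@Rintegrable_bM _ _ _ (2 * K)) => // t.
  by apply: le_trans (Gw t) _; rewrite ler_piMr// mulr_ge0.
- exact: RintegrableZ (iw id2).
by move=> t; rewrite normrM (ger0_norm (sqr_ge0 _)) mulrA ler_wpM2r ?sqr_ge0.
Qed.

(** Writing u^2 = v^2 + 2 v (u - v) + (u - v)^2 splits the increment of the mean of g. The first
    part is a Taylor expansion under P and yields the variance term; the linear part of G in the
    second yields 2 g1 s beta, the drift created by the change of law, to be matched with g1 m; the
    rest is error. *)
Lemma local_step (m : R) :
  `|\int[Q]_t g (x + s * psi t) - g x -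
    (g1 x * m + 2^-1 * g2 x * (s ^+ 2 * \int[P]_t (psi t ^+ 2)))| <=
  2 * K * (s ^+ 2 * omega) + 4 * K * (s * (Num.sqrt omega * Num.sqrt H)) +
  2 * K * Hw + K * `|2 * (s * beta) - m|.
Proof.
have id2 : Rintegrable nu (fun t => (u t - v t) ^+ 2) by case: sd.
have sGv : sq_integrable nu (fun t => G t * v t).
  apply: (sq_integrable_le _ _ (sq_integrableZ (2 * K) sv)).
    exact: measurable_funM.
  move=> t; have c0 : 0 <= 2 * K by rewrite mulr_ge0.
  rewrite normrM (normrM (2 * K)) (ger0_norm c0) ler_wpM2r//.
  by apply: le_trans (Gw t) _; rewrite ler_piMr.
have iGv2 := Rintegrable_density densv (iG P).
have iGd : Rintegrable nu (fun t => G t * (u t - v t) ^+ 2).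
  apply: (@Rintegrable_bM _ _ _ (2 * K)) => // t.
  by apply: le_trans (Gw t) _; rewrite ler_piMr// mulr_ge0.
have iGvd := sq_integrable_mul sGv sd.
have ib := sq_integrable_mul sd spv.
have iGvd' : Rintegrable nu (fun t => (G t - g1 x * y t) * (v t * (u t - v t))).
  apply: (eq_Rintegrable _ (RintegrableB iGvd (RintegrableZ (g1 x * s) ib))) => t.
  by rewrite /y; ring.
have igx : Rintegrable Q (fun t => g (x + s * psi t)).
  apply: (@Rintegrable_bounded _ _ _ Q _ K) => //.
  by apply: measurableT_comp => //; exact: measurable_funD.
have E1 : \int[Q]_t g (x + s * psi t) - g x = \int[Q]_t G t.
  by rewrite RintegralB// ?Rintegral_prob_cst//; exact: finite_measure_integrable_cst.
have E2 : \int[Q]_t G t = \int[P]_t G t +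
    2 * \int[nu]_t ((G t - g1 x * y t) * (v t * (u t - v t))) +
    (2 * (g1 x * (s * beta)) + \int[nu]_t (G t * (u t - v t) ^+ 2)).
  rewrite (Rintegral_density densu mG) (Rintegral_density densv mG).
  have -> : g1 x * (s * beta) = \int[nu]_t (g1 x * s * ((u t - v t) * (psi t * v t))).
    by rewrite (RintegralZl _ measurableT ib) mulrA.
  rewrite -(RintegralZl 2 measurableT iGvd').
  rewrite -(RintegralZl 2 measurableT (RintegrableZ (g1 x * s) ib)).
  have k1 := RintegrableZ 2 iGvd'.
  have k2 := RintegrableZ 2 (RintegrableZ (g1 x * s) ib).
  rewrite -(RintegralD measurableT iGv2 k1) -(RintegralD measurableT k2 iGd).
  rewrite -(RintegralD measurableT (RintegrableD iGv2 k1) (RintegrableD k2 iGd)).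
  by apply: Rintegral_ext => t; rewrite /y; ring.
rewrite E1 E2.
have -> : \int[P]_t G t + 2 * \int[nu]_t ((G t - g1 x * y t) * (v t * (u t - v t))) +
    (2 * (g1 x * (s * beta)) + \int[nu]_t (G t * (u t - v t) ^+ 2)) -
    (g1 x * m + 2^-1 * g2 x * (s ^+ 2 * \int[P]_t (psi t ^+ 2))) =
  (\int[P]_t G t - 2^-1 * g2 x * (s ^+ 2 * \int[P]_t (psi t ^+ 2))) +
  2 * \int[nu]_t ((G t - g1 x * y t) * (v t * (u t - v t))) +
  \int[nu]_t (G t * (u t - v t) ^+ 2) + g1 x * (2 * (s * beta) - m) by ring.
apply: le_trans (ler_normD _ _) _; apply: lerD; last first.
  by rewrite normrM ler_wpM2r.
apply: le_trans (ler_normD _ _) _; apply: lerD => //.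
by apply: le_trans (ler_normD _ _) _; apply: lerD.
Qed.

End local_step.

Lemma cvg_squeeze_near0 (R : realType) (a b : R^nat) (l : R) :
  (forall n, (0 < n)%N -> `|a n - l| <= b n) -> b @ \oo --> 0 -> a @ \oo --> l.
Proof.
move=> ab b0; apply/cvgrPdist_le => e e0.
move/cvgrPdist_le : b0 => /(_ e e0); apply: filter_app; exists 1%N => // n /= n0.
rewrite sub0r normrN distrC => bn; apply: (le_trans (ab n n0)).
by rewrite (le_trans _ bn)// ler_norm.
Qed.

Section local_clt.
Context (d : measure_display) (T : measurableType d) (R : realType).
Variables (P : probability T R) (Q nu : nat -> probability T R).
Variables (u v : nat -> T -> R) (h psi : T -> R).
Hypothesis Qu : forall n, is_root_density (Q n) (nu n) (u n).
Hypothesis Pv : forall n, is_root_density P (nu n) (v n).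
Hypothesis sh : sq_integrable P h.
Hypothesis DQM_error0 :
  \int[nu n]_t (DQM_error u v h n t ^+ 2) @[n --> \oo] --> 0.
Hypothesis spsi : sq_integrable P psi.
Hypothesis psi_mean0 : \int[P]_t psi t = 0.

Let c := \int[P]_t (h t * psi t).
Let sigma2 := \int[P]_t (psi t ^+ 2).
Let s n : R := (Num.sqrt n%:R)^-1.
Let s0 n : 0 <= s n. Proof. by rewrite invr_ge0. Qed.
Let w n := truncation psi (s n).
Let omega n := \int[P]_t (w n t * psi t ^+ 2).
Let H n := \int[nu n]_t ((u n t - v n t) ^+ 2).
Let beta n := \int[nu n]_t ((u n t - v n t) * (psi t * v n t)).
Let Hw n := \int[nu n]_t (w n t * (u n t - v n t) ^+ 2).

Let sigma2_ge0 : 0 <= sigma2. Proof. exact: Rintegral_sqr_ge0. Qed.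
Let mw n : measurable_fun setT (w n).
Proof. exact: (measurable_truncation (s n) spsi). Qed.
Let w01 n t : 0 <= w n t <= 1. Proof. exact: (truncation01 psi (s0 n) t). Qed.
Let s_cvg : s n @[n --> \oo] --> 0. Proof. exact: invsqrt_cvg0. Qed.

Let w_cvg : \int[P]_t w n t @[n --> \oo] --> 0.
Proof.
have ipsi : Rintegrable P (fun t => `|psi t|).
  exact: Rintegrable_norm (sq_integrable_integrable spsi).
apply: (@cvg_squeeze0 _ _ (fun n => s n * \int[P]_t `|psi t|)) => [n|]; last first.
  have : s n * \int[P]_t `|psi t| @[n --> \oo] --> 0 * \int[P]_t `|psi t|.
    by apply: cvgM => //; exact: cvg_cst.
  by rewrite mul0r.
have iw : Rintegrable P (w n).
  apply: (@Rintegrable_bounded _ _ _ P _ 1) => // t.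
  by case/andP: (w01 n t) => a b; rewrite ger0_norm.
rewrite subr0 ger0_norm; last by apply: Rintegral_ge0 => t _; case/andP: (w01 n t).
rewrite -(RintegralZl _ measurableT ipsi); apply: Rintegral_le => //.
  exact: RintegrableZ.
by move=> t; rewrite /w /truncation ge_min lexx orbT.
Qed.

Let omega_cvg : omega n @[n --> \oo] --> 0.
Proof.
apply: bounded_weight_cvg0 => //; first by case: spsi.
by move=> t; exact: sqr_ge0.
Qed.

Let Hw_cvg : n%:R * Hw n @[n --> \oo] --> 0.
Proof.
apply: (DQM_hellinger_weighted Qu Pv sh DQM_error0) => //.
apply: bounded_weight_cvg0 => //; first by case: sh.
by move=> t; exact: sqr_ge0.
Qed.

(** Normal summands of mean c / n and variance sigma2 / n replace the coordinates. Multiplied by n,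
    the errors of one step become omega, sqrt(omega) sqrt(n H), n Hw and |2 sqrt n beta - c|, plus
    Gaussian terms of order n^(-1/2); all vanish, n H staying bounded. *)
Lemma local_clt K g g1 g2 : smooth_test K g g1 g2 ->
  \int[iid (Q n) n]_x g ((Num.sqrt n%:R)^-1 * tsum psi x) @[n --> \oo] -->
  \int[centered_normal sigma2]_z g (c + z).
Proof.
move=> sg; have cg := sg.1.
have gK x : `|g x| <= K by have [[]] := sg.2 x.
pose m n := s n ^+ 2 * c; pose W n := s n ^+ 2 * sigma2.
pose D1 n := 2 * K * (s n ^+ 2 * omega n) +
  4 * K * (s n * (Num.sqrt (omega n) * Num.sqrt (H n))) +
  2 * K * Hw n + K * `|2 * (s n * beta n) - m n|.
pose D2 n := K * (65 * (W n * Num.sqrt (W n)) + `|m n| * W n + `|m n| ^+ 2).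
have W0 n : 0 <= W n by rewrite mulr_ge0// sqr_ge0.
have one_step n x : `|\int[Q n]_t g (x + s n * psi t) -
    \int[centered_normal (W n)]_z g (x + m n + z)| <= D1 n + D2 n.
  have h1 := local_step sg (Qu n) (Pv n) spsi psi_mean0 (s0 n) x (m n).
  have h2 := gaussian_step sg x (m n) (W0 n).
  rewrite -/sigma2 -/(W n) in h1.
  set a := \int[Q n]_t _ in h1 *; set b := \int[centered_normal _]_z _ in h2 *.
  have -> : a - b = (a - g x - (g1 x * m n + 2^-1 * g2 x * W n)) -
     (b - g x - (g1 x * m n + 2^-1 * g2 x * W n)) by ring.
  by apply: le_trans (ler_normB _ _) _; exact: lerD h1 h2.
have ns n : (0 < n)%N -> n%:R * s n ^+ 2 = 1.
  by move=> n0; rewrite /s exprVn sqr_sqrtr// divff// pnatr_eq0 -lt0n.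
have ns1 n : (0 < n)%N -> n%:R * s n = Num.sqrt n%:R.
  move=> n0; rewrite /s -{1}(sqr_sqrtr (ler0n R n)) expr2 mulfK//.
  by rewrite gt_eqF// sqrtr_gt0 ltr0n.
pose B n := 2 * K * omega n + 4 * K * (Num.sqrt (omega n) * Num.sqrt (n%:R * H n)) +
  2 * K * (n%:R * Hw n) + K * `|2 * (Num.sqrt n%:R * beta n) - c| +
  K * (65 * (sigma2 * (s n * Num.sqrt sigma2)) + s n ^+ 2 * (`|c| * sigma2 + `|c| ^+ 2)).
have my n : measurable_fun setT (fun t => s n * psi t).
  by apply: measurable_funM => //; case: spsi.
apply: (@cvg_squeeze_near0 _ _ B) => [n n0|].
  have := @lindeberg_telescope _ _ _ (Q n) (fun t => s n * psi t) (m n) (W n)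
    (D1 n + D2 n) K g (my n) (W0 n) cg gK (one_step n) n 0.
  have -> : n%:R * W n = sigma2 by rewrite /W mulrA ns// mul1r.
  have -> : n%:R * m n = c by rewrite /m mulrA ns// mul1r.
  have -> : \int[iid (Q n) n]_y g (0 + tsum (fun t => s n * psi t) y) =
     \int[iid (Q n) n]_x g ((Num.sqrt n%:R)^-1 * tsum psi x).
    by apply: Rintegral_ext => y; rewrite add0r /tsum mulr_sumr.
  rewrite add0r => /le_trans; apply.
  rewrite le_eqVlt; apply/orP; left; apply/eqP; rewrite mulrDr /B; congr (_ + _).
    rewrite /D1 !mulrDr; congr (_ + _ + _ + _).
    - by rewrite mulrCA (mulrA n%:R) ns// mul1r.
    - rewrite mulrCA (mulrA n%:R) ns1//.
      rewrite (sqrtrM (H n) (ler0n R n)); ring.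
    - by rewrite mulrCA.
    - rewrite mulrCA; congr (_ * _).
      rewrite -[X in X * _](ger0_norm (ler0n R n)) -normrM; congr (`|_|).
      have -> : n%:R * (2 * (s n * beta n) - m n) =
        2 * (n%:R * s n * beta n) - n%:R * s n ^+ 2 * c by rewrite /m; ring.
      by rewrite ns// mul1r ns1.
  rewrite /D2 mulrCA; congr (_ * _).
  have sW : Num.sqrt (W n) = s n * Num.sqrt sigma2.
    by rewrite /W sqrtrM ?sqr_ge0// sqrtr_sqr ger0_norm.
  rewrite sW; have nm : `|m n| = s n ^+ 2 * `|c| by rewrite normrM ger0_norm ?sqr_ge0.
  rewrite nm /W.
  have -> : n%:R * (65 * (s n ^+ 2 * sigma2 * (s n * Num.sqrt sigma2)) +
      s n ^+ 2 * `|c| * (s n ^+ 2 * sigma2) + (s n ^+ 2 * `|c|) ^+ 2) =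
    (n%:R * s n ^+ 2) * (65 * (sigma2 * (s n * Num.sqrt sigma2)) +
      s n ^+ 2 * (`|c| * sigma2 + `|c| ^+ 2)) by ring.
  by rewrite ns// mul1r.
have c1 : n%:R * H n @[n --> \oo] --> 4^-1 * \int[P]_t (h t ^+ 2).
  exact: (DQM_hellinger Qu Pv sh DQM_error0).
have c2 : Num.sqrt n%:R * beta n @[n --> \oo] --> 2^-1 * c.
  exact: (DQM_cross Qu Pv sh DQM_error0 spsi).
have k (a : R) : (fun _ : nat => a) @ \oo --> a by exact: cvg_cst.
have c3 : 4 * K * (Num.sqrt (omega n) * Num.sqrt (n%:R * H n)) @[n --> \oo] -->
    4 * K * (0 * Num.sqrt (4^-1 * \int[P]_t (h t ^+ 2))).
  apply: cvgM => //; apply: cvgM; first exact: cvg_sqrt0.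
  by apply: (cvg_comp _ _ c1); exact: sqrt_continuous.
have c4 : K * `|2 * (Num.sqrt n%:R * beta n) - c| @[n --> \oo] --> K * `|2 * (2^-1 * c) - c|.
  apply: cvgM => //; apply: cvg_norm; apply: cvgB => //.
  by apply: cvgM.
have c5 : K * (65 * (sigma2 * (s n * Num.sqrt sigma2)) + s n ^+ 2 * (`|c| * sigma2 + `|c| ^+ 2))
    @[n --> \oo] --> K * (65 * (sigma2 * (0 * Num.sqrt sigma2)) +
      0 * 0 * (`|c| * sigma2 + `|c| ^+ 2)).
  apply: cvgM => //; apply: cvgD.
    by apply: cvgM => //; apply: cvgM => //; apply: cvgM.
  by apply: cvgM => //; apply: cvgM.
have c6 : B n @[n --> \oo] --> 2 * K * 0 +
    4 * K * (0 * Num.sqrt (4^-1 * \int[P]_t (h t ^+ 2))) + 2 * K * 0 +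
    K * `|2 * (2^-1 * c) - c| +
    K * (65 * (sigma2 * (0 * Num.sqrt sigma2)) + 0 * 0 * (`|c| * sigma2 + `|c| ^+ 2)).
  apply: cvgD => //; apply: cvgD => //; apply: cvgD; last by apply: cvgM.
  by apply: cvgD => //; apply: cvgM.
have e0 : 2 * (2^-1 * c) - c = 0 by field.
by move: c6; rewrite e0 normr0 !(mulr0, mul0r, addr0).
Qed.

End local_clt.

(** * Local sequences of laws *)

(** What is retained of a path: its laws at n^(-1/2), with some dominating probabilities and roots.
    The score is a plain function, so that it can be rescaled pointwise. *)
Definition DQM_sequence (d : measure_display) (T : measurableType d) (R : realType)
    (P : probability T R) (h : T -> R) (Q : nat -> probability T R) : Prop :=
  exists nu u v,
    [/\ forall n, is_root_density (Q n) (nu n) (u n),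
        forall n, is_root_density P (nu n) (v n) &
        \int[nu n]_t (DQM_error u v h n t ^+ 2) @[n --> \oo] --> 0].

Section DQM_paths.
Context (d : measure_display) (T : measurableType d) (R : realType).
Variables (calP : set (probability T R)) (P : probability T R).

Lemma DQM_path_sequence (h : L2 P) Pt : DQM_path calP h Pt ->
  DQM_sequence P h (fun n => Pt (Num.sqrt n%:R)^-1).
Proof.
move=> [_ _ _ rem0]; pose Q n := Pt (Num.sqrt n%:R)^-1.
exists (fun n => half_dominating (Q n) P),
  (fun n x => Num.sqrt 2 * root_density (Q n) P (Q n) x),
  (fun n x => Num.sqrt 2 * root_density (Q n) P P x).
split=> [n|n|]; first exact: is_root_density_scaled (@dominated_left _ _ _ P (Q n)).
  exact: is_root_density_scaled (@dominated_right _ _ _ P (Q n)).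
have c : (fun n => fine (DQM_remainder h Pt (Num.sqrt n%:R)^-1)) @ \oo --> 0.
  exact: (fine_cvg (cvg_comp _ _ (@invsqrt_cvg_right R) rem0)).
apply: cvg_trans c; apply: near_eq_cvg; apply: nearW => n.
rewrite /= DQM_remainderE; congr fine; apply: eq_integral => x _.
by congr EFin; rewrite /DQM_error invrK; congr (_ ^+ 2); ring.
Qed.

(** Turns regularity in the direction 0 into a statement about P itself. *)
Lemma DQM_path_constant : calP P -> DQM_path calP (0 : L2 P) (fun=> P).
Proof.
move=> cP; split => //.
- by rewrite /L20 /=; under eq_Rintegral do rewrite /=; rewrite Rintegral_prob_cst.
- by exists 1; [exact: ltr01|move=> t _].
- rewrite (_ : DQM_remainder _ _ = cst 0%E); first exact: cvg_cst.
  apply/funext => t; rewrite /DQM_remainder /=; apply: integral0_eq => x _.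
  by rewrite subrr mul0r mulr0 mul0r subrr expr0n.
Qed.

End DQM_paths.

(** * Convergence in probability and linear statistics *)

Section convergence_in_probability.
Context (d : measure_display) (T : measurableType d) (R : realType).
Variables (Q : forall n, probability (n.-tuple T) R).
Variables (Z : forall n, n.-tuple T -> R).
Hypothesis mZ : forall n, measurable_fun setT (@Z n).

Lemma measurable_min1_norm n : measurable_fun setT (fun x => Num.min 1 `|@Z n x|).
Proof.
have m := measurableT_comp (@normr_measurable R setT) (@mZ n).
by apply: measurable_minr.
Qed.

Lemma min1_norm01 (z : R) : 0 <= Num.min 1 `|z| <= 1.
Proof. by rewrite le_min ler01 normr_ge0 ge_min lexx. Qed.

Lemma Rintegrable_min1_norm n (m : probability (n.-tuple T) R) :
  Rintegrable m (fun x => Num.min 1 `|@Z n x|).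
Proof.
apply: (@Rintegrable_bounded _ _ _ m _ 1); first exact: measurable_min1_norm.
by move=> x; have /andP[a b] := min1_norm01 (@Z n x); rewrite ger0_norm.
Qed.

(** The mean of min(1, |Z|) metrises this convergence. Its integrand has values in [0, 1], as
    [DQM_contiguity] demands, and is subadditive in Z. *)
Lemma cvg_in_prob0P :
  cvg_in_prob0 Q Z <-> \int[Q n]_x Num.min 1 `|Z x| @[n --> \oo] --> 0.
Proof.
pose A (e : R) n := [set x | e < `|@Z n x|].
have mA e n : measurable (A e n).
  rewrite -[A e n]setTI; apply: measurable_fun_ltr => //.
  exact: measurableT_comp (@normr_measurable R setT) (@mZ n).
split=> [H|H e e0].
  apply/cvgrPdist_le => /= e e0; have e20 : 0 < e / 2 by rewrite divr_gt0.
  have : (fun n => fine (Q n (A (e / 2) n))) @ \oo --> 0.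
    exact: (fine_cvg (H _ e20)).
  move=> /cvgrPdist_le /(_ _ e20).
  apply: filterS => n; rewrite !sub0r !normrN /= => AQ.
  rewrite ger0_norm; last first.
    by apply: Rintegral_ge0 => x _; have /andP[] := min1_norm01 (@Z n x).
  have iA := Rintegrable_indic (Q n) (mA (e / 2) n).
  have ic : Rintegrable (Q n) (fun=> e / 2) by exact: finite_measure_integrable_cst.
  have h : \int[Q n]_x Num.min 1 `|Z x| <= \int[Q n]_x (e / 2 + \1_(A (e / 2) n) x).
    apply: Rintegral_le; [exact: Rintegrable_min1_norm|exact: RintegrableD|].
    move=> x; rewrite indicE; have [xA|xA] := boolP (x \in A (e / 2) n).
      by have /andP[_] := min1_norm01 (@Z n x); rewrite /=; lra.
    have {}xA : `|Z x| <= e / 2.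
      by rewrite leNgt; apply/negP => h; move/negP : xA; apply; rewrite inE.
    by rewrite addr0 ge_min xA orbT.
  rewrite (RintegralD measurableT ic iA) Rintegral_prob_cst in h.
  have eA : fine (Q n (A (e / 2) n)) = \int[Q n]_x \1_(A (e / 2) n) x.
    by rewrite -(Rintegral_indic (Q n) (mA (e / 2) n)).
  apply: (le_trans h).
  have := ler_norm (fine (Q n (A (e / 2) n))); lra.
have me0 : 0 < Num.min 1 e / 2 by rewrite divr_gt0// lt_min ltr01.
(* Below both 1 and e, so e < |Z| implies m < min(1, |Z|) and Markov's inequality applies at level
   m. *)
set m := Num.min 1 e / 2 in me0.
have me : m < 1 /\ m < e by rewrite /m; case: (leP 1 e) => h; split; lra.
have h0 : (m^-1 * \int[Q n]_x Num.min 1 `|Z x|)%:E @[n --> \oo] --> 0%E.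
  apply: cvg_EFin; first by near=> n.
  by rewrite -(mulr0 m^-1); apply: cvgM => //; exact: cvg_cst.
apply: (squeeze_cvge _ _ h0); last exact: cvg_cst.
near=> n; rewrite measure_ge0/=.
apply: le_trans (markov_Rintegral me0 (Rintegrable_min1_norm (Q n)) _); last first.
  by move=> x; have /andP[] := min1_norm01 (@Z n x).
apply: le_measure; rewrite ?inE; first exact: mA.
  rewrite -[X in measurable X]setTI; apply: measurable_fun_ltr => //.
  exact: measurable_min1_norm.
by move=> x /= ex; rewrite lt_min me.1/= (lt_trans _ ex)// me.2.
Unshelve. all: by end_near. Qed.

End convergence_in_probability.

Section linear_statistics.
Context (d : measure_display) (T : measurableType d) (R : realType).
Variables (P : probability T R) (Q : nat -> probability T R) (h psi : T -> R).
Variables (S : forall n, n.-tuple T -> R) (b : R^nat).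
Hypothesis Qh : DQM_sequence P h Q.
Hypothesis sh : sq_integrable P h.
Hypothesis spsi : sq_integrable P psi.
Hypothesis psi_mean0 : \int[P]_t psi t = 0.
Hypothesis mS : forall n, measurable_fun setT (@S n).
Hypothesis b_cvg : b n @[n --> \oo] --> \int[P]_t (h t * psi t).
Hypothesis S_linear : cvg_in_prob0 (iid P)
  (fun n x => S x - (Num.sqrt n%:R)^-1 * tsum psi x).

Let c := \int[P]_t (h t * psi t).
Let sigma2 := \int[P]_t (psi t ^+ 2).
Let sigma2_ge0 : 0 <= sigma2. Proof. exact: Rintegral_sqr_ge0. Qed.

(** The remainder Z = S - D vanishes under the local laws by contiguity. A bounded Lipschitz test
    function turns it into an error 2K min(1, |Z|), and the centring b n in place of its limit c
    costs K |b n - c|. *)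
Lemma linear_weak_cvg :
  weak_cvg (fun n => iid (Q n) n) (fun n x => S x - b n) (centered_normal sigma2).
Proof.
have [nu [u [v [Qu Pv err0]]]] := Qh.
apply: weak_cvg_smooth => [n||K g g1 g2 sg].
- exact: (measurable_funB (@mS n) (measurable_cst (b n))).
- exact: (sq_integrable_centered_normal sigma2_ge0).2.
have cg := sg.1.
have mg : measurable_fun setT g by exact: continuous_measurable_fun.
have gK x : `|g x| <= K by have [[]] := sg.2 x.
have K0 : 0 <= K by exact: le_trans (normr_ge0 _) (gK 0).
have gL x y : `|g x - g y| <= K * `|x - y|.
  have [_ /(_ (x - y))[]] := sg.2 y.
  by have -> : y + (x - y) = x by ring.
(* The local limit of D has mean c; translating the test function centres it. *)
have sg' : smooth_test K (fun y => g (y - c)) (fun y => g1 (y - c)) (fun y => g2 (y - c)).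
  split=> [x|x].
    apply: (@continuous_comp _ _ _ (fun y => y - c) g); last exact: cg.
    by apply: cvgB => //; exact: cvg_cst.
  split=> [|y]; first exact: (sg.2 (x - c)).1.
  by have -> : x + y - c = x - c + y; [ring|exact: (sg.2 (x - c)).2].
have lim := local_clt Qu Pv sh err0 spsi psi_mean0 sg'.
rewrite -/sigma2 -/c in lim.
have e1 : \int[centered_normal sigma2]_z g (c + z - c) = \int[centered_normal sigma2]_z g z.
  by apply: Rintegral_ext => z; congr g; ring.
rewrite e1 in lim.
pose D n (x : n.-tuple T) := (Num.sqrt n%:R)^-1 * tsum psi x.
pose Z n (x : n.-tuple T) := S x - D n x.
have mD n : measurable_fun setT (D n).
  by apply: measurable_funM => //; apply: measurable_tsum; case: spsi.
have mZ n : measurable_fun setT (Z n) by exact: (measurable_funB (@mS n) (mD n)).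
have Z0 : \int[iid (Q n) n]_x Num.min 1 `|Z n x| @[n --> \oo] --> 0.
  apply: (DQM_contiguity Qu Pv sh err0 (F := fun n x => Num.min 1 `|Z n x|)).
  - by move=> n; exact: (measurable_min1_norm mZ).
  - by move=> n x; exact: min1_norm01.
  - exact: (cvg_in_prob0P _ mZ).1.
pose B n := 2 * K * \int[iid (Q n) n]_x Num.min 1 `|Z n x| + K * `|b n - c| +
  `|\int[iid (Q n) n]_x g (D n x - c) - \int[centered_normal sigma2]_z g z|.
apply: (@cvg_squeeze0 _ _ B) => [n|]; last first.
  have k (a : R) : (fun _ : nat => a) @ \oo --> a by exact: cvg_cst.
  have : B n @[n --> \oo] --> 2 * K * 0 + K * `|c - c| +
    `|\int[centered_normal sigma2]_z g z - \int[centered_normal sigma2]_z g z|.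
    apply: cvgD; last by apply: cvg_norm; apply: cvgB.
    apply: cvgD; first exact: cvgM.
    by apply: cvgM => //; apply: cvg_norm; apply: cvgB.
  by rewrite !subrr !normr0 !mulr0 !addr0.
have igc (f : n.-tuple T -> R) : measurable_fun setT f ->
    Rintegrable (iid (Q n) n) (fun x => g (f x)).
  move=> mf; apply: (@Rintegrable_bounded _ _ _ _ _ K) => //.
  exact: measurableT_comp mg mf.
have i1 : Rintegrable (iid (Q n) n) (fun x => g (S x - b n)).
  by apply: igc; exact: (measurable_funB (@mS n) (measurable_cst (b n))).
have i2 : Rintegrable (iid (Q n) n) (fun x => g (D n x - c)).
  by apply: igc; exact: (measurable_funB (mD n) (measurable_cst c)).
have i3 := RintegrableZ (2 * K) (Rintegrable_min1_norm mZ (iid (Q n) n)).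
have ic : Rintegrable (iid (Q n) n) (fun=> K * `|b n - c|).
  exact: finite_measure_integrable_cst.
have main : `|\int[iid (Q n) n]_x g (S x - b n) - \int[iid (Q n) n]_x g (D n x - c)| <=
   2 * K * \int[iid (Q n) n]_x Num.min 1 `|Z n x| + K * `|b n - c|.
  rewrite -(RintegralB measurableT i1 i2).
  rewrite -(RintegralZl _ measurableT (Rintegrable_min1_norm mZ (iid (Q n) n))).
  rewrite -[X in _ <= _ + X](Rintegral_prob_cst (iid (Q n) n)).
  rewrite -(RintegralD measurableT i3 ic).
  apply: (Rintegral_norm_le (RintegrableB i1 i2) (RintegrableD i3 ic)) => x.
  have h1 := gL (S x - b n) (S x - c); have h2 := gL (S x - c) (D n x - c).
  have e2 : S x - b n - (S x - c) = - (b n - c) by ring.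
  have e3 : S x - c - (D n x - c) = Z n x by rewrite /Z; ring.
  rewrite e2 normrN in h1; rewrite e3 in h2.
  have h3 : `|g (S x - c) - g (D n x - c)| <= 2 * K * Num.min 1 `|Z n x|.
    case: (leP 1 `|Z n x|) => _.
      rewrite mulr1; apply: (le_trans (ler_normB _ _)).
      by have := gK (S x - c); have := gK (D n x - c); lra.
    by apply: (le_trans h2); have := mulr_ge0 K0 (normr_ge0 (Z n x)); lra.
  have -> : g (S x - b n) - g (D n x - c) =
    (g (S x - c) - g (D n x - c)) + (g (S x - b n) - g (S x - c)) by ring.
  by apply: le_trans (ler_normD _ _) _; exact: lerD.
rewrite /B.
set a1 := \int[iid (Q n) n]_x g (S x - b n) in main *.
set a2 := \int[iid (Q n) n]_x g (D n x - c) in main *.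
set a3 := \int[centered_normal sigma2]_z g z.
have -> : a1 - a3 = (a1 - a2) + (a2 - a3) by ring.
by apply: le_trans (ler_normD _ _) _; exact: lerD.
Qed.

End linear_statistics.

(** * From regularity to linearity *)

Section clipping.
Variable R : realType.
Implicit Types (M N y z c : R).

Definition clip M y := Num.max (- M) (Num.min M y).

Variant clip_spec M y : R -> Prop :=
| ClipId of - M <= y & y <= M : clip_spec M y y
| ClipHigh of M < y : clip_spec M y M
| ClipLow of y < - M : clip_spec M y (- M).

Lemma clipP M y : 0 <= M -> clip_spec M y (clip M y).
Proof.
move=> M0; rewrite /clip; case: (leP M y) => My.
  rewrite (max_idPr _); last by lra.
  have [->|] := eqVneq y M; first by constructor; lra.
  by move=> yM; apply: ClipHigh; rewrite lt_neqAle eq_sym yM.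
by case: (leP (- M) y) => My'; constructor => //; exact: ltW.
Qed.

Lemma continuous_clip M : continuous (clip M).
Proof.
move=> y.
apply: (@continuous_max _ _ (cst (- M)) (fun y => Num.min M y)); first exact: cvg_cst.
by apply: (@continuous_min _ _ (cst M) id); [exact: cvg_cst|exact: cvg_id].
Qed.

Lemma clip_norm_le M y : 0 <= M -> `|clip M y| <= M.
Proof. by move=> M0; apply/ler_normlP; case: (clipP y M0) => *; split; lra. Qed.

Lemma clip_lipschitz M y z : 0 <= M -> `|clip M y - clip M z| <= `|y - z|.
Proof.
move=> M0; case: (ler0P (y - z)) => yz; apply/ler_normlP.
  by case: (clipP y M0) => *; case: (clipP z M0) => *; split; lra.
by case: (clipP y M0) => *; case: (clipP z M0) => *; split; lra.
Qed.

Lemma clip_sqr_le M y : 0 <= M -> clip M y ^+ 2 <= y ^+ 2.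
Proof. by move=> M0; case: (clipP y M0) => *; nra. Qed.

Lemma sqr_tail N y : 0 < N -> N <= `|y| -> 1 <= (N ^+ 2)^-1 * y ^+ 2.
Proof.
move=> N0 Ny; rewrite mulrC ler_pdivlMr ?exprn_gt0// mul1r.
by rewrite -(real_normK (num_real y)) lerXn2r// nnegrE ltW.
Qed.

(** For |z| <= N both z and z + c lie within the level N + 1 and the shift is exact. Otherwise the
    increment of [clip] lies between 0 and c, so the defect is at most |c|, and z^2 / N^2 >= 1
    there. *)
Lemma clip_shift N c z : 0 < N -> `|c| <= 1 ->
  `|clip (N + 1) (z + c) - clip (N + 1) z - c| <= `|c| * ((N ^+ 2)^-1 * z ^+ 2).
Proof.
move=> N0 c1; have M0 : 0 <= N + 1 by lra.
have [zN|Nz] := leP `|z| N.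
  have r0 : 0 <= `|c| * ((N ^+ 2)^-1 * z ^+ 2).
    by rewrite mulr_ge0// mulr_ge0 ?invr_ge0 ?sqr_ge0// exprn_ge0// ltW.
  suff -> : clip (N + 1) (z + c) - clip (N + 1) z - c = 0 by rewrite normr0.
  move/ler_normlP : zN => [z1 z2]; move/ler_normlP : c1 => [h1 h2].
  by case: (clipP (z + c) M0) => *; case: (clipP z M0) => *; lra.
have := sqr_tail N0 (ltW Nz); set w := _ * z ^+ 2 => w1.
apply: (@le_trans _ _ `|c|); last by rewrite ler_peMr.
case: (ler0P c) => h; apply/ler_normlP.
  by case: (clipP (z + c) M0) => *; case: (clipP z M0) => *; split; lra.
by case: (clipP (z + c) M0) => *; case: (clipP z M0) => *; split; lra.
Qed.

Lemma clip_tail N y : 0 < N ->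
  Num.min 1 `|y - clip (N + 1) y| <= (N ^+ 2)^-1 * y ^+ 2.
Proof.
move=> N0; have [yN|Ny] := leP `|y| N.
  have -> : y - clip (N + 1) y = 0.
    move/ler_normlP : yN => [z1 z2].
    by case: (@clipP (N + 1) y) => *; lra.
  rewrite normr0 (_ : Num.min 1 0 = 0); last by apply/min_idPr.
  by rewrite mulr_ge0 ?invr_ge0 ?sqr_ge0// exprn_ge0// ltW.
by apply: le_trans (sqr_tail N0 (ltW Ny)); rewrite ge_min lexx.
Qed.

End clipping.

Section linearity_from_regularity.
Context (d : measure_display) (T : measurableType d) (R : realType).
Variables (P : probability T R) (V : set (T -> R)) (psi : T -> R).
Variable S : forall n, n.-tuple T -> R.
Let sigma2 := \int[P]_t (psi t ^+ 2).
Let G := centered_normal sigma2.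
Hypothesis mS : forall n, measurable_fun setT (@S n).
Hypothesis spsi : sq_integrable P psi.
Hypothesis psi_mean0 : \int[P]_t psi t = 0.
Hypothesis V_sq : forall h, V h -> sq_integrable P h /\ \int[P]_t h t = 0.
Hypothesis psi_adherent : forall e, 0 < e ->
  exists2 h, V h & \int[P]_t ((psi t - h t) ^+ 2) <= e ^+ 2.
Hypothesis S_limit : weak_cvg (iid P) (@S) G.
Hypothesis S_local_limit : forall h a, V h -> 0 < a -> exists Q b,
  [/\ DQM_sequence P (fun t => a * h t) Q,
      b n @[n --> \oo] --> a * \int[P]_t (psi t * h t) &
      weak_cvg (fun n => iid (Q n) n) (fun n x => S x - b n) G].

Let sigma2_ge0 : 0 <= sigma2. Proof. exact: Rintegral_sqr_ge0. Qed.
Let iG2 : Rintegrable G (fun z => z ^+ 2).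
Proof. exact: (sq_integrable_centered_normal sigma2_ge0).2. Qed.
Let EG2 : \int[G]_z (z ^+ 2) = sigma2.
Proof. exact: Rintegral_centered_normal_sqr. Qed.

Let D (k : T -> R) n (x : n.-tuple T) := (Num.sqrt n%:R)^-1 * tsum k x.
Let sqD k n : sq_integrable P k -> sq_integrable (iid P n) (@D k n).
Proof. by move=> sk; exact: (sq_integrableZ _ (sq_integrable_tsum n sk)). Qed.

Let D_sqr k n : sq_integrable P k -> \int[P]_t k t = 0 -> (0 < n)%N ->
  \int[iid P n]_x (D k x ^+ 2) = \int[P]_t (k t ^+ 2).
Proof.
move=> sk k0 n0; have := sq_integrable_tsum n sk => -[_ i2].
rewrite (_ : \int[iid P n]_x (D k x ^+ 2) =
  (Num.sqrt n%:R)^-1 ^+ 2 * \int[iid P n]_x (tsum k x ^+ 2)); last first.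
  rewrite -(RintegralZl _ measurableT i2); apply: Rintegral_ext => x.
  by rewrite /D exprMn.
rewrite Rintegral_tsum_sqr// exprVn sqr_sqrtr// mulrA mulVf ?mul1r//.
by rewrite pnatr_eq0 -lt0n.
Qed.

Section truncated.
Variable N : R.
Hypothesis N0 : 0 < N.
Let M := N + 1.
Let M0 : 0 <= M. Proof. by rewrite /M; have := N0; lra. Qed.
Let tau := (N ^+ 2)^-1 * sigma2.
Let tau0 : 0 <= tau. Proof. by rewrite mulr_ge0// invr_ge0 exprn_ge0// ltW. Qed.
Let F n (x : n.-tuple T) := clip M (S x).
Let FM n (x : n.-tuple T) : `|F x| <= M. Proof. exact: clip_norm_le. Qed.
Let mclip : measurable_fun setT (clip M).
Proof. by apply: continuous_measurable_fun; exact: continuous_clip. Qed.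
Let mF n : measurable_fun setT (@F n). Proof. exact: measurableT_comp mclip (@mS n). Qed.
Let sF n (m : probability (n.-tuple T) R) : sq_integrable m (@F n).
Proof. by apply: (@sq_integrable_bounded _ _ _ m _ M); [exact: mF|exact: FM]. Qed.
Let iclip c : Rintegrable G (fun z => clip M (z + c)).
Proof.
apply: (@Rintegrable_bounded _ (measurableTypeR R) _ G _ M); last first.
  by move=> z; exact: clip_norm_le.
by apply: measurableT_comp mclip _; exact: measurable_funD.
Qed.

(** A finite-difference form of the fact that the truncated mean of a shifted normal has derivative
    close to 1; integrating z^2 / N^2 in [clip_shift] produces [tau]. *)
Let clip_normal_shift c : `|c| <= 1 ->
  `|\int[G]_z clip M (z + c) - \int[G]_z clip M z - c| <= `|c| * tau.
Proof.
move=> c1; have i1 := iclip c.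
have i0 : Rintegrable G (clip M).
  by apply: (eq_Rintegrable _ (iclip 0)) => z; rewrite addr0.
have ic : Rintegrable G (fun=> c) by exact: finite_measure_integrable_cst.
have iB := RintegrableB i1 i0.
rewrite -[X in _ - _ - X](Rintegral_prob_cst G) -(RintegralB measurableT i1 i0).
rewrite -(RintegralB measurableT iB ic) /tau -EG2.
have i2 := RintegrableZ (N ^+ 2)^-1 iG2.
rewrite -(RintegralZl _ measurableT iG2) -(RintegralZl _ measurableT i2).
apply: (Rintegral_norm_le (RintegrableB iB ic) (RintegrableZ _ i2)) => z.
exact: clip_shift.
Qed.

(** The covariance is read off a difference quotient in the direction a h. The difference of the two
    means is c = a <psi, h>, up to |c| tau from the truncation and terms of order a^2; dividing by a
    leaves |<psi, h>| tau and an error that a makes small. *)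
Let covariance_V h e : V h -> 0 < e -> \forall n \near \oo,
  `|\int[iid P n]_x (F x * D h x) - \int[P]_t (psi t * h t)| <=
  `|\int[P]_t (psi t * h t)| * tau + e.
Proof.
move=> Vh e0; have [sh h0] := V_sq Vh.
set gam := \int[P]_t (psi t * h t); set H := \int[P]_t (h t ^+ 2).
have H0 : 0 <= H by exact: Rintegral_sqr_ge0.
have Mp : 0 < M by rewrite /M; have := N0; lra.
(* The step is a = e / (X + Y). From a X <= e the expansion error M a^2 (H + 1) and the errors [eta]
   of size M a^2 / 4 stay below a e in total; from a Y <= e follows a |gam| <= 1, the hypothesis of
   [clip_shift] on c. *)
pose X := M * (H + 2); pose Y := e * (`|gam| + 1).
have X0 : 0 < X by rewrite mulr_gt0//; lra.
have Y0 : 0 < Y by rewrite mulr_gt0//; have := normr_ge0 gam; lra.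
pose a := e / (X + Y); have a0 : 0 < a by rewrite divr_gt0// addr_gt0.
have aXY : a * X + a * Y = e.
  by rewrite -mulrDr divfK// gt_eqF// addr_gt0.
have aX : a * X <= e by have := mulr_gt0 a0 Y0; lra.
have ag : a * `|gam| <= 1.
  have aY : a * Y <= e by have := mulr_gt0 a0 X0; lra.
  have : e * (a * (`|gam| + 1)) <= e * 1 by rewrite mulr1 mulrCA.
  by rewrite (ler_pM2l e0); have := normr_ge0 gam; lra.
pose c := a * gam; have nc : `|c| = a * `|gam| by rewrite normrM gtr0_norm.
have [Q [b [[nu [u [v [Qu Pv err0]]]] bc wk]]] := S_local_limit Vh a0.
have sah : sq_integrable P (fun t => a * h t) by exact: sq_integrableZ.
have ah0 : \int[P]_t (a * h t) = 0.
  by rewrite (RintegralZl _ measurableT (sq_integrable_integrable sh)) h0 mulr0.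
have ah2 : \int[P]_t ((a * h t) ^+ 2) = a ^+ 2 * H.
  rewrite -(RintegralZl _ measurableT sh.2); apply: Rintegral_ext => t.
  by rewrite exprMn.
have a20 : 0 < a ^+ 2 by exact: exprn_gt0.
have expn := local_expansion Qu Pv sah ah0 err0 M0 a20; rewrite ah2 in expn.
have cclip : continuous (fun y => clip M (y + c)).
  move=> y; apply: (@continuous_comp _ _ _ (fun y => y + c) (clip M)).
    by apply: cvgD; [exact: cvg_id|exact: cvg_cst].
  exact: continuous_clip.
pose eta := M * a ^+ 2 / 4.
have eta0 : 0 < eta by rewrite divr_gt0// mulr_gt0.
have l1 : \int[iid (Q n) n]_x clip M (S x - b n + c) @[n --> \oo] -->
    \int[G]_z clip M (z + c).
  by apply: wk => //; exists M => y; exact: clip_norm_le.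
have l2 : \int[iid P n]_x clip M (S x) @[n --> \oo] --> \int[G]_z clip M z.
  apply: S_limit; first exact: continuous_clip.
  by exists M => y; exact: clip_norm_le.
have c1 : `|c| <= 1 by rewrite nc.
have shift := clip_normal_shift c1.
move/cvgrPdist_le : l1 => /(_ _ eta0) l1.
move/cvgrPdist_le : l2 => /(_ _ eta0) l2.
move/cvgrPdist_le : bc => /(_ _ eta0) bc; rewrite -/gam -/c in bc.
near=> n.
have b1 : `|c - b n| <= eta by near: n.
have b2 : `|\int[G]_z clip M (z + c) -
   \int[iid (Q n) n]_x clip M (S x - b n + c)| <= eta by near: n.
have b3 : `|\int[G]_z clip M z - \int[iid P n]_x F x| <= eta by near: n.
have b4 : `|\int[iid (Q n) n]_x F x - \int[iid P n]_x F x -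
    \int[iid P n]_x (F x * ((Num.sqrt n%:R)^-1 * tsum (fun t => a * h t) x))| <=
    M * (a ^+ 2 * H + a ^+ 2).
  have E : forall F : n.-tuple T -> R, measurable_fun setT F -> (forall x, `|F x| <= M) ->
     `|\int[iid (Q n) n]_x F x - \int[iid P n]_x F x -
       \int[iid P n]_x (F x * ((Num.sqrt n%:R)^-1 * tsum (fun t => a * h t) x))| <=
      M * (a ^+ 2 * H + a ^+ 2) by near: n.
  by apply: E; [exact: mF|exact: FM].
have iFD : Rintegrable (iid P n) (fun x => F x * D h x).
  exact: (sq_integrable_mul (sF (iid P n)) (sqD n sh)).
have e1 : \int[iid P n]_x (F x * ((Num.sqrt n%:R)^-1 * tsum (fun t => a * h t) x)) =
    a * \int[iid P n]_x (F x * D h x).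
  rewrite -(RintegralZl _ measurableT iFD); apply: Rintegral_ext => x.
  by rewrite /D /tsum -mulr_sumr; ring.
rewrite e1 in b4.
(* The weak limit under the local law concerns S - b n; the Lipschitz bound of [clip] exchanges S
   with S - b n + c at cost |c - b n|. *)
have b5 : `|\int[iid (Q n) n]_x F x - \int[iid (Q n) n]_x clip M (S x - b n + c)| <= eta.
  have i1 : Rintegrable (iid (Q n) n) (@F n) := sq_integrable_integrable (sF _).
  have i2 : Rintegrable (iid (Q n) n) (fun x => clip M (S x - b n + c)).
    apply: (@Rintegrable_bounded _ _ _ _ _ M); last by move=> x; exact: clip_norm_le.
    apply: measurableT_comp mclip _; apply: measurable_funD => //.
    exact: (measurable_funB (@mS n) (measurable_cst (b n))).
  apply: le_trans b1; rewrite -(RintegralB measurableT i1 i2).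
  rewrite -[X in _ <= X](Rintegral_prob_cst (iid (Q n) n)).
  apply: (Rintegral_norm_le (RintegrableB i1 i2)) => [|x].
    exact: finite_measure_integrable_cst.
  apply: (le_trans (clip_lipschitz _ _ M0)).
  have -> : S x - (S x - b n + c) = - (c - b n) by ring.
  by rewrite normrN.
rewrite -(ler_pM2l a0) -[X in X * _ <= _](gtr0_norm a0) -normrM.
set EF := \int[iid P n]_x (F x * D h x) in b4 *.
set Q1 := \int[iid (Q n) n]_x F x in b4 b5 *.
set P1 := \int[iid P n]_x F x in b3 b4 *.
set Q2 := \int[iid (Q n) n]_x clip M _ in b2 b5 *.
set G1 := \int[G]_z clip M (z + c) in shift b2 *.
set G0 := \int[G]_z clip M z in shift b3 *.
have aX' : a * (a * X) <= a * e by rewrite ler_pM2l.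
have aXe : a * (a * X) = M * (a ^+ 2 * H + a ^+ 2) + (eta + eta + eta + eta).
  by rewrite /X /eta; field.
have -> : a * (EF - gam) = - (Q1 - P1 - a * EF) + ((Q1 - Q2) - (G1 - Q2) +
  (G0 - P1) + (G1 - G0 - c)) by rewrite /c; ring.
apply: le_trans (ler_normD _ _) _; rewrite normrN.
have -> : a * (`|gam| * tau + e) = a * e + `|c| * tau by rewrite nc; ring.
have t1 := ler_normD (Q1 - Q2 - (G1 - Q2) + (G0 - P1)) (G1 - G0 - c).
have t2 := ler_normD (Q1 - Q2 - (G1 - Q2)) (G0 - P1).
have t3 := ler_normB (Q1 - Q2) (G1 - Q2).
lra.
Unshelve. all: by end_near. Qed.

(** Approximating psi by h in V moves both sides by a multiple of |psi - h|, uniformly in n: [D] is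
    linear and preserves the L2 norm of centred functions, and F is bounded by M. *)
Let covariance_psi e : 0 < e -> \forall n \near \oo,
  `|\int[iid P n]_x (F x * D psi x) - sigma2| <= sigma2 * tau + e.
Proof.
move=> e0; pose s0 := Num.sqrt sigma2.
have s00 : 0 <= s0 by exact: sqrtr_ge0.
have s0E : s0 ^+ 2 = sigma2 by rewrite sqr_sqrtr.
have st0 : 0 <= s0 * tau by exact: mulr_ge0.
(* M, s0 tau and s0 are the factors of [del] in the errors from the covariance, from |gam| tau and
   from |sigma2 - gam|; the 1 keeps X positive. *)
pose X := M + s0 * tau + s0 + 1.
have X0 : 0 < X by rewrite /X; have := M0; lra.
pose del := e / 2 / X; have del0 : 0 < del by rewrite !divr_gt0.
have delX : del * X = e / 2 by rewrite divfK// gt_eqF.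
have [h Vh hd] := psi_adherent del0; have [sh h0] := V_sq Vh.
have sk := sq_integrableB spsi sh.
have k0 : \int[P]_t (psi t - h t) = 0.
  rewrite (RintegralB measurableT (sq_integrable_integrable spsi)
    (sq_integrable_integrable sh)).
  by rewrite psi_mean0 h0 subr0.
set gam := \int[P]_t (psi t * h t).
have gamd : `|sigma2 - gam| <= s0 * del.
  have -> : sigma2 - gam = \int[P]_t (psi t * (psi t - h t)).
    rewrite /sigma2 /gam -(RintegralB measurableT spsi.2 (sq_integrable_mul spsi sh)).
    by apply: Rintegral_ext => t; ring.
  by apply: cauchy_schwarz_le => //; [exact: ltW|rewrite s0E].
have e20 : 0 < e / 2 by rewrite divr_gt0.
have near_h := covariance_V Vh e20; rewrite -/gam in near_h.
near=> n.
have n0 : (0 < n)%N by near: n; exists 1%N.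
have c1 : `|\int[iid P n]_x (F x * D h x) - gam| <= `|gam| * tau + e / 2 by near: n.
have sF' := sF (iid P n); have i1 := sq_integrable_mul sF' (sqD n spsi).
have i2 := sq_integrable_mul sF' (sqD n sh).
have c2 : `|\int[iid P n]_x (F x * D psi x) - \int[iid P n]_x (F x * D h x)| <= M * del.
  rewrite -(RintegralB measurableT i1 i2).
  have -> : \int[iid P n]_x (F x * D psi x - F x * D h x) =
      \int[iid P n]_x (F x * D (fun t => psi t - h t) x).
    by apply: Rintegral_ext => x; rewrite /D /tsum sumrB; ring.
  apply: cauchy_schwarz_le => //; [exact: sqD|exact: ltW| |by rewrite D_sqr].
  rewrite -[X in _ <= X](Rintegral_prob_cst (iid P n)).
  apply: Rintegral_le; [exact: sF'.2|exact: finite_measure_integrable_cst|move=> x].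
  by rewrite -(real_normK (num_real (F x))) lerXn2r// nnegrE.
have gle : `|gam| * tau <= (sigma2 + s0 * del) * tau.
  rewrite ler_wpM2r//; have -> : gam = sigma2 - (sigma2 - gam) by ring.
  by apply: (le_trans (ler_normB _ _)); rewrite (ger0_norm sigma2_ge0) lerD.
set a1 := \int[iid P n]_x (F x * D psi x) in c2 *.
set a2 := \int[iid P n]_x (F x * D h x) in c1 c2 *.
have -> : a1 - sigma2 = (a1 - a2) + (a2 - gam) - (sigma2 - gam) by ring.
apply: (le_trans (ler_normB _ _)).
have t1 := ler_normD (a1 - a2) (a2 - gam).
move: delX; rewrite /X => delX.
have -> : sigma2 * tau + e = sigma2 * tau + e / 2 + del * (M + s0 * tau + s0 + 1).
  by rewrite delX; lra.
lra.
Unshelve. all: by end_near. Qed.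

(** |S - D| is at most the clipping error of S plus |r| with r = F - D, and |r| <= eta + r^2 / eta.
    The mean of r^2 is at most (sigma2 + e) - 2 (sigma2 - sigma2 tau - e) + sigma2, where the terms
    sigma2 cancel. For the mean of F^2 an upper bound suffices, and clipping only decreases
    squares. *)
Lemma clip_error eta e : 0 < eta -> 0 < e -> \forall n \near \oo,
  \int[iid P n]_x Num.min 1 `|S x - D psi x| <=
  tau + e + eta + eta^-1 * (2 * (sigma2 * tau) + 3 * e).
Proof.
move=> eta0 e0.
pose phi (y : R) := Num.min 1 `|y - clip M y|.
have cphi : continuous phi.
  move=> y; apply: (@continuous_min _ _ (cst 1) (fun y => `|y - clip M y|)).
    exact: cvg_cst.
  apply: cvg_norm; apply: cvgB; [exact: cvg_id|exact: continuous_clip].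
have phi1 y : `|phi y| <= 1.
  by have /andP[a b] := min1_norm01 (y - clip M y); rewrite ger0_norm.
pose sqc (y : R) := clip M y ^+ 2.
have csqc : continuous sqc.
  move=> y; rewrite /sqc; under eq_fun do rewrite expr2.
  by apply: cvgM; exact: continuous_clip.
have sqcM y : `|sqc y| <= M ^+ 2.
  by rewrite normrX lerXn2r ?nnegrE//; exact: clip_norm_le.
have iG (f : R -> R) B : continuous f -> (forall y, `|f y| <= B) -> Rintegrable G f.
  move=> cf fB; apply: (@Rintegrable_bounded _ (measurableTypeR R) _ G _ B) => //.
  exact: continuous_measurable_fun.
have p1 : \int[G]_z phi z <= tau.
  rewrite /tau -EG2 -(RintegralZl _ measurableT iG2).
  apply: Rintegral_le; [exact: iG phi1|exact: RintegrableZ|move=> z].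
  exact: clip_tail.
have p2 : \int[G]_z sqc z <= sigma2.
  rewrite -EG2; apply: Rintegral_le; [exact: iG sqcM|exact: iG2|move=> z].
  exact: clip_sqr_le.
have l1 := S_limit cphi (ex_intro _ 1 phi1).
have l2 := S_limit csqc (ex_intro _ (M ^+ 2) sqcM).
move/cvgrPdist_le : l1 => /(_ _ e0) l1.
move/cvgrPdist_le : l2 => /(_ _ e0) l2.
have l3 := covariance_psi e0.
near=> n.
have n0 : (0 < n)%N by near: n; exists 1%N.
have q1 : `|\int[G]_z phi z - \int[iid P n]_x phi (S x)| <= e by near: n.
have q2 : `|\int[G]_z sqc z - \int[iid P n]_x sqc (S x)| <= e by near: n.
have q3 : `|\int[iid P n]_x (F x * D psi x) - sigma2| <= sigma2 * tau + e by near: n.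
have sF' := sF (iid P n); have sDp := sqD n spsi.
have sDn := sq_integrableZ (-1) sDp.
have sFD := sq_integrableD sF' sDn.
have q4 : \int[iid P n]_x ((F x + -1 * D psi x) ^+ 2) =
    \int[iid P n]_x sqc (S x) - 2 * \int[iid P n]_x (F x * D psi x) + sigma2.
  rewrite (Rintegral_sqrD sF' sDn).
  have -> : \int[iid P n]_x (F x * (-1 * D psi x)) = - \int[iid P n]_x (F x * D psi x).
    rewrite -[RHS]mulN1r -(RintegralZl _ measurableT (sq_integrable_mul sF' sDp)).
    by apply: Rintegral_ext => x; ring.
  have -> : \int[iid P n]_x ((-1 * D psi x) ^+ 2) = sigma2.
    by rewrite -[RHS](D_sqr spsi psi_mean0 n0); apply: Rintegral_ext => x; ring.
  by rewrite /sqc; ring.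
have q5 : \int[iid P n]_x ((F x + -1 * D psi x) ^+ 2) <= 2 * (sigma2 * tau) + 3 * e.
  rewrite q4; move/ler_normlP : q2 => [q21 q22]; move/ler_normlP : q3 => [q31 q32].
  lra.
have mSn : measurable_fun setT (@S n) by exact: mS.
have iphi : Rintegrable (iid P n) (fun x => phi (S x)).
  apply: (@Rintegrable_bounded _ _ _ _ _ 1) => //.
  by apply: measurableT_comp mSn; exact: continuous_measurable_fun.
have ieta : Rintegrable (iid P n) (fun=> eta) by exact: finite_measure_integrable_cst.
have iq := RintegrableZ eta^-1 sFD.2.
have mm : forall n, measurable_fun setT (fun x : n.-tuple T => S x - D psi x).
  move=> m; apply: measurable_funB; first exact: mS.
  by case: (sqD m spsi).
have bound : \int[iid P n]_x Num.min 1 `|S x - D psi x| <=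
    \int[iid P n]_x (phi (S x) + (eta + eta^-1 * (F x + -1 * D psi x) ^+ 2)).
  apply: Rintegral_le.
  - exact: (Rintegrable_min1_norm mm (iid P n)).
  - exact: (RintegrableD iphi (RintegrableD ieta iq)).
  move=> x; set r := F x + -1 * D psi x.
  have r1 : `|r| <= eta + eta^-1 * r ^+ 2.
    have [re|er] := leP `|r| eta.
      by rewrite (le_trans re)// lerDl mulr_ge0 ?invr_ge0 ?sqr_ge0// ltW.
    apply: (@le_trans _ _ (eta^-1 * r ^+ 2)); last by rewrite lerDr ltW.
    rewrite mulrC ler_pdivlMr// -(real_normK (num_real r)) expr2.
    by rewrite ler_wpM2l// ltW.
  have r2 : `|S x - D psi x| <= `|S x - clip M (S x)| + `|r|.
    have -> : S x - D psi x = (S x - clip M (S x)) + r by rewrite /r /F; ring.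
    exact: ler_normD.
  have r3 := normr_ge0 r.
  rewrite /phi; case: (leP 1 `|S x - clip M (S x)|) => h1; last first.
    by rewrite ge_min; apply/orP; right; lra.
  by rewrite ge_min; apply/orP; left; lra.
apply: (le_trans bound).
rewrite (RintegralD measurableT iphi (RintegrableD ieta iq)).
rewrite (RintegralD measurableT ieta iq) Rintegral_prob_cst.
rewrite (RintegralZl _ measurableT sFD.2).
have q6 : eta^-1 * \int[iid P n]_x ((F x + -1 * D psi x) ^+ 2) <=
    eta^-1 * (2 * (sigma2 * tau) + 3 * e) by rewrite ler_wpM2l// invr_ge0 ltW.
move/ler_normlP : q1 => [q11 q12]; lra.
Unshelve. all: by end_near. Qed.

End truncated.

(** [clip_error] holds for each fixed N with a bound that vanishes as tau, e and eta do; so eta is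
    chosen first, then N, then the tolerance in n, whose sizes are measured against eta. *)
Lemma regular_asymptotically_linear :
  cvg_in_prob0 (iid P) (fun n x => S x - (Num.sqrt n%:R)^-1 * tsum psi x).
Proof.
have mm : forall n, measurable_fun setT (fun x : n.-tuple T => S x - D psi x).
  move=> m; apply: measurable_funB; first exact: mS.
  by case: (sqD m spsi).
apply/(cvg_in_prob0P _ mm); apply/cvgrPdist_le => /= e e0.
pose eta := e / 4; have eta0 : 0 < eta by rewrite divr_gt0.
(* The total coefficient of tau in [clip_error]. The N below satisfies N >= 1 and N >= sigma2 / kap,
   hence tau <= kap = eta / A. *)
pose A := 1 + eta^-1 * (2 * sigma2).
have A1 : 1 <= A by rewrite lerDl mulr_ge0 ?mulr_ge0// invr_ge0 ltW.
have A0 : 0 < A by lra.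
pose kap := eta / A; have kap0 : 0 < kap by exact: divr_gt0.
pose N := 1 + sigma2 / kap.
have sk0 : 0 <= sigma2 / kap by rewrite divr_ge0// ltW.
have N1 : 1 <= N by rewrite lerDl.
have N0 : 0 < N by lra.
have tauk : (N ^+ 2)^-1 * sigma2 <= kap.
  rewrite mulrC ler_pdivrMr ?exprn_gt0//.
  have : sigma2 = kap * (sigma2 / kap) by rewrite mulrC divfK// gt_eqF.
  move=> {1}->; rewrite ler_pM2l//; apply: (@le_trans _ _ N); first by rewrite /N; lra.
  by rewrite expr2 ler_peMr// ltW.
(* Makes e1 / eta at most eta / 8. In total the bound is at most eta + eta / 2 + eta + 3 eta / 8,
   below 4 eta = e. *)
pose e2 := eta * eta / 8; have e20 : 0 < e2 by rewrite !divr_gt0// mulr_gt0.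
pose e1 := Num.min (eta / 2) e2.
have e10 : 0 < e1 by rewrite lt_min e20 divr_gt0.
have e1a : e1 <= eta / 2 by rewrite ge_min lexx.
have e1b : e1 <= e2 by rewrite ge_min lexx orbT.
have near_n := clip_error N0 eta0 e10.
near=> n.
have H : \int[iid P n]_x Num.min 1 `|S x - D psi x| <=
  (N ^+ 2)^-1 * sigma2 + e1 + eta +
  eta^-1 * (2 * (sigma2 * ((N ^+ 2)^-1 * sigma2)) + 3 * e1) by near: n.
rewrite sub0r normrN ger0_norm; last first.
  by apply: Rintegral_ge0 => x _; have /andP[] := min1_norm01 (S x - D psi x).
apply: (le_trans H); set tau := (N ^+ 2)^-1 * sigma2 in tauk *.
have -> : tau + e1 + eta + eta^-1 * (2 * (sigma2 * tau) + 3 * e1) =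
  tau * A + e1 + eta + 3 * (eta^-1 * e1) by rewrite /A; ring.
have h1 : tau * A <= eta by rewrite -ler_pdivlMr.
have h2 : eta^-1 * e1 <= eta / 8.
  rewrite mulrC ler_pdivrMr//; apply: (le_trans e1b).
  by rewrite /e2; lra.
by move: h1 h2 e1a; rewrite /eta; lra.
Unshelve. all: by end_near. Qed.

End linearity_from_regularity.

Lemma root_rate_cvg (R : realType) (f : R -> R) (a l : R) :
  t^-1 * (f t - a) @[t --> 0^'+] --> l ->
  Num.sqrt n%:R * (f (Num.sqrt n%:R)^-1 - a) @[n --> \oo] --> l.
Proof.
move=> /(cvg_comp _ _ (@invsqrt_cvg_right R)); apply: cvg_trans.
by apply: near_eq_cvg; apply: nearW => n; rewrite /= invrK.
Qed.

Lemma eq_weak_cvg (d : measure_display) (T : measurableType d) (R : realType)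
    (Q : forall n, probability (n.-tuple T) R) (Z Z' : forall n, n.-tuple T -> R)
    (L : probability (measurableTypeR R) R) :
  (forall n x, Z n x = Z' n x) -> weak_cvg Q Z L -> weak_cvg Q Z' L.
Proof.
move=> ZZ' ZL f cf bf; apply: cvg_trans (ZL f cf bf).
apply: near_eq_cvg; apply: nearW => n.
by apply: Rintegral_ext => x; rewrite ZZ'.
Qed.

(** * Efficiency and asymptotic linearity *)

Section efficiency.
Context (R : realType) (d : measure_display) (T : measurableType d).
Variables (calP : set (probability T R)) (P : probability T R).
Hypothesis calP_P : calP P.
Variable TS : set (L2 P).
Hypothesis TS_L20 : TS `<=` @L20 d T R P.
Hypothesis H1 : assumption1 calP TS.
Variables (Psi : probability T R -> R) (gamma : L2 P -> R).
Hypothesis Psi_diff : directionally_differentiable calP TS Psi gamma.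
Variable V : set (L2 P).
Hypothesis V_subspace : linear_subspace V.
Hypothesis V_TS : V `<=` TS.
Hypothesis gamma_linear : linear_on V gamma.
Variable psi : L2 P.
Hypothesis psi_rep : riesz_representer V gamma psi.

Let L2closure_subset (h : L2 P) : V h -> L2closure V h.
Proof.
move=> Vh e e0; exists h => //; rewrite subrr.
have : L2norm (0 : L2 P) ^+ 2 = 0.
  rewrite L2norm_sqr -[RHS](Rintegral_prob_cst P); apply: Rintegral_ext => x.
  by rewrite /= expr0n.
by move/eqP; rewrite sqrf_eq0 => /eqP ->.
Qed.

(** The closure of V stays inside the closed tangent space, whose elements are centred. *)
Let psi_mean0 : \int[P]_t psi t = 0.
Proof.
apply: TS_L20; apply: H1.1 => e e0; have [k Vk ke] := psi_rep.1 e e0.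
by exists k => //; exact: V_TS.
Qed.

Let gammaE h : V h -> gamma h = L2inner psi h.
Proof.
move=> Vh; have [_ [g [gV _ gpsi]]] := psi_rep.
by rewrite -gV// gpsi//; exact: L2closure_subset.
Qed.

Let VZ a h : V h -> V (a *: h).
Proof. by move=> Vh; rewrite -[a *: h]addr0; apply: V_subspace.2 => //; exact: V_subspace.1. Qed.

Let gammaZ a h : V h -> gamma (a *: h) = a * gamma h.
Proof.
move=> Vh; have V0 := V_subspace.1.
have g0 : gamma 0 = 0.
  have := gamma_linear 1 V0 V0; rewrite scaler0 addr0 mul1r => e.
  by apply: (addIr (gamma 0)); rewrite add0r -e.
by rewrite -[a *: h]addr0 gamma_linear// g0 addr0.
Qed.

Let mT (Tn : estimator T R) (c : R) n :
  measurable_fun setT (fun x : n.-tuple T => Num.sqrt n%:R * (Tn n x - c)).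
Proof. by apply: measurable_funM => //; apply: measurable_funB. Qed.

(** Differentiability sends sqrt n (Psi(P_n) - Psi(P)) to gamma h = <psi, h>, exactly the drift that
    the change of law gives to the score sum of psi; the two cancel, and the limit is the same for
    every h. *)
Lemma asymptotically_linear_efficient (Tn : estimator T R) :
  asymptotically_linear Psi psi Tn -> efficient calP Psi V psi Tn.
Proof.
move=> lin h Vh Pt path; rewrite L2norm_sqr /=.
have seqh := DQM_path_sequence path.
have rate := root_rate_cvg (Psi_diff.2 h (V_TS Vh) Pt path).
have ge : gamma h = \int[P]_t (h t * psi t).
  by rewrite gammaE//; apply: Rintegral_ext => t; rewrite mulrC.
rewrite ge in rate.
apply: eq_weak_cvg (linear_weak_cvg seqh (sq_integrable_L2 h) (sq_integrable_L2 psi) psi_mean0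
  (mT Tn (Psi P)) rate lin) => n x; ring.
Qed.

(** V contains a h along with h, and the tangent-space assumption provides a path with that score;
    linearity of gamma gives the limit a <psi, h> of the centring, which is the input of the
    covariance argument. *)
Lemma efficient_asymptotically_linear (Tn : estimator T R) :
  efficient calP Psi V psi Tn -> asymptotically_linear Psi psi Tn.
Proof.
move=> eff; rewrite /efficient L2norm_sqr in eff.
have spsi := sq_integrable_L2 psi.
apply: (@regular_asymptotically_linear _ _ _ P [set (h : T -> R) | h in V] psi
  (fun n x => Num.sqrt n%:R * (Tn n x - Psi P))).
- by move=> n; exact: mT.
- exact: spsi.
- exact: psi_mean0.
- by move=> _ [h Vh <-]; split; [exact: sq_integrable_L2|exact/TS_L20/V_TS].
- move=> e e0; have [k Vk ke] := psi_rep.1 e e0.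
  exists (k : T -> R); first by exists k.
  have := L2norm_sqr (psi - k) => /= <-.
  by rewrite lerXn2r ?nnegrE ?L2norm_ge0 ?ltW.
(* The limit under P is regularity in the direction 0, along the constant path. *)
- exact: (eff 0 V_subspace.1 _ (DQM_path_constant calP_P)).
move=> _ a [h Vh <-] a0; have Vah := VZ a Vh.
have [Pt path] := H1.2 _ (V_TS Vah).
exists (fun n => Pt (Num.sqrt n%:R)^-1).
exists (fun n => Num.sqrt n%:R * (Psi (Pt (Num.sqrt n%:R)^-1) - Psi P)); split.
- exact: DQM_path_sequence path.
- have := root_rate_cvg (Psi_diff.2 _ (V_TS Vah) Pt path).
  by rewrite gammaZ// gammaE.
by apply: eq_weak_cvg (eff _ Vah Pt path) => n x; ring.
Qed.

End efficiency.

(** The score sums and Psi(P) cancel in the difference, which leaves the difference of two vanishing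
    remainders. *)
Lemma asymptotically_linear_equivalent (R : realType) (d : measure_display)
    (T : measurableType d) (P : probability T R) (Psi : probability T R -> R)
    (psi : L2 P) (Tn Tn' : estimator T R) :
  asymptotically_linear Psi psi Tn -> asymptotically_linear Psi psi Tn' ->
  cvg_in_prob0 (iid P) (fun n x => Num.sqrt n%:R * (Tn n x - Tn' n x)).
Proof.
move=> lin lin'.
pose Z (U : estimator T R) n (x : n.-tuple T) := Num.sqrt n%:R * (U n x - Psi P)
  - (Num.sqrt n%:R)^-1 * \sum_(i < n) psi (tnth x i).
have mZ U n : measurable_fun setT (@Z U n).
  apply: measurable_funB; first by apply: measurable_funM => //; exact: measurable_funB.
  by apply: measurable_funM => //; exact: (@measurable_tsum _ _ _ n psi (measurable_L2 psi)).
pose W n (x : n.-tuple T) := Num.sqrt n%:R * (Tn n x - Tn' n x).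
have mW n : measurable_fun setT (@W n).
  by apply: measurable_funM => //; exact: measurable_funB.
apply/(cvg_in_prob0P _ mW).
have c1 := (cvg_in_prob0P (iid P) (mZ Tn)).1 lin.
have c2 := (cvg_in_prob0P (iid P) (mZ Tn')).1 lin'.
have c3 : \int[iid P n]_x Num.min 1 `|Z Tn n x| + \int[iid P n]_x Num.min 1 `|Z Tn' n x|
    @[n --> \oo] --> 0.
  by rewrite -[X in _ --> X](addr0 0); apply: cvgD.
apply: (cvg_squeeze0 _ c3) => n.
have i1 := Rintegrable_min1_norm (mZ Tn) (iid P n).
have i2 := Rintegrable_min1_norm (mZ Tn') (iid P n).
rewrite subr0 -(RintegralD measurableT i1 i2).
apply: (Rintegral_norm_le (Rintegrable_min1_norm mW (iid P n)) (RintegrableD i1 i2)) => x.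
have /andP[w0 w1] := min1_norm01 (W n x); rewrite (ger0_norm w0).
have /andP[z0 _] := min1_norm01 (Z Tn n x); have /andP[z0' _] := min1_norm01 (Z Tn' n x).
have : `|W n x| <= `|Z Tn n x| + `|Z Tn' n x|.
  have -> : W n x = Z Tn n x - Z Tn' n x by rewrite /W /Z; ring.
  exact: ler_normB.
move: z0 z0' w1; case: (leP 1 `|W n x|); case: (leP 1 `|Z Tn n x|);
  case: (leP 1 `|Z Tn' n x|) => *; lra.
Qed.

Theorem theorem5 (R : realType) (d : measure_display) (T : measurableType d)
    (calP : set (probability T R)) (P : probability T R) (calP_P : calP P)
    (TS : set (L2 P)) (TS_subspace : linear_subspace TS)
    (TS_L20 : TS `<=` @L20 d T R P)
    (H1 : assumption1 calP TS)
    (Psi : probability T R -> R) (gamma : L2 P -> R)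
    (Psi_diff : directionally_differentiable calP TS Psi gamma)
    (V : set (L2 P)) (V_subspace : linear_subspace V) (V_TS : V `<=` TS)
    (gamma_linear : linear_on V gamma)
    (psi : L2 P) (psi_rep : riesz_representer V gamma psi) :
  (forall Tn : estimator T R,
     efficient calP Psi V psi Tn <-> asymptotically_linear Psi psi Tn) /\
  (forall Tn Tn' : estimator T R,
     efficient calP Psi V psi Tn -> efficient calP Psi V psi Tn' ->
     cvg_in_prob0 (iid P) (fun n x => Num.sqrt n%:R * (Tn n x - Tn' n x))).
Proof.
have linear Tn : efficient calP Psi V psi Tn -> asymptotically_linear Psi psi Tn.
  exact: (efficient_asymptotically_linear calP_P TS_L20 H1 Psi_diff V_subspace
    V_TS gamma_linear psi_rep).
split=> [Tn|Tn Tn' /linear lin /linear lin'].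
  split; first exact: linear.
  exact: (asymptotically_linear_efficient TS_L20 H1 Psi_diff V_TS psi_rep).
exact: asymptotically_linear_equivalent lin lin'.
Qed.
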